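(* There is a unique linear connection $\nabla$ on $V$ such that (i) $T_{1,0}(\mathcal{F})$ is parallel with respect to $\nabla$; (ii) $\nabla L_\theta=0$, $\nabla T=0$, $\nabla N=0$; (iii) the torsion $T_\nabla$ is pure, i.e., with $\tau(X)=T_\nabla(T,X)$ for $X\in T(V)$, $$T_\nabla(Z,W)=0,\quad T_\nabla(Z,\overline W)=2iL_\theta(Z,\overline W)T,\quad T_\nabla(N,W)=rW+i\,\tau(W)$$ for any $Z,W\in T_{1,0}(\mathcal{F})$, and $$\tau(T_{1,0}(\mathcal{F}))\subseteq T_{0,1}(\mathcal{F}),\qquad\tau(N)=-J\nabla^Hr-2rT.$$
   Context: Let $\Omega=\{\varphi<0\}\subset\mathbb{C}^n$ be a smoothly bounded strictly pseudoconvex domain ($\varphi$ a smooth defining function). Let $V$ be a one-sided neighborhood of $\partial\Omega$ foliated by the level sets $M_\delta=\{\varphi=-\delta\}$ of $\varphi$, which are strictly pseudoconvex CR manifolds of CR dimension $n-1$; denote this foliation by $\mathcal{F}$ and its tangent bundle by $T(\mathcal{F})\subset T(V)$. $H(\mathcal{F})\to V$ (respectively $T_{1,0}(\mathcal{F})\to V$) is the bundle whose restriction to each $M_\delta$ is the Levi distribution $H(M_\delta)$ (respectively the CR structure $T_{1,0}(M_\delta)$); $T_{0,1}(\mathcal{F})=\overline{T_{1,0}(\mathcal{F})}$; $J$ is the complex structure of $\mathbb{C}^n$. Set $\theta=\frac i2(\overline\partial-\partial)\varphi$, so $d\theta=i\,\partial\overline\partial\varphi$ (convention: $2(d\theta)(X,Y)=X\theta(Y)-Y\theta(X)-\theta([X,Y])$,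 $\alpha\wedge\beta=\frac12(\alpha\otimes\beta-\beta\otimes\alpha)$), and $L_\theta(Z,\overline W)=-i(d\theta)(Z,\overline W)$ for $Z,W\in T_{1,0}(\mathcal{F})$. Let $\xi$ be the unique complex vector field of type $(1,0)$ on $V$ with $\partial\varphi(\xi)=1$ and $\partial\overline\partial\varphi(\xi,\overline Z)=0$ for all $Z\in T_{1,0}(\mathcal{F})$. Write $\xi=\frac12(N-iT)$ with $N,T$ real vector fields, and $r=2\,\partial\overline\partial\varphi(\xi,\overline\xi)$ (the transverse curvature). Then $d\varphi(N)=2$, $d\varphi(T)=0$, $\theta(N)=0$, $\theta(T)=1$, and $T(\mathcal{F})=H(\mathcal{F})\oplus\mathbb{R}T$, with projection $\pi_H:T(\mathcal{F})\to H(\mathcal{F})$. $g_\theta$ is the Riemannian metric in $T(\mathcal{F})$ with $g_\theta(X,Y)=(d\theta)(X,JY)$, $g_\theta(X,T)=0$, $g_\theta(T,T)=1$ for $X,Y\in H(\mathcal{F})$. $\nabla^Hr=\pi_H\nabla r$, where $\nabla r\in T(\mathcal{F})$ is given by $g_\theta(\nabla r,X)=X(r)$ for $X\in T(\mathcal{F})$. *)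

(* Defs.v *)
From HB Require Import structures.
From mathcomp Require Import all_boot all_order all_algebra.
From mathcomp Require Import complex.
From mathcomp Require Import all_classical all_reals all_analysis.
Set Implicit Arguments.
Unset Strict Implicit.
Unset Printing Implicit Defensive.
Import Order.TTheory GRing.Theory Num.Theory.
Import numFieldNormedType.Exports.
Local Open Scope classical_set_scope.
Local Open Scope complex_scope.
Local Open Scope ring_scope.

(* C^n is R^(n+n) with coordinates (x_1, ..., x_n, y_1, ..., y_n) and
   z_j = x_j + i y_j.  A real (resp. complexified) tangent vector is its row of
   real (resp. complex) coefficients on the frame (d/dx_j, d/dy_j).  Fields and
   functions are total; only their values on the set V at hand matter. *)

Section Smooth.
Variables (R : realType) (E W : normedModType R).

Fixpoint Ck (k : nat) (V : set E) (f : E -> W) : Prop :=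
  match k with
  | 0 => forall p, V p -> {for p, continuous f}
  | k'.+1 => (forall p, V p -> differentiable f p) /\
             (forall v : E, Ck k' V ('D_v f))
  end.

Definition smooth_on (V : set E) (f : E -> W) : Prop := forall k, Ck k V f.

End Smooth.

Section CnCalculus.
Variables (R : realType) (n : nat).
Let E : Type := 'rV[R]_(n + n).
Let EC : Type := 'rV[R[i]]_(n + n).
Implicit Types (p : 'rV[R]_(n + n)) (v w : 'rV[R[i]]_(n + n)).

Definition re_vec (v : EC) : 'rV[R]_(n + n) := \row_a complex.Re (v 0 a).
Definition im_vec (v : EC) : 'rV[R]_(n + n) := \row_a complex.Im (v 0 a).
Definition cplx (v : E) : 'rV[R[i]]_(n + n) := \row_a (v 0 a)%:C.
Definition conj_vec (v : EC) : 'rV[R[i]]_(n + n) := \row_a ((v 0 a)^*)%C.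

Definition cfield (X : E -> E) : E -> EC := fun p => cplx (X p).
Definition re_field (X : E -> EC) : E -> E := fun p => re_vec (X p).
Definition im_field (X : E -> EC) : E -> E := fun p => im_vec (X p).
Definition conj_field (X : E -> EC) : E -> EC := fun p => conj_vec (X p).

Definition smooth_field (V : set 'rV[R]_(n + n)) (X : E -> E) : Prop :=
  smooth_on V (X : 'rV[R]_(n + n) -> 'rV[R]_(n + n)).
Definition smooth_cfield (V : set 'rV[R]_(n + n)) (X : E -> EC) : Prop :=
  smooth_field V (re_field X) /\ smooth_field V (im_field X).

(* J d/dx_j = d/dy_j and J d/dy_j = - d/dx_j, extended C-linearly *)
Definition Jvec (v : EC) : 'rV[R[i]]_(n + n) :=
  row_mx (- rsubmx v) (lsubmx v).

Definition type10 (v : EC) : Prop := Jvec v = 'i%C *: v.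

(* v(F) at p, C-bilinear in (v, F) *)
Definition cderive (F : E -> R[i]) (p : E) (v : EC) : R[i] :=
  let f : 'rV[R]_(n + n) -> R := fun q => complex.Re (F q) in
  let g : 'rV[R]_(n + n) -> R := fun q => complex.Im (F q) in
  ('D_(re_vec v) f p - 'D_(im_vec v) g p) +i*
  ('D_(re_vec v) g p + 'D_(im_vec v) f p).

Definition bracket (X Y : E -> EC) : E -> EC := fun p =>
  \row_a (cderive (fun q => Y q 0 a) p (X p) -
          cderive (fun q => X q 0 a) p (Y p)).

Definition d_z (j : 'I_n) : EC :=
  2^-1 *: (delta_mx 0 (lshift n j) - 'i%C *: delta_mx 0 (rshift n j)).
Definition d_zb (j : 'I_n) : EC :=
  2^-1 *: (delta_mx 0 (lshift n j) + 'i%C *: delta_mx 0 (rshift n j)).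
Definition dz (j : 'I_n) (v : EC) : R[i] :=
  v 0 (lshift n j) + 'i%C * v 0 (rshift n j).
Definition dzb (j : 'I_n) (v : EC) : R[i] :=
  v 0 (lshift n j) - 'i%C * v 0 (rshift n j).

(* 2 d(alpha)(X,Y) = X alpha(Y) - Y alpha(X) - alpha([X,Y]) *)
Definition extd (alpha : E -> EC -> R[i]) (X Y : E -> EC) (p : E) : R[i] :=
  2^-1 * (cderive (fun q => alpha q (Y q)) p (X p)
          - cderive (fun q => alpha q (X q)) p (Y p)
          - alpha p (bracket X Y p)).

Section DefiningFunction.
Variable phi : 'rV[R]_(n + n) -> R.

Definition phiC : E -> R[i] := fun p => (phi p)%:C.

Definition dphi (p : E) (v : EC) : R[i] := cderive phiC p v.
Definition del (p : E) (v : EC) : R[i] :=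
  \sum_(j < n) cderive phiC p (d_z j) * dz j v.
Definition delbar (p : E) (v : EC) : R[i] :=
  \sum_(j < n) cderive phiC p (d_zb j) * dzb j v.

(* sum_(j,k) phi_(j kbar) dz_j /\ dzbar_k, where
   a /\ b = (a (x) b - b (x) a) / 2 *)
Definition deldelbar (p : E) (v w : EC) : R[i] :=
  \sum_(j < n) \sum_(k < n)
    cderive (fun q => cderive phiC q (d_zb k)) p (d_z j) *
    (2^-1 * (dz j v * dzb k w - dzb k v * dz j w)).

Definition theta (p : E) (v : EC) : R[i] :=
  'i%C / 2 * (delbar p v - del p v).

(* d(theta) is tensorial: its value on tangent vectors is computed on their
   constant extensions. *)
Definition dtheta (p : E) (v w : EC) : R[i] :=
  extd theta (fun=> v) (fun=> w) p.

Definition Ltheta (p : E) (v w : EC) : R[i] := - 'i%C * dtheta p v w.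

(* fibre at p of the CR structure of the level set of phi through p *)
Definition T10 (p : E) (v : EC) : Prop := type10 v /\ dphi p v = 0.
Definition T01 (p : E) (v : EC) : Prop := T10 p (conj_vec v).

Definition regular_at (p : E) : Prop := exists v : 'rV[R]_(n + n), 'D_v phi p != 0.

(* strict pseudoconvexity at p of the level set of phi through p *)
Definition spc_at (p : E) : Prop :=
  forall Z : 'rV[R[i]]_(n + n), T10 p Z -> Z != 0 -> 0 < Ltheta p Z (conj_vec Z).

Definition Omega : set 'rV[R]_(n + n) := [set p | phi p < 0].
Definition bOmega : set 'rV[R]_(n + n) := closure Omega `\` Omega.

Definition smoothly_bounded_spc_domain : Prop :=
  [/\ smooth_on setT (phi : _ -> R^o),
      Omega !=set0 /\ connected Omega,
      bounded_set Omega &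
      forall p, bOmega p -> regular_at p /\ spc_at p].

(* V lies on the inner side of the boundary, and the foliation is that of V by
   the strictly pseudoconvex sets V `&` {phi = - delta}, delta > 0. *)
Definition foliated_one_sided_nbhd (V : set 'rV[R]_(n + n)) : Prop :=
  (exists U : set 'rV[R]_(n + n), [/\ open U, bOmega `<=` U & V = U `&` Omega])
  /\ forall p, V p -> regular_at p /\ spc_at p.

Definition is_xi (V : set 'rV[R]_(n + n)) (xi : E -> EC) : Prop :=
  smooth_cfield V xi /\
  forall p, V p ->
    [/\ type10 (xi p), del p (xi p) = 1 &
        forall Z, T10 p Z -> deldelbar p (xi p) (conj_vec Z) = 0].

Section Transverse.
Variable xi : E -> EC.

(* xi = (N - i T) / 2 *)
Definition Nfield : E -> E := fun p => 2 *: re_vec (xi p).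
Definition Tfield : E -> E := fun p => - 2 *: im_vec (xi p).

Definition curv (p : E) : R[i] := 2 * deldelbar p (xi p) (conj_vec (xi p)).

(* C-linear extension of the projection of T(F) on H(F) along T *)
Definition piH (p : E) (v : EC) : EC := v - theta p v *: cplx (Tfield p).

Definition gtheta (p : E) (v w : EC) : R[i] :=
  dtheta p (piH p v) (Jvec (piH p w)) + theta p v * theta p w.

Definition is_gradient (V : set 'rV[R]_(n + n)) (f : E -> R[i]) (G : E -> E)
  : Prop :=
  forall p, V p ->
    dphi p (cplx (G p)) = 0 /\
    forall v : E, dphi p (cplx v) = 0 ->
      gtheta p (cplx (G p)) (cplx v) = cderive f p (cplx v).

End Transverse.
End DefiningFunction.

(* Linear connection on the open set V.  Agreement of D X Y on V for fields that
   agree on V follows from the C^oo-linearity and Leibniz rules, applied with f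
   the indicator function of the complement of V. *)
Definition is_connection (V : set 'rV[R]_(n + n))
    (D : (E -> E) -> (E -> E) -> (E -> E)) : Prop :=
  let sm := smooth_field V in
  [/\ forall X Y, sm X -> sm Y -> sm (D X Y),
      forall X X' Y, sm X -> sm X' -> sm Y -> forall p, V p ->
        D (fun q => X q + X' q) Y p = D X Y p + D X' Y p,
      forall X Y Y', sm X -> sm Y -> sm Y' -> forall p, V p ->
        D X (fun q => Y q + Y' q) p = D X Y p + D X Y' p,
      forall (f : 'rV[R]_(n + n) -> R^o) X Y,
        smooth_on V f -> sm X -> sm Y -> forall p, V p ->
        D (fun q => f q *: X q) Y p = f p *: D X Y p &
      forall (f : 'rV[R]_(n + n) -> R^o) X Y,
        smooth_on V f -> sm X -> sm Y -> forall p, V p ->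
        D X (fun q => f q *: Y q) p = 'D_(X p) f p *: Y p + f p *: D X Y p].

(* C-bilinear extension to complex vector fields *)
Definition nablaC (D : (E -> E) -> (E -> E) -> (E -> E)) (X Y : E -> EC)
  : E -> EC := fun p =>
  cplx (D (re_field X) (re_field Y) p - D (im_field X) (im_field Y) p) +
  'i%C *: cplx (D (re_field X) (im_field Y) p + D (im_field X) (re_field Y) p).

Definition torsion (D : (E -> E) -> (E -> E) -> (E -> E)) (X Y : E -> EC)
  : E -> EC := fun p =>
  nablaC D X Y p - nablaC D Y X p - bracket X Y p.

Section GrahamLee.
Variables (phi : 'rV[R]_(n + n) -> R) (V : set 'rV[R]_(n + n)).
Variables (xi : E -> EC) (gradr : E -> E).
Variable D : (E -> E) -> (E -> E) -> (E -> E).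
Let T : E -> E := Tfield xi.
Let N : E -> E := Nfield xi.
Let r : E -> R[i] := curv phi xi.
Let L : E -> EC -> EC -> R[i] := Ltheta phi.

Definition T10_section (Z : E -> EC) : Prop :=
  smooth_cfield V Z /\ forall p, V p -> T10 phi p (Z p).

Definition T10_parallel : Prop :=
  forall X Z, smooth_field V X -> T10_section Z ->
    T10_section (nablaC D (cfield X) Z).

Definition L_parallel : Prop :=
  forall X Z W, smooth_field V X -> T10_section Z -> T10_section W ->
  forall p, V p ->
    cderive (fun q => L q (Z q) (conj_field W q)) p (cplx (X p))
    - L p (nablaC D (cfield X) Z p) (conj_field W p)
    - L p (Z p) (nablaC D (cfield X) (conj_field W) p) = 0.

Definition field_parallel (Y : E -> E) : Prop :=
  forall X, smooth_field V X -> forall p, V p -> D X Y p = 0.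

Definition tau (X : E -> EC) : E -> EC := torsion D (cfield T) X.

Definition pure_torsion : Prop :=
  [/\ forall Z W, T10_section Z -> T10_section W -> forall p, V p ->
        torsion D Z W p = 0,
      forall Z W, T10_section Z -> T10_section W -> forall p, V p ->
        torsion D Z (conj_field W) p =
        (2 * 'i%C * L p (Z p) (conj_field W p)) *: cplx (T p),
      forall W, T10_section W -> forall p, V p ->
        torsion D (cfield N) W p = r p *: W p + 'i%C *: tau W p,
      forall W, T10_section W -> forall p, V p -> T01 phi p (tau W p) &
      forall p, V p ->
        tau (cfield N) p =
        - Jvec (piH phi xi p (cplx (gradr p))) - (2 * r p) *: cplx (T p)].

Definition graham_lee_connection : Prop :=
  [/\ is_connection V D,
      T10_parallel,
      [/\ L_parallel, field_parallel T & field_parallel N] &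
      pure_torsion].

End GrahamLee.
End CnCalculus.

(* Main.v *)
(** Let D1, D2, D3 be the C-multilinear derivatives of phi of order 1, 2, 3; then
    2 L(Z, conj W) = D2(Z, conj W), r = D2(xi, conj xi), and the closedness of
    i ddbar phi is the symmetry of D3.  Let pi be the projection on T_{1,0} along
    T_{0,1} + C xi + C conj xi, and d the flat derivative of vector fields.

    For a section W of T_{1,0} the torsion conditions force
    nabla_{conj U} W = pi (d_{conj U} W), nabla_xi W = [xi, W] + r/2 W and
    nabla_{conj xi} W = pi (d_{conj xi} W) + r/2 W, while L-parallelism then
    determines nabla_Z W.  These are the special cases of the single formula
      nabla_X W = pi (d_X W) + Gamma(X^{1,0}, W)
                  + r/2 (delbar phi (X) - del phi (X)) W,
    where D2(Gamma(X, W), conj U) = D3(X, W, conj U); for X = xi this rests on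
      D3(xi, W, conj U) + D2(d_W xi, conj U) = r D2(W, conj U).
    Taking this formula as a definition, with nabla xi = 0 and nabla real, gives
    existence.  The difference of two solutions is a tensor; the conditions
    annihilate it successively on T_{0,1} x T_{1,0}, on T, N and on
    T_{1,0} x T_{1,0}, which gives uniqueness. *)

Require Import Defs.
From HB Require Import structures.
From mathcomp Require Import all_boot all_order all_algebra.
From mathcomp Require Import complex ring lra.
From mathcomp Require Import all_classical all_reals all_analysis.
Set Implicit Arguments.
Unset Strict Implicit.
Unset Printing Implicit Defensive.
Import Order.TTheory GRing.Theory Num.Theory.
Import numFieldNormedType.Exports.
Local Open Scope classical_set_scope.
Local Open Scope complex_scope.
Local Open Scope ring_scope.

(** * Smooth functions and symmetry of second derivatives *)

(** The factor r/2 comes from xi = (N - iT)/2: the conditions on N and T give torsion(xi, W) = (rW +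
    i tau W - i tau W)/2 = (r/2) W, while torsion(conj xi, W) = (r/2) W + i tau W, whose second
    summand has type (0,1) and is invisible to pi. The sign of the correction fits L: since r is
    real, the coefficient of W is imaginary on real X, so it drops out of nabla L.

    The obstacle is that no global smooth frame of T_{1,0} is at hand. Everything is expressed in
    the constant coordinate frame and projected by pi; an identity between vectors of T_{1,0} is
    tested against all conj U through the nondegeneracy of L, and Gamma is obtained by inverting a
    matrix of full size 2n instead of the Levi matrix. The flat derivative commutes with J, is
    torsion free and obeys the product rule on D1 and D2, so the geometry reduces to the symmetric
    forms D1, D2, D3 and to the values of D1 and D2 on xi. The coordinate frame also spares cutoff
    functions in the proof that the difference of two connections is a tensor. *)

Section RealSmooth.
Variables (R : realType) (E : normedModType R) (V : set E).
Hypothesis oV : open V.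

Section Target.
Variable W : normedModType R.
Implicit Types f g : E -> W.

Lemma CkS k f : Ck k.+1 V f -> Ck k V f.
Proof.
elim: k f => [|k IH] f [df Df].
  by move=> p Vp; apply: differentiable_continuous; apply: df.
by split=> // v; apply: IH; apply: Df.
Qed.

Lemma eq_on_near (T : Type) (f g : E -> T) p :
  V p -> (forall q, V q -> f q = g q) -> \forall q \near p, f q = g q.
Proof.
move=> Vp fg; apply: filterS (open_nbhs_nbhs (conj oV Vp)) => q; exact: fg.
Qed.

Lemma eq_on_derive f g p v :
  V p -> (forall q, V q -> f q = g q) -> 'D_v f p = 'D_v g p.
Proof. by move=> Vp fg; apply: near_eq_derive; apply: eq_on_near. Qed.

Lemma eq_on_differentiable f g p :
  V p -> (forall q, V q -> f q = g q) -> differentiable f p ->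
  differentiable g p.
Proof.
move=> Vp fg dfp; have [cf df] := (diff_locallyP _ _).1 dfp.
have dg : g \o shift p = cst (g p) + 'd f p +o_ 0 id.
  move/eqaddoP : df => df; apply/eqaddoP => e e0.
  have nfg : \forall h \near (0 : E), f (h + p) = g (h + p).
    have := eq_on_near Vp fg; rewrite (near_shift 0) /=.
    by apply: filterS => h /=; rewrite subr0.
  move: (df e e0); apply: filterS2 nfg => h /= Eh.
  by rewrite /= /shift/= !fctE /= Eh fg.
apply/diff_locallyP; split; last by rewrite (diff_unique _ dg).
by rewrite (diff_unique _ dg).
Qed.

(** As [V] is open, derivatives at its points depend only on values in [V]. This is what allows
    total functions to be rewritten by identities that hold on [V] alone. *)
Lemma Ck_eq k f g : (forall q, V q -> f q = g q) -> Ck k V f -> Ck k V g.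
Proof.
elim: k f g => [|k IH] f g fg /=.
  move=> cf p Vp; have := cf p Vp; rewrite /prop_for /continuous_at -fg//.
  by apply: cvg_trans; apply: near_eq_cvg; apply: eq_on_near.
move=> [df Df]; split=> [p Vp|v].
  by apply: eq_on_differentiable fg _ => //; apply: df.
by apply: IH (Df v) => q Vq; apply: eq_on_derive.
Qed.

Lemma Ck_cst k (c : W) : Ck k V (fun _ : E => c).
Proof.
elim: k c => [|k IH] c /=; first by move=> p _; apply: cst_continuous.
split=> [p _|v]; first exact: differentiable_cst.
apply: (@Ck_eq k (fun _ => 0)) => // q _.
exact/esym/(derive_cst c q v).
Qed.

Lemma CkD k f g : Ck k V f -> Ck k V g -> Ck k V (fun q => f q + g q).
Proof.
elim: k f g => [|k IH] f g /=.
  by move=> cf cg p Vp; apply: continuousD; [apply: cf | apply: cg].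
move=> [df Df] [dg Dg]; split=> [p Vp|v].
  by apply: differentiableD; [apply: df | apply: dg].
apply: (@Ck_eq k (fun q => 'D_v f q + 'D_v g q)); last exact: IH.
move=> q Vq; apply/esym/deriveD; apply: diff_derivable; first exact: df.
exact: dg.
Qed.

Lemma Ck_sum k (I : Type) (r : seq I) (P : pred I) (F : I -> E -> W) :
  (forall i, Ck k V (F i)) -> Ck k V (fun q => \sum_(i <- r | P i) F i q).
Proof.
move=> sF; elim: r => [|i r IH].
  by apply: (Ck_eq _ (Ck_cst k 0)) => q _; rewrite big_nil.
case Pi: (P i).
  by apply: (Ck_eq _ (CkD (sF i) IH)) => q _; rewrite big_cons Pi.
by apply: (Ck_eq _ IH) => q _; rewrite big_cons Pi.
Qed.

End Target.

Lemma Ck_lin k (W W' : normedModType R) (L : {linear W -> W'}) (f : E -> W) :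
  continuous L -> Ck k V f -> Ck k V (L \o f).
Proof.
move=> cL; elim: k f => [|k IH] f /=.
  by move=> cf p Vp; apply: continuous_comp; [apply: cf | apply: cL].
move=> [df Df]; split=> [p Vp|v].
  apply: differentiable_comp; first exact: df.
  exact: linear_differentiable.
apply: (@Ck_eq _ k (L \o 'D_v f)); last exact: IH.
move=> q Vq /=.
have dL x : differentiable L x by exact: linear_differentiable.
rewrite deriveE; last exact: df.
rewrite deriveE; last by apply: differentiable_comp; [apply: df | apply: dL].
by rewrite (diff_comp (df _ Vq) (dL _)) /= diff_lin.
Qed.

Lemma CkM k (f g : E -> R^o) :
  Ck k V f -> Ck k V g -> Ck k V (fun q => f q * g q : R^o).
Proof.
elim: k f g => [|k IH] f g.
  by move=> cf cg p Vp; apply: continuousM; [apply: cf | apply: cg].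
move=> sf sg; have [df Df] := sf; have [dg Dg] := sg.
split=> [p Vp|v].
  by apply: (@differentiableM _ _ f g); [apply: df | apply: dg].
apply: (@Ck_eq _ k (fun q => f q * 'D_v g q + g q * 'D_v f q)).
  move=> q Vq; apply/esym/(@deriveM _ _ f g); apply: diff_derivable.
    exact: df.
  exact: dg.
apply: CkD; apply: IH; [exact: CkS|exact: Dg|exact: CkS|exact: Df].
Qed.

(** The derivative of 1/f is a product of 1/f twice and Df, so the induction on the order feeds on
    1/f itself. *)
Lemma CkV k (f : E -> R^o) : (forall p, V p -> f p != 0) ->
  Ck k V f -> Ck k V (fun q => (f q)^-1 : R^o).
Proof.
move=> f0; elim: k => [|k IH].
  move=> cf p Vp; apply: continuousV; [exact: f0 | exact: cf].
move=> sf; have [df Df] := sf; split=> [p Vp|v].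
  by apply: (@differentiableV _ _ f); [apply: df | apply: f0].
apply: (@Ck_eq _ k (fun q => (-1 * ((f q)^-1 * (f q)^-1)) * 'D_v f q)).
  move=> q Vq; rewrite deriveV; [|exact: f0|exact: diff_derivable (df _ _)].
  by rewrite mulN1r -invfM -expr2.
have sI := IH (CkS sf); apply: CkM; last exact: Df.
by apply: CkM; [exact: Ck_cst | exact: CkM].
Qed.

(** A row is a finite sum of its coordinates times constant basis vectors, and both directions are
    compositions with continuous linear maps. From here on smoothness of fields is checked on scalar
    coordinates. *)
Lemma smooth_rowP m (X : E -> 'rV[R]_m) :
  smooth_on V X <-> forall a, smooth_on V (fun q => X q 0 a : R^o).
Proof.
split=> [sX a k|sX k].
  have @L : {linear 'rV[R]_m -> R^o}.
    by exists (fun N : 'rV[R]_m => N 0 a); do 2![eexists]; do ?[constructor];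
       rewrite ?mxE// => ? *; rewrite ?mxE//; move=> ?; rewrite !mxE.
  have cL : continuous L by exact: coord_continuous.
  exact: (Ck_lin cL (sX k)).
apply: (@Ck_eq _ k (fun q => \sum_a X q 0 a *: (delta_mx 0 a : 'rV[R]_m))).
  by move=> q _; rewrite -row_sum_delta.
apply: Ck_sum => a.
have lL : linear ( *:%R ^~ (delta_mx 0 a : 'rV[R]_m) : R^o -> 'rV[R]_m).
  by move=> u y z; rewrite scalerDl scalerA.
pose LM := GRing.isLinear.Build _ _ _ _ _ lL.
pose L : {linear R^o -> 'rV[R]_m} := HB.pack ( *:%R ^~ (delta_mx 0 a : 'rV[R]_m)) LM.
have cL : continuous L by exact: scalel_continuous.
exact: (Ck_lin cL (sX a k)).
Qed.

End RealSmooth.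

(** * Symmetry of second derivatives by second differences *)

Section Schwarz.
Variables (R : realType) (E : normedModType R).
Implicit Types f : E -> R^o.

Lemma is_derive_line f (p v : E) (s : R) :
  (forall q, differentiable f q) ->
  is_derive s 1 (fun h : R => f (p + h *: v) : R^o) ('D_v f (p + s *: v)).
Proof.
move=> df.
have dl : is_diff s (fun h : R^o => p + h *: v) ( *:%R ^~ v).
  have : is_diff s (cst p + (( *:%R ^~ v) : R^o -> E)) (0 + ( *:%R ^~ v)).
    exact: is_diffD.
  by rewrite add0r.
have dc := is_diff_comp dl (differentiableP (df (p + s *: v))).
apply: DeriveDef; first by apply: diff_derivable; apply: ex_diff.
rewrite deriveE; last exact: ex_diff.
by rewrite [in LHS]diff_val /= scale1r deriveE.
Qed.

(** Two applications of the mean value theorem: to the increment along [w] as a function of the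
    displacement along [v], then to the resulting derivative along [v]. The left-hand side is
    symmetric in [v] and [w], the right-hand side is not visibly so; that asymmetry is the point. *)
Lemma second_difference f (p v w : E) (t : R) : 0 < t -> Ck 2 setT f ->
  exists c d : R, [/\ 0 < c < t, 0 < d < t &
    f (p + t *: v + t *: w) - f (p + t *: v) - f (p + t *: w) + f p
    = t * t * 'D_w ('D_v f) (p + c *: v + d *: w)].
Proof.
move=> t0 [df Df].
have {}df q : differentiable f q by exact: df.
have dDf u q : differentiable ('D_u f) q by apply: (Df u).1.
pose g (s : R) : R^o := f (p + t *: w + s *: v) - f (p + s *: v).
have dg (s : R) : is_derive s 1 g
    ('D_v f (p + t *: w + s *: v) - 'D_v f (p + s *: v)).
  by apply: is_deriveB; apply: is_derive_line.
have [|c] := @MVT R g _ 0 t t0 (fun s _ => dg s).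
  apply: continuous_subspaceT => s; apply/differentiable_continuous.
  by apply/derivable1_diffP; apply: ex_derive.
rewrite in_itv /= => ct gc.
pose h (s : R) : R^o := 'D_v f (p + c *: v + s *: w).
have dh (s : R) : is_derive s 1 h ('D_w ('D_v f) (p + c *: v + s *: w)).
  exact: is_derive_line.
have [|d] := @MVT R h _ 0 t t0 (fun s _ => dh s).
  apply: continuous_subspaceT => s; apply/differentiable_continuous.
  by apply/derivable1_diffP; apply: ex_derive.
rewrite in_itv /= => dt hd; exists c, d; split=> //.
move: gc hd; rewrite /g /h !scale0r !addr0 subr0 => gc hd.
rewrite (addrAC p (t *: w)) in gc; rewrite (addrAC p (t *: w)) hd in gc.
by rewrite [RHS]mulrC mulrA -gc opprB addrA [RHS]addrAC.
Qed.

Lemma mixed_derive_near f (p v w : E) (r : R) : 0 < r -> Ck 2 setT f ->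
  exists q q', [/\ ball p r q, ball p r q' &
    'D_w ('D_v f) q = 'D_v ('D_w f) q' :> R].
Proof.
(* The summand 1 keeps the denominator positive when v = w = 0 and makes the estimate t (|v| + |w|)
   < r strict. *)
move=> r0 sf; pose t := r / (`|v| + `|w| + 1).
have k0 : 0 < `|v| + `|w| + 1 by rewrite ltr_wpDl // addr_ge0.
have t0 : 0 < t by rewrite divr_gt0.
have inB (c d : R) (u1 u2 : E) : `|u1| + `|u2| = `|v| + `|w| ->
    0 < c < t -> 0 < d < t -> ball p r (p + c *: u1 + d *: u2).
  move=> Eu /andP[c0 ct] /andP[d0 dt]; rewrite -ball_normE /= -addrA opprD.
  rewrite addNKr normrN (le_lt_trans (ler_normD _ _)) // !normrZ.
  rewrite !gtr0_norm // (@le_lt_trans _ _ (t * (`|v| + `|w|))) //.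
    by rewrite -Eu mulrDr lerD // ler_wpM2r // ltW.
  by rewrite -[ltRHS](divfK (lt0r_neq0 k0)) -/t ltr_pM2l // ltrDl.
have [c [d [ct dt H1]]] := second_difference p v w t0 sf.
have [c' [d' [ct' dt' H2]]] := second_difference p w v t0 sf.
exists (p + c *: v + d *: w), (p + c' *: w + d' *: v).
split; [exact: inB | by apply: inB => //; rewrite addrC |].
have tI (y z : R) : t * t * y = t * t * z -> y = z.
  exact: (mulfI (lt0r_neq0 (mulr_gt0 t0 t0))).
have E1 : p + t *: w + t *: v = p + t *: v + t *: w by rewrite addrAC.
apply: tI; apply: etrans (esym H1) _; apply: etrans _ H2.
by rewrite E1; congr (_ + _); exact: addrAC.
Qed.

(** If the values at [p] differed, both functions would stay within half of the gap near [p], and a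
    common value g q = h q' would violate the triangle inequality. Two distinct points are allowed
    because each order of differentiation yields its own mean value point. *)
Lemma continuous_eq_near (g h : E -> R^o) (p : E) :
  {for p, continuous g} -> {for p, continuous h} ->
  (forall r : R, 0 < r -> exists q q', [/\ ball p r q, ball p r q' & g q = h q']) ->
  g p = h p.
Proof.
move=> cg ch gh; apply/eqP/negPn/negP => ne.
have e0 : 0 < `|g p - h p| / 2 by rewrite divr_gt0 // normr_gt0 subr_eq0.
have /cvgrPdist_lt /(_ _ e0) ng := cg.
have /cvgrPdist_lt /(_ _ e0) nh := ch.
have [r /= r0 Hr] := (nbhs_ballP _ _).1 (filterI ng nh).
have [q [q' [/Hr[/= Hg _] /Hr[_ /= Hh] Eq]]] := gh r r0.
have := ltrD Hg Hh; rewrite -splitr ltNge => /negP; apply.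
by rewrite Eq (distrC (h p)) (le_trans (ler_distD (h q') _ _)).
Qed.

Lemma derive_comm f (p v w : E) : Ck 2 setT f ->
  'D_v ('D_w f) p = 'D_w ('D_v f) p.
Proof.
move=> sf.
have cD u u' : {for p, continuous ('D_u' ('D_u f))}.
  by have [_ /(_ u)[_ /(_ u')]] := sf; apply.
apply: (continuous_eq_near (cD w v) (cD v w)) => r r0.
exact: mixed_derive_near.
Qed.

End Schwarz.

(** * Complex-valued functions *)

Lemma complex_eq (R : realType) (x y : R[i]) :
  complex.Re x = complex.Re y -> complex.Im x = complex.Im y -> x = y.
Proof. by case: x y => a b [c d] /= -> ->. Qed.

Lemma ReM (R : realType) (x y : R[i]) :
  complex.Re (x * y) = complex.Re x * complex.Re y - complex.Im x * complex.Im y.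
Proof. by case: x y => a b [c d]. Qed.

Lemma ImM (R : realType) (x y : R[i]) :
  complex.Im (x * y) = complex.Re x * complex.Im y + complex.Im x * complex.Re y.
Proof. by case: x y => a b [c d]. Qed.

Lemma ReD (R : realType) (x y : R[i]) :
  complex.Re (x + y) = complex.Re x + complex.Re y.
Proof. by case: x y => a b [c d]. Qed.

Lemma ImD (R : realType) (x y : R[i]) :
  complex.Im (x + y) = complex.Im x + complex.Im y.
Proof. by case: x y => a b [c d]. Qed.

Lemma ReJ (R : realType) (x : R[i]) : complex.Re x^*%C = complex.Re x.
Proof. by case: x. Qed.

Lemma ImJ (R : realType) (x : R[i]) : complex.Im x^*%C = - complex.Im x.
Proof. by case: x. Qed.

(* [rmorphM] and its companions would leave [conjc] wrapped in a structure. *)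
Lemma conjcD (R : realType) (x y : R[i]) : (x + y)^*%C = x^*%C + y^*%C.
Proof. exact: rmorphD. Qed.
Lemma conjcM (R : realType) (x y : R[i]) : (x * y)^*%C = x^*%C * y^*%C.
Proof. exact: rmorphM. Qed.
Lemma conjcN (R : realType) (x : R[i]) : (- x)^*%C = - x^*%C.
Proof. exact: rmorphN. Qed.

(** * Conjugation, real and imaginary parts of complexified vectors *)

Section Vectors.
Variables (R : realType) (n : nat).
Implicit Types (c : R[i]) (v w : 'rV[R[i]]_(n + n)) (x : 'rV[R]_(n + n)).

Lemma conj_vecD v w : conj_vec (v + w) = conj_vec v + conj_vec w.
Proof. by apply/rowP => a; rewrite !mxE rmorphD. Qed.
Lemma conj_vecZ c v : conj_vec (c *: v) = c^*%C *: conj_vec v.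
Proof. by apply/rowP => a; rewrite !mxE rmorphM. Qed.
Lemma conj_vecK v : conj_vec (conj_vec v) = v.
Proof. by apply/rowP => a; rewrite !mxE conjcK. Qed.
Lemma conj_vecN v : conj_vec (- v) = - conj_vec v.
Proof. by apply/rowP => a; rewrite !mxE rmorphN. Qed.
Lemma conj_vecB v w : conj_vec (v - w) = conj_vec v - conj_vec w.
Proof. by rewrite conj_vecD conj_vecN. Qed.
Lemma conj_vec0 : conj_vec (0 : 'rV[R[i]]_(n + n)) = 0.
Proof. by apply/rowP => a; rewrite !mxE rmorph0. Qed.
Lemma conj_cplx x : conj_vec (cplx x) = cplx x.
Proof. by apply/rowP => a; rewrite !mxE conjc_real. Qed.

Lemma re_vecD v w : re_vec (v + w) = re_vec v + re_vec w.
Proof. by apply/rowP => a; rewrite !mxE ReD. Qed.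
Lemma im_vecD v w : im_vec (v + w) = im_vec v + im_vec w.
Proof. by apply/rowP => a; rewrite !mxE ImD. Qed.
Lemma re_vecZ c v :
  re_vec (c *: v) = complex.Re c *: re_vec v - complex.Im c *: im_vec v.
Proof. by apply/rowP => a; rewrite !mxE ReM. Qed.
Lemma im_vecZ c v :
  im_vec (c *: v) = complex.Re c *: im_vec v + complex.Im c *: re_vec v.
Proof. by apply/rowP => a; rewrite !mxE ImM. Qed.
Lemma re_conj v : re_vec (conj_vec v) = re_vec v.
Proof. by apply/rowP => a; rewrite !mxE ReJ. Qed.
Lemma im_conj v : im_vec (conj_vec v) = - im_vec v.
Proof. by apply/rowP => a; rewrite !mxE ImJ. Qed.
Lemma re_cplx x : re_vec (cplx x) = x.
Proof. by apply/rowP => a; rewrite !mxE. Qed.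
Lemma im_cplx x : im_vec (cplx x) = 0.
Proof. by apply/rowP => a; rewrite !mxE. Qed.
Lemma cplx_re_im v : v = cplx (re_vec v) + 'i%C *: cplx (im_vec v).
Proof. by apply/rowP => a; rewrite !mxE -complexE. Qed.
Lemma cplx_real v : conj_vec v = v -> cplx (re_vec v) = v.
Proof.
move=> cv; apply/rowP => a; rewrite !mxE; apply: complex_eq => //=.
have := im_conj v; rewrite cv => /rowP/(_ a); rewrite !mxE; lra.
Qed.
Lemma cplxD x y : cplx (x + y : 'rV[R]_(n + n)) = cplx x + cplx y.
Proof. by apply/rowP => a; rewrite !mxE rmorphD. Qed.
Lemma cplxN x : cplx (- x : 'rV[R]_(n + n)) = - cplx x.
Proof. by apply/rowP => a; rewrite !mxE rmorphN. Qed.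
Lemma cplxZ (s : R) x : cplx (s *: x : 'rV[R]_(n + n)) = s%:C *: cplx x.
Proof. by apply/rowP => a; rewrite !mxE rmorphM. Qed.
Lemma cplx_inj x y : cplx x = cplx y -> x = y.
Proof. by move=> /(congr1 (@re_vec R n)); rewrite !re_cplx. Qed.

End Vectors.

(** * Smoothness and differentiation of complex-valued functions *)

Section ComplexCalculus.
Variables (R : realType) (n : nat) (V : set 'rV[R]_(n + n)).
Hypothesis oV : open V.
Let E : Type := 'rV[R]_(n + n).
Implicit Types (F G : 'rV[R]_(n + n) -> R[i]) (v w : 'rV[R[i]]_(n + n)).

Definition csmooth F : Prop :=
  smooth_on V (fun q => complex.Re (F q) : R^o) /\
  smooth_on V (fun q => complex.Im (F q) : R^o).

Lemma csmooth_diff F p : csmooth F -> V p ->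
  differentiable (fun q => complex.Re (F q) : R^o) p /\
  differentiable (fun q => complex.Im (F q) : R^o) p.
Proof. by move=> [sR sI] Vp; split; [apply: (sR 1).1 | apply: (sI 1).1]. Qed.

Lemma csmooth_eq F G : (forall q, V q -> F q = G q) -> csmooth F -> csmooth G.
Proof.
move=> FG [sR sI]; split=> k; [apply: Ck_eq (sR k) | apply: Ck_eq (sI k)] => //.
  by move=> q Vq; rewrite FG.
by move=> q Vq; rewrite FG.
Qed.

Lemma csmooth_cst c : csmooth (fun=> c).
Proof. by split=> k; exact: Ck_cst. Qed.

Lemma csmoothD F G : csmooth F -> csmooth G -> csmooth (fun q => F q + G q).
Proof.
move=> [FR FI] [GR GI]; split=> k.
  by apply: Ck_eq (CkD oV (FR k) (GR k)) => // q _; rewrite ReD.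
by apply: Ck_eq (CkD oV (FI k) (GI k)) => // q _; rewrite ImD.
Qed.

Lemma csmoothM F G : csmooth F -> csmooth G -> csmooth (fun q => F q * G q).
Proof.
move=> [FR FI] [GR GI]; split=> k.
  have CN := CkM oV (Ck_cst oV k (-1 : R^o)).
  apply: Ck_eq (CkD oV (CkM oV (FR k) (GR k)) (CN _ (CkM oV (FI k) (GI k)))) => // q _.
  by rewrite ReM mulN1r.
by apply: Ck_eq (CkD oV (CkM oV (FR k) (GI k)) (CkM oV (FI k) (GR k))) => // q _;
  rewrite ImM.
Qed.

Lemma csmoothN F : csmooth F -> csmooth (fun q => - F q).
Proof.
move=> sF; apply: csmooth_eq (csmoothM (csmooth_cst (-1)) sF) => q _.
by rewrite mulN1r.
Qed.

Lemma csmoothB F G : csmooth F -> csmooth G -> csmooth (fun q => F q - G q).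
Proof. by move=> sF sG; apply: csmoothD => //; apply: csmoothN. Qed.

Lemma csmooth_conj F : csmooth F -> csmooth (fun q => (F q)^*%C).
Proof.
move=> [FR FI]; split=> k.
  by apply: Ck_eq (FR k) => // q _; rewrite ReJ.
apply: Ck_eq (CkM oV (Ck_cst oV k (-1 : R^o)) (FI k)) => // q _.
by rewrite ImJ mulN1r.
Qed.

Lemma csmooth_real (f : E -> R^o) : smooth_on V f -> csmooth (fun q => (f q)%:C).
Proof. by move=> sf; split=> // k; exact: Ck_cst. Qed.

Lemma csmooth_sum (I : Type) (r : seq I) (P : pred I) (F : I -> E -> R[i]) :
  (forall i, csmooth (F i)) -> csmooth (fun q => \sum_(i <- r | P i) F i q).
Proof.
move=> sF; elim: r => [|i r IH].
  by apply: (csmooth_eq _ (csmooth_cst 0)) => q _; rewrite big_nil.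
case Pi: (P i).
  by apply: (csmooth_eq _ (csmoothD (sF i) IH)) => q _; rewrite big_cons Pi.
by apply: (csmooth_eq _ IH) => q _; rewrite big_cons Pi.
Qed.

Lemma csmooth_prod (I : Type) (r : seq I) (P : pred I) (F : I -> E -> R[i]) :
  (forall i, csmooth (F i)) -> csmooth (fun q => \prod_(i <- r | P i) F i q).
Proof.
move=> sF; elim: r => [|i r IH].
  by apply: (csmooth_eq _ (csmooth_cst 1)) => q _; rewrite big_nil.
case Pi: (P i).
  by apply: (csmooth_eq _ (csmoothM (sF i) IH)) => q _; rewrite big_cons Pi.
by apply: (csmooth_eq _ IH) => q _; rewrite big_cons Pi.
Qed.

(** 1/F is conj F divided by |F|^2, which leaves the inverse of a nowhere vanishing real
    function. *)
Lemma csmoothV F : csmooth F -> (forall q, V q -> F q != 0) ->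
  csmooth (fun q => (F q)^-1).
Proof.
move=> sF F0.
pose d q := complex.Re (F q * (F q)^*%C).
have sd : smooth_on V (fun q => (d q)^-1 : R^o).
  move=> k; apply: CkV => //; last exact: (csmoothM sF (csmooth_conj sF)).1.
  move=> q Vq; have := F0 _ Vq; rewrite /d; case: (F q) => a b /=.
  rewrite mulrN opprK eq_complex negb_and /= => ab.
  by rewrite -!expr2 paddr_eq0 ?sqr_ge0// !sqrf_eq0 negb_and.
apply: csmooth_eq (csmoothM (csmooth_real sd) (csmooth_conj sF)) => q Vq.
have Fc : F q * (F q)^*%C = (d q)%:C.
  by apply: complex_eq; rewrite //= ImM ReJ ImJ; ring.
have Fc0 : (F q)^*%C != 0 by rewrite fmorph_eq0 F0.
have -> : ((d q)^-1)%:C = (F q * (F q)^*%C)^-1 by rewrite Fc fmorphV.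
by rewrite invfM -mulrA mulVf ?mulr1.
Qed.

Lemma csmooth_det m (A : E -> 'M[R[i]]_m) :
  (forall i j, csmooth (fun q => A q i j)) -> csmooth (fun q => \det (A q)).
Proof.
move=> sA; apply: csmooth_sum => s; apply: csmoothM; first exact: csmooth_cst.
by apply: csmooth_prod.
Qed.

(** Cramer's rule: each entry is a cofactor, polynomial in the entries, over a determinant that does
    not vanish on [V]. It yields the smoothness of the Christoffel symbols. *)
Lemma csmooth_invmx m (A : E -> 'M[R[i]]_m) :
  (forall i j, csmooth (fun q => A q i j)) ->
  (forall q, V q -> A q \in unitmx) ->
  forall i j, csmooth (fun q => invmx (A q) i j).
Proof.
move=> sA uA i j.
apply: (@csmooth_eq (fun q => (\det (A q))^-1 * ((-1) ^+ (j + i) *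
  \det (row' j (col' i (A q)))))).
  by move=> q Vq; rewrite /invmx uA // !mxE.
apply: csmoothM.
  apply: csmoothV; first exact: csmooth_det.
  by move=> q Vq; have := uA q Vq; rewrite unitmxE unitfE.
apply: csmoothM; first exact: csmooth_cst.
apply: csmooth_det => k l.
by apply: (csmooth_eq _ (sA (lift j k) (lift i l))) => q _; rewrite !mxE.
Qed.

Lemma smooth_cfieldP (X : E -> 'rV[R[i]]_(n + n)) :
  smooth_cfield V X <-> forall a, csmooth (fun q => X q 0 a).
Proof.
split=> [[/smooth_rowP sR /smooth_rowP sI] a|sX].
  split=> k; [have := sR oV a k|have := sI oV a k]; apply: Ck_eq => // q _;
  by rewrite mxE.
split; apply/smooth_rowP => // a k; [have := (sX a).1 k|have := (sX a).2 k];
  by apply: Ck_eq => // q _; rewrite mxE.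
Qed.

Lemma smooth_fieldP (X : E -> 'rV[R]_(n + n)) :
  smooth_field V X <-> smooth_cfield V (cfield X).
Proof.
rewrite /smooth_cfield.
have -> : re_field (cfield X) = X by apply: funext => q; apply: re_cplx.
have -> : im_field (cfield X) = fun=> 0 by apply: funext => q; apply: im_cplx.
by split=> [sX|[]//]; split=> // k; exact: Ck_cst.
Qed.

Lemma smooth_cfieldD (X Y : E -> 'rV[R[i]]_(n + n)) :
  smooth_cfield V X -> smooth_cfield V Y -> smooth_cfield V (fun q => X q + Y q).
Proof.
move=> /smooth_cfieldP sX /smooth_cfieldP sY; apply/smooth_cfieldP => a.
by apply: (csmooth_eq _ (csmoothD (sX a) (sY a))) => q _; rewrite mxE.
Qed.

Lemma smooth_cfieldZ F (Y : E -> 'rV[R[i]]_(n + n)) :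
  csmooth F -> smooth_cfield V Y -> smooth_cfield V (fun q => F q *: Y q).
Proof.
move=> sF /smooth_cfieldP sY; apply/smooth_cfieldP => a.
by apply: (csmooth_eq _ (csmoothM sF (sY a))) => q _; rewrite mxE.
Qed.

Lemma smooth_cfield_cst v : smooth_cfield V (fun=> v).
Proof. by apply/smooth_cfieldP => a; apply: csmooth_cst. Qed.

Lemma smooth_cfieldN (Y : E -> 'rV[R[i]]_(n + n)) :
  smooth_cfield V Y -> smooth_cfield V (fun q => - Y q).
Proof.
move=> /smooth_cfieldP sY; apply/smooth_cfieldP => a.
by apply: (csmooth_eq _ (csmoothN (sY a))) => q _; rewrite mxE.
Qed.

Lemma smooth_cfieldB (X Y : E -> 'rV[R[i]]_(n + n)) :
  smooth_cfield V X -> smooth_cfield V Y -> smooth_cfield V (fun q => X q - Y q).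
Proof. by move=> sX sY; apply: smooth_cfieldD => //; apply: smooth_cfieldN. Qed.

Lemma smooth_cfield_conj (Y : E -> 'rV[R[i]]_(n + n)) :
  smooth_cfield V Y -> smooth_cfield V (conj_field Y).
Proof.
move=> /smooth_cfieldP sY; apply/smooth_cfieldP => a.
by apply: (csmooth_eq _ (csmooth_conj (sY a))) => q _; rewrite mxE.
Qed.

Lemma smooth_cfield_eq (X Y : E -> 'rV[R[i]]_(n + n)) :
  (forall q, V q -> X q = Y q) -> smooth_cfield V X -> smooth_cfield V Y.
Proof.
move=> XY /smooth_cfieldP sX; apply/smooth_cfieldP => a.
by apply: (csmooth_eq _ (sX a)) => q Vq; rewrite XY.
Qed.

Lemma smooth_cfield_mulmx (X : E -> 'rV[R[i]]_(n + n))
    (A : E -> 'M[R[i]]_(n + n)) :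
  smooth_cfield V X -> (forall i j, csmooth (fun q => A q i j)) ->
  smooth_cfield V (fun q => X q *m A q).
Proof.
move=> /smooth_cfieldP sX sA; apply/smooth_cfieldP => a.
apply: (@csmooth_eq (fun q => \sum_b X q 0 b * A q b a)).
  by move=> q _; rewrite mxE.
by apply: csmooth_sum => b; apply: csmoothM.
Qed.

Definition dirD (f : E -> R) (p u : 'rV[R]_(n + n)) : R :=
  'D_u (f : 'rV[R]_(n + n) -> R^o) p.

(* [ring] would otherwise try to unify derivatives by unfolding them. *)
Ltac dirD_ring :=
  repeat match goal with |- context [dirD ?f ?p ?u] =>
    generalize (dirD f p u); intro end; ring.

Lemma cderiveE F p v : cderive F p v =
  (dirD (fun q => complex.Re (F q)) p (re_vec v) -
   dirD (fun q => complex.Im (F q)) p (im_vec v)) +i*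
  (dirD (fun q => complex.Im (F q)) p (re_vec v) +
   dirD (fun q => complex.Re (F q)) p (im_vec v)).
Proof. by []. Qed.

Lemma dirDDv (f : E -> R^o) p u u' :
  differentiable f p -> dirD f p (u + u') = dirD f p u + dirD f p u'.
Proof. by move=> df; rewrite /dirD !deriveE // linearD. Qed.

Lemma dirDZv (f : E -> R^o) p (c : R) u :
  differentiable f p -> dirD f p (c *: u) = c * dirD f p u.
Proof. by move=> df; rewrite /dirD !deriveE // linearZ. Qed.

Lemma dirDNv (f : E -> R^o) p u :
  differentiable f p -> dirD f p (- u) = - dirD f p u.
Proof. by move=> df; rewrite /dirD !deriveE // linearN. Qed.

Lemma dirD_near (f g : E -> R) p u :
  V p -> (forall q, V q -> f q = g q) -> dirD f p u = dirD g p u.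
Proof. by move=> Vp fg; apply: (eq_on_derive oV). Qed.

Lemma dirDD (f g : E -> R) p u : differentiable (f : E -> R^o) p ->
  differentiable (g : E -> R^o) p ->
  dirD (fun q => f q + g q) p u = dirD f p u + dirD g p u.
Proof. by move=> df dg; apply: deriveD; apply: diff_derivable. Qed.

Lemma dirDN (f : E -> R) p u : differentiable (f : E -> R^o) p ->
  dirD (fun q => - f q) p u = - dirD f p u.
Proof. by move=> df; apply: deriveN; apply: diff_derivable. Qed.

Lemma dirDM (f g : E -> R) p u : differentiable (f : E -> R^o) p ->
  differentiable (g : E -> R^o) p ->
  dirD (fun q => f q * g q) p u = f p * dirD g p u + g p * dirD f p u.
Proof.
by move=> df dg; apply: (@deriveM _ _ (f : E -> R^o) g); apply: diff_derivable.
Qed.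

Lemma cderive_eq F G p v : V p -> (forall q, V q -> F q = G q) ->
  cderive F p v = cderive G p v.
Proof.
move=> Vp FG; rewrite !cderiveE.
have ER u : dirD (fun q => complex.Re (F q)) p u =
            dirD (fun q => complex.Re (G q)) p u.
  by apply: dirD_near => // q Vq; rewrite FG.
have EI u : dirD (fun q => complex.Im (F q)) p u =
            dirD (fun q => complex.Im (G q)) p u.
  by apply: dirD_near => // q Vq; rewrite FG.
by rewrite !ER !EI.
Qed.

Section AtPoint.
Variable p : 'rV[R]_(n + n).
Hypothesis Vp : V p.

Lemma cderiveDv F v w : csmooth F ->
  cderive F p (v + w) = cderive F p v + cderive F p w.
Proof.
move=> /csmooth_diff /(_ Vp) [dR dI]; rewrite !cderiveE re_vecD im_vecD.
by rewrite !dirDDv //; apply: complex_eq => /=; dirD_ring.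
Qed.

Lemma cderiveZv F c v : csmooth F -> cderive F p (c *: v) = c * cderive F p v.
Proof.
move=> /csmooth_diff /(_ Vp) [dR dI]; rewrite !cderiveE re_vecZ im_vecZ.
rewrite !dirDDv // !dirDNv // !dirDZv //.
by case: c => a b; apply: complex_eq => /=; dirD_ring.
Qed.

Lemma cderive0v F : csmooth F -> cderive F p 0 = 0.
Proof. by move=> sF; rewrite -(scale0r 0) cderiveZv // mul0r. Qed.

Lemma cderive_sumv F (I : Type) (r : seq I) (P : pred I)
    (w : I -> 'rV[R[i]]_(n + n)) : csmooth F ->
  cderive F p (\sum_(i <- r | P i) w i) = \sum_(i <- r | P i) cderive F p (w i).
Proof.
move=> sF; apply: (big_morph (cderive F p)); last exact: cderive0v.
by move=> v w'; exact: cderiveDv.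
Qed.

Lemma cderive_cst c v : cderive (fun=> c) p v = 0.
Proof.
have D0 (y : R) u : dirD (fun=> y) p u = 0 by exact: derive_cst.
by rewrite cderiveE !D0; apply: complex_eq => /=; dirD_ring.
Qed.

Lemma cderiveD F G v : csmooth F -> csmooth G ->
  cderive (fun q => F q + G q) p v = cderive F p v + cderive G p v.
Proof.
move=> /csmooth_diff /(_ Vp) [FR FI] /csmooth_diff /(_ Vp) [GR GI].
rewrite !cderiveE.
have ER u : dirD (fun q => complex.Re (F q + G q)) p u =
    dirD (fun q => complex.Re (F q)) p u + dirD (fun q => complex.Re (G q)) p u.
  by rewrite -dirDD //; apply: dirD_near => // q _; rewrite ReD.
have EI u : dirD (fun q => complex.Im (F q + G q)) p u =
    dirD (fun q => complex.Im (F q)) p u + dirD (fun q => complex.Im (G q)) p u.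
  by rewrite -dirDD //; apply: dirD_near => // q _; rewrite ImD.
by rewrite !ER !EI; apply: complex_eq => /=; dirD_ring.
Qed.

Lemma cderiveM F G v : csmooth F -> csmooth G ->
  cderive (fun q => F q * G q) p v = cderive F p v * G p + F p * cderive G p v.
Proof.
move=> /csmooth_diff /(_ Vp) [FR FI] /csmooth_diff /(_ Vp) [GR GI].
rewrite !cderiveE.
have ER u : dirD (fun q => complex.Re (F q * G q)) p u =
    dirD (fun q => complex.Re (F q) * complex.Re (G q)) p u -
    dirD (fun q => complex.Im (F q) * complex.Im (G q)) p u.
  rewrite -dirDN; last exact: (differentiableM FI GI).
  rewrite -dirDD; first by apply: dirD_near => // q _; rewrite ReM.
    exact: (differentiableM FR GR).
  exact: differentiableN (differentiableM FI GI).
have EI u : dirD (fun q => complex.Im (F q * G q)) p u =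
    dirD (fun q => complex.Re (F q) * complex.Im (G q)) p u +
    dirD (fun q => complex.Im (F q) * complex.Re (G q)) p u.
  rewrite -dirDD; first by apply: dirD_near => // q _; rewrite ImM.
    exact: (differentiableM FR GI).
  exact: (differentiableM FI GR).
rewrite !ER !EI !dirDM //.
apply: complex_eq; rewrite /= ?ReD ?ImD ?ReM ?ImM /=; dirD_ring.
Qed.

Lemma cderiveZ F c v : csmooth F ->
  cderive (fun q => c * F q) p v = c * cderive F p v.
Proof.
move=> sF; rewrite (cderiveM _ (csmooth_cst c) sF).
by rewrite cderive_cst mul0r add0r.
Qed.

Lemma cderiveN F v : csmooth F -> cderive (fun q => - F q) p v = - cderive F p v.
Proof.
move=> sF; rewrite -mulN1r -(cderiveZ _ _ sF).
by apply: cderive_eq => // q _; rewrite mulN1r.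
Qed.

Lemma cderiveB F G v : csmooth F -> csmooth G ->
  cderive (fun q => F q - G q) p v = cderive F p v - cderive G p v.
Proof.
by move=> sF sG; rewrite (cderiveD _ sF (csmoothN sG)) cderiveN.
Qed.

Lemma cderive_sum (I : Type) (r : seq I) (P : pred I) (F : I -> E -> R[i]) v :
  (forall i, csmooth (F i)) ->
  cderive (fun q => \sum_(i <- r | P i) F i q) p v =
  \sum_(i <- r | P i) cderive (F i) p v.
Proof.
move=> sF; elim: r => [|i r IH].
  rewrite big_nil; apply: etrans _ (cderive_cst 0 v).
  by apply: cderive_eq => // q _; rewrite big_nil.
rewrite big_cons; case Pi: (P i).
  rewrite -IH -cderiveD //; last exact: csmooth_sum.
  by apply: cderive_eq => // q _; rewrite big_cons Pi.
by rewrite -IH; apply: cderive_eq => // q _; rewrite big_cons Pi.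
Qed.

Lemma cderive_conj F v : csmooth F ->
  cderive (fun q => (F q)^*%C) p v = (cderive F p (conj_vec v))^*%C.
Proof.
move=> /csmooth_diff /(_ Vp) [FR FI]; rewrite !cderiveE re_conj im_conj.
have ER u : dirD (fun q => complex.Re (F q)^*%C) p u =
    dirD (fun q => complex.Re (F q)) p u.
  by apply: dirD_near => // q _; rewrite ReJ.
have EI u : dirD (fun q => complex.Im (F q)^*%C) p u =
    - dirD (fun q => complex.Im (F q)) p u.
  by rewrite -dirDN //; apply: dirD_near => // q _; rewrite ImJ.
by rewrite !ER !EI !dirDNv //; apply: complex_eq => /=; dirD_ring.
Qed.

End AtPoint.

Lemma csmooth_cderive_cst F v : csmooth F -> csmooth (fun q => cderive F q v).
Proof.
move=> [FR FI].
have sD (f : E -> R^o) u k : smooth_on V f -> Ck k V ('D_u f).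
  by move=> /(_ k.+1)[_]; apply.
have sN (f : E -> R^o) k : Ck k V f -> Ck k V (fun q => - f q).
  move=> sf; apply: Ck_eq (CkM oV (Ck_cst oV k (-1 : R^o)) sf) => // q _.
  by rewrite mulN1r.
split=> k /=.
  by apply: CkD => //; [apply: sD | apply: sN; apply: sD].
by apply: CkD => //; apply: sD.
Qed.

Lemma csmooth_cderive F (X : E -> 'rV[R[i]]_(n + n)) :
  csmooth F -> smooth_cfield V X -> csmooth (fun q => cderive F q (X q)).
Proof.
move=> sF /smooth_cfieldP sX.
(* Expanding the direction in the coordinate basis reduces to constant directions, for which the
   derivative is a combination of real directional derivatives. *)
apply: (@csmooth_eq (fun q => \sum_a X q 0 a * cderive F q (delta_mx 0 a))).
  move=> q Vq; rewrite [in RHS](row_sum_delta (X q)) cderive_sumv //.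
  by apply: eq_bigr => a _; rewrite cderiveZv.
apply: csmooth_sum => a; apply: csmoothM => //.
exact: csmooth_cderive_cst.
Qed.

End ComplexCalculus.

(* Locked: conversion checks between distinct instances would unfold down to
   matrices and derivatives. *)
HB.lock Definition p10 (R : realType) (n : nat) (v : 'rV[R[i]]_(n + n)) :
  'rV[R[i]]_(n + n) := 2^-1 *: (v - 'i%C *: Jvec v).
HB.lock Definition p01 (R : realType) (n : nat) (v : 'rV[R[i]]_(n + n)) :
  'rV[R[i]]_(n + n) := 2^-1 *: (v + 'i%C *: Jvec v).

(** * Vectors of type (1,0) and (0,1) *)

Section Types.
Variables (R : realType) (n : nat).
Implicit Types (c : R[i]) (v w : 'rV[R[i]]_(n + n)).

Lemma JvecEl v (j : 'I_n) : Jvec v 0 (lshift n j) = - v 0 (rshift n j).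
Proof. by rewrite row_mxEl !mxE. Qed.
Lemma JvecEr v (j : 'I_n) : Jvec v 0 (rshift n j) = v 0 (lshift n j).
Proof. by rewrite row_mxEr !mxE. Qed.

Lemma row2P v w : (forall j : 'I_n, v 0 (lshift n j) = w 0 (lshift n j)) ->
  (forall j : 'I_n, v 0 (rshift n j) = w 0 (rshift n j)) -> v = w.
Proof.
move=> El Er; apply/rowP => a; rewrite -(fintype.splitK a);
  case: (fintype.split a) => j /=;
  [exact: El | exact: Er].
Qed.

Lemma JvecD v w : Jvec (v + w) = Jvec v + Jvec w.
Proof. by apply: row2P => j;
  rewrite [RHS]mxE !(JvecEl, JvecEr) [in LHS]mxE // opprD. Qed.
Lemma JvecZ c v : Jvec (c *: v) = c *: Jvec v.
Proof. by apply: row2P => j;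
  rewrite [RHS]mxE !(JvecEl, JvecEr) [in LHS]mxE // mulrN. Qed.
Lemma JvecN v : Jvec (- v) = - Jvec v.
Proof. by rewrite -scaleN1r JvecZ scaleN1r. Qed.
Lemma JvecK v : Jvec (Jvec v) = - v.
Proof. by apply: row2P => j; rewrite [RHS]mxE !(JvecEl, JvecEr). Qed.
Lemma Jvec_conj v : Jvec (conj_vec v) = conj_vec (Jvec v).
Proof. by apply: row2P => j; rewrite [RHS]mxE !(JvecEl, JvecEr) mxE // rmorphN. Qed.

Lemma iiC : 'i%C * 'i%C = -1 :> R[i].
Proof. by rewrite -expr2 sqr_i. Qed.
Lemma two_neq0 : 2 != 0 :> R[i]. Proof. by rewrite pnatr_eq0. Qed.

Lemma p10D v w : p10 (v + w) = p10 v + p10 w.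
Proof. by rewrite p10.unlock JvecD; move: (Jvec v) (Jvec w) => v' w';
  apply/rowP => a; rewrite !mxE; ring. Qed.
Lemma p10Z c v : p10 (c *: v) = c *: p10 v.
Proof. by rewrite p10.unlock JvecZ; move: (Jvec v) => v'; apply/rowP => a;
  rewrite !mxE; ring. Qed.
Lemma p10_p01 v : p10 v + p01 v = v.
Proof.
by rewrite p10.unlock p01.unlock; move: (Jvec v) => v'; apply/rowP => a;
  rewrite !mxE; field.
Qed.

Lemma p01_sub v : p01 v = v - p10 v.
Proof. by rewrite -[X in X - _](p10_p01 v) addrC addKr. Qed.
Lemma p01D v w : p01 (v + w) = p01 v + p01 w.
Proof. by rewrite !p01_sub p10D opprD addrACA. Qed.
Lemma p01Z c v : p01 (c *: v) = c *: p01 v.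
Proof. by rewrite !p01_sub p10Z scalerBr. Qed.
Lemma p10N v : p10 (- v) = - p10 v.
Proof. by rewrite -scaleN1r p10Z scaleN1r. Qed.
Lemma p01N v : p01 (- v) = - p01 v.
Proof. by rewrite -scaleN1r p01Z scaleN1r. Qed.
Lemma p10_0 : p10 (0 : 'rV[R[i]]_(n + n)) = 0. Proof. by rewrite -(scale0r 0)
  p10Z !scale0r. Qed.
Lemma p01_0 : p01 (0 : 'rV[R[i]]_(n + n)) = 0. Proof. by rewrite -(scale0r 0)
  p01Z !scale0r. Qed.

Lemma Jvec_p10 v : Jvec (p10 v) = 'i%C *: p10 v.
Proof.
rewrite p10.unlock JvecZ JvecD JvecN JvecZ JvecK; move: (Jvec v) => v'.
by apply/rowP => a; rewrite !mxE; ring: (@iiC).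
Qed.

Lemma p01E v : p01 v = conj_vec (p10 (conj_vec v)).
Proof.
rewrite p10.unlock p01.unlock Jvec_conj conj_vecZ conj_vecB conj_vecZ !conj_vecK.
have -> : ('i%C)^*%C = - 'i%C :> R[i] by apply: complex_eq; rewrite /= ?oppr0.
rewrite scaleNr opprK; congr (_ *: _).
by rewrite fmorphV rmorph_nat.
Qed.

Lemma p10_conj v : p10 (conj_vec v) = conj_vec (p01 v).
Proof. by rewrite p01E conj_vecK. Qed.
Lemma p01_conj v : p01 (conj_vec v) = conj_vec (p10 v).
Proof. by rewrite p01E conj_vecK. Qed.

Lemma type10_p10 v : type10 (p10 v).
Proof. exact: Jvec_p10. Qed.

Lemma p10_id v : type10 v -> p10 v = v.
Proof.
move=> tv; rewrite p10.unlock tv scalerA iiC scaleN1r opprK.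
by apply/rowP => a; rewrite !mxE; field.
Qed.
Lemma p01_0P v : type10 v -> p01 v = 0.
Proof. by move=> tv; apply: (addrI v); rewrite -{1}(p10_id tv) p10_p01 addr0. Qed.

Lemma type10D v w : type10 v -> type10 w -> type10 (v + w).
Proof. by rewrite /type10 JvecD scalerDr => -> ->. Qed.
Lemma type10Z c v : type10 v -> type10 (c *: v).
Proof. by rewrite /type10 JvecZ => ->; rewrite !scalerA mulrC. Qed.
Lemma type10N v : type10 v -> type10 (- v).
Proof. by rewrite -scaleN1r; apply: type10Z. Qed.

Lemma p10_conj0 v : type10 v -> p10 (conj_vec v) = 0.
Proof. by move=> tv; rewrite p10_conj p01_0P // conj_vec0. Qed.
Lemma p01_conj_id v : type10 v -> p01 (conj_vec v) = conj_vec v.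
Proof. by move=> tv; rewrite p01_conj p10_id. Qed.
Lemma Jvec_p01 v : Jvec (p01 v) = - 'i%C *: p01 v.
Proof.
rewrite p01E Jvec_conj Jvec_p10 conj_vecZ; congr (_ *: _).
by apply: complex_eq; rewrite /= ?oppr0.
Qed.

Lemma p10_Jvec v : p10 (Jvec v) = 'i%C *: p10 v.
Proof.
rewrite p10.unlock JvecK; move: (Jvec v) => v'.
by apply/rowP => a; rewrite !mxE; ring: (@iiC).
Qed.

Lemma p10_sum (I : Type) (r : seq I) (w : I -> 'rV[R[i]]_(n + n)) :
  p10 (\sum_(i <- r) w i) = \sum_(i <- r) p10 (w i).
Proof. by apply: (big_morph (@p10 R n) p10D p10_0). Qed.

(** The bridge from the coordinate formulas to invariant ones: with it, del phi becomes D1 composed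
    with [p10], and the coordinates z_j can be forgotten. The terms of d/dx_j and d/dy_j combine
    because J d/dx_j = d/dy_j and [p10] turns J into multiplication by i. *)
Lemma sum_dz v : \sum_(j < n) dz j v *: d_z R j = p10 v.
Proof.
have Jl (j : 'I_n) : Jvec (delta_mx 0 (lshift n j)) = delta_mx 0 (rshift n j)
  :> 'rV[R[i]]_(n + n).
  apply: row2P => k; rewrite ?JvecEl ?JvecEr !mxE /=.
    by rewrite eq_rlshift eq_lrshift oppr0.
  by rewrite (inj_eq (@lshift_inj _ _)) (inj_eq (@rshift_inj _ _)).
have El j : d_z R j = p10 (delta_mx 0 (lshift n j)) by rewrite p10.unlock Jl.
rewrite [in RHS](row_sum_delta v) p10_sum big_split_ord /= -big_split /=.
by apply: eq_bigr => j _;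
  rewrite -Jl !p10Z p10_Jvec -El scalerA -scalerDl [_ * 'i%C]mulrC.
Qed.

Lemma sum_dzb v : \sum_(j < n) dzb j v *: d_zb R j = p01 v.
Proof.
have iJ : ('i%C)^*%C = - 'i%C :> R[i] by apply: complex_eq; rewrite /= ?oppr0.
rewrite p01E -sum_dz (big_morph _ (@conj_vecD R n) (@conj_vec0 R n)).
apply: eq_bigr => j _; rewrite conj_vecZ; congr (_ *: _).
  by rewrite /dz /dzb !mxE; move: (v 0 _) (v 0 _) => [x1 y1] [x2 y2];
    apply: complex_eq => /=; ring.
rewrite /d_z /d_zb conj_vecZ conj_vecB conj_vecZ iJ scaleNr opprK.
have cd a : conj_vec (delta_mx 0 a) = delta_mx 0 a :> 'rV[R[i]]_(n + n).
  by apply/rowP => b; rewrite !mxE rmorph_nat.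
by rewrite !cd fmorphV rmorph_nat.
Qed.

End Types.

(** * The flat derivative of vector fields *)

HB.lock Definition dvec (R : realType) (n : nat)
    (Y : 'rV[R]_(n + n) -> 'rV[R[i]]_(n + n)) (p : 'rV[R]_(n + n))
    (v : 'rV[R[i]]_(n + n)) : 'rV[R[i]]_(n + n) :=
  \row_a cderive (fun q => Y q 0 a) p v.

Section FlatDerivative.
Variables (R : realType) (n : nat) (V : set 'rV[R]_(n + n)).
Hypothesis oV : open V.
Let E : Type := 'rV[R]_(n + n).
Implicit Types (v w : 'rV[R[i]]_(n + n)) (X Y : E -> 'rV[R[i]]_(n + n)).

Lemma dvecE Y (p : E) v a : dvec Y p v 0 a = cderive (fun q => Y q 0 a) p v.
Proof. by rewrite dvec.unlock mxE. Qed.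

Lemma bracketE X Y (p : E) :
  bracket X Y p = dvec Y p (X p) - dvec X p (Y p).
Proof. by apply/rowP => a; rewrite !(mxE, dvecE). Qed.

Lemma smooth_dvec X Y : smooth_cfield V X -> smooth_cfield V Y ->
  smooth_cfield V (fun q => dvec Y q (X q)).
Proof.
move=> sX /(smooth_cfieldP oV) sY; apply/(smooth_cfieldP oV) => a.
apply: (csmooth_eq oV _ (csmooth_cderive oV (sY a) sX)) => q _.
by rewrite dvecE.
Qed.

Section AtPoint.
Variable p : 'rV[R]_(n + n).
Hypothesis Vp : V p.

Lemma dvec_eq X Y v : (forall q, V q -> X q = Y q) -> dvec X p v = dvec Y p v.
Proof.
by move=> XY; apply/rowP => a; rewrite !(mxE, dvecE);
  apply: (cderive_eq oV) => // q Vq; rewrite XY.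
Qed.

Lemma dvecDv Y v w : smooth_cfield V Y ->
  dvec Y p (v + w) = dvec Y p v + dvec Y p w.
Proof.
move=> /(smooth_cfieldP oV) sY; apply/rowP => a.
by rewrite [LHS]dvecE (cderiveDv Vp _ _ (sY a)) !(mxE, dvecE).
Qed.

Lemma dvecZv Y c v : smooth_cfield V Y -> dvec Y p (c *: v) = c *: dvec Y p v.
Proof.
move=> /(smooth_cfieldP oV) sY; apply/rowP => a.
by rewrite [LHS]dvecE (cderiveZv Vp _ _ (sY a)) !(mxE, dvecE).
Qed.

Lemma dvecNv Y v : smooth_cfield V Y -> dvec Y p (- v) = - dvec Y p v.
Proof. by move=> sY; rewrite -scaleN1r dvecZv // scaleN1r. Qed.

Lemma dvecBv Y v w : smooth_cfield V Y ->
  dvec Y p (v - w) = dvec Y p v - dvec Y p w.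
Proof. by move=> sY; rewrite dvecDv // dvecNv. Qed.

Lemma dvec_cst (u : 'rV[R[i]]_(n + n)) v : dvec (fun=> u) p v = 0.
Proof. by apply/rowP => a; rewrite [LHS]dvecE (cderive_cst p) mxE. Qed.

Lemma dvecD X Y v : smooth_cfield V X -> smooth_cfield V Y ->
  dvec (fun q => X q + Y q) p v = dvec X p v + dvec Y p v.
Proof.
move=> /(smooth_cfieldP oV) sX /(smooth_cfieldP oV) sY; apply/rowP => a.
rewrite !(mxE, dvecE) -(cderiveD oV Vp _ (sX a) (sY a)).
by apply: (cderive_eq oV) => // q _; rewrite mxE.
Qed.

Lemma dvecZ (F : E -> R[i]) Y v : csmooth V F -> smooth_cfield V Y ->
  dvec (fun q => F q *: Y q) p v = cderive F p v *: Y p + F p *: dvec Y p v.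
Proof.
move=> sF /(smooth_cfieldP oV) sY; apply/rowP => a.
rewrite !(mxE, dvecE) -(cderiveM oV Vp _ sF (sY a)).
by apply: (cderive_eq oV) => // q _; rewrite mxE.
Qed.

Lemma dvecZc c Y v : smooth_cfield V Y ->
  dvec (fun q => c *: Y q) p v = c *: dvec Y p v.
Proof.
move=> sY; rewrite (dvecZ v (csmooth_cst oV c) sY) (cderive_cst p).
by rewrite scale0r add0r.
Qed.

Lemma dvecN Y v : smooth_cfield V Y -> dvec (fun q => - Y q) p v = - dvec Y p v.
Proof.
move=> sY; rewrite -scaleN1r -(dvecZc _ _ sY).
by apply: dvec_eq => q _; rewrite scaleN1r.
Qed.

Lemma dvecB X Y v : smooth_cfield V X -> smooth_cfield V Y ->
  dvec (fun q => X q - Y q) p v = dvec X p v - dvec Y p v.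
Proof.
by move=> sX sY; rewrite (dvecD v sX (smooth_cfieldN oV sY)) dvecN.
Qed.

Lemma dvec_conj Y v : smooth_cfield V Y ->
  dvec (conj_field Y) p v = conj_vec (dvec Y p (conj_vec v)).
Proof.
move=> /(smooth_cfieldP oV) sY; apply/rowP => a.
rewrite !(mxE, dvecE) -(cderive_conj oV Vp _ (sY a)).
by apply: (cderive_eq oV) => // q _; rewrite mxE.
Qed.

Lemma dvec_Jvec Y v : smooth_cfield V Y ->
  dvec (fun q => Jvec (Y q)) p v = Jvec (dvec Y p v).
Proof.
move=> /(smooth_cfieldP oV) sY; apply: row2P => j.
  rewrite JvecEl [LHS]dvecE [in RHS]dvecE -(cderiveN oV Vp _ (sY _)).
  by apply: (cderive_eq oV) => // q _; rewrite JvecEl.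
rewrite JvecEr [LHS]dvecE [in RHS]dvecE.
by apply: (cderive_eq oV) => // q _; rewrite JvecEr.
Qed.

(** J has constant coefficients, so the flat derivative commutes with it and preserves types. *)
Lemma type10_dvec Y v : smooth_cfield V Y ->
  (forall q, V q -> type10 (Y q)) -> type10 (dvec Y p v).
Proof.
by move=> sY tY; rewrite /type10 -dvec_Jvec // -(dvecZc _ _ sY); apply: dvec_eq.
Qed.

End AtPoint.

Section Forms.
Variable B : E -> 'rV[R[i]]_(n + n) -> R[i].
Hypothesis BD : forall q v w, V q -> B q (v + w) = B q v + B q w.
Hypothesis BZ : forall q c v, V q -> B q (c *: v) = c * B q v.
Hypothesis sB : forall w, csmooth V (fun q => B q w).

Lemma form_row q v : V q -> B q v = \sum_a v 0 a * B q (delta_mx 0 a).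
Proof.
move=> Vq; rewrite [in LHS](row_sum_delta v).
have B0 : B q 0 = 0 by rewrite -(scale0r 0) BZ // mul0r.
rewrite (big_morph (B q) (fun v w => BD v w Vq) B0).
by apply: eq_bigr => a _; rewrite BZ.
Qed.

Lemma csmooth_form Y : smooth_cfield V Y -> csmooth V (fun q => B q (Y q)).
Proof.
move=> /(smooth_cfieldP oV) sY.
apply: (@csmooth_eq _ _ _ oV (fun q => \sum_a Y q 0 a * B q (delta_mx 0 a))).
  by move=> q Vq; rewrite -form_row.
by apply: csmooth_sum => // a; apply: csmoothM.
Qed.

(** The product rule for a form with variable coefficients: on the right the argument is frozen at
    [p] in one term and differentiated in the other. Expansion in the constant frame reduces it to
    the rule for scalars. Forms of several arguments are treated one slot at a time. *)
Lemma cderive_form Y p v : V p -> smooth_cfield V Y ->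
  cderive (fun q => B q (Y q)) p v =
  cderive (fun q => B q (Y p)) p v + B p (dvec Y p v).
Proof.
move=> Vp /(smooth_cfieldP oV) sY.
have E1 : cderive (fun q => B q (Y q)) p v =
    cderive (fun q => \sum_a Y q 0 a * B q (delta_mx 0 a)) p v.
  by apply: (cderive_eq oV) => // q Vq; rewrite -form_row.
have E2 : cderive (fun q => B q (Y p)) p v =
    cderive (fun q => \sum_a Y p 0 a * B q (delta_mx 0 a)) p v.
  by apply: (cderive_eq oV) => // q Vq; rewrite -form_row.
have sAB a : csmooth V (fun q => Y q 0 a * B q (delta_mx 0 a)) by exact: csmoothM.
have sAB' a : csmooth V (fun q => Y p 0 a * B q (delta_mx 0 a)).
  by apply: csmoothM => //; apply: csmooth_cst.
rewrite E1 E2 form_row // (cderive_sum oV Vp _ _ _ sAB) (cderive_sum oV Vp _ _ _ sAB').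
rewrite -big_split; apply: eq_bigr => a _.
by rewrite (cderiveM oV Vp _ (sY a) (sB _)) (cderiveZ oV Vp _ _ (sB _)) dvecE addrC.
Qed.

End Forms.
End FlatDerivative.

(** * Symmetry of second derivatives over the complex numbers *)

Section Symmetry.
Variables (R : realType) (n : nat).
Let E : Type := 'rV[R]_(n + n).
Implicit Types (F : E -> R[i]) (v w : 'rV[R[i]]_(n + n)).

Lemma Ck_sub (E' W : normedModType R) (U V : set E') k (f : E' -> W) :
  V `<=` U -> Ck k U f -> Ck k V f.
Proof.
move=> VU; elim: k f => [|k IH] f /=; first by move=> cf p /VU; apply: cf.
by move=> [df Df]; split=> [p /VU|v]; [apply: df | apply: IH (Df v)].
Qed.

Lemma csmooth_sub (U V : set E) F : V `<=` U -> csmooth U F -> csmooth V F.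
Proof.
by move=> VU [sR sI]; split=> k; [apply: Ck_sub (sR k) | apply: Ck_sub (sI k)].
Qed.

Lemma cderive_cplx F (p : E) (u : 'rV[R]_(n + n)) : cderive F p (cplx u) =
  'D_u (fun q => complex.Re (F q) : R^o) p +i* 'D_u (fun q => complex.Im (F q) : R^o) p.
Proof.
rewrite cderiveE re_cplx im_cplx /dirD !derive0.
by apply: complex_eq; rewrite /= ?subr0 ?addr0.
Qed.

Lemma cplx_form_sym (S : 'rV[R[i]]_(n + n) -> 'rV[R[i]]_(n + n) -> R[i]) :
  (forall u v w, S (v + 'i%C *: w) u = S v u + 'i%C * S w u) ->
  (forall u v w, S u (v + 'i%C *: w) = S u v + 'i%C * S u w) ->
  (forall a b, S (cplx a) (cplx b) = S (cplx b) (cplx a)) ->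
  forall v w, S v w = S w v.
Proof.
move=> Sl Sr Sc v w; rewrite [v]cplx_re_im [w]cplx_re_im !Sl !Sr.
rewrite (Sc (re_vec w)) (Sc (re_vec w) (im_vec v)) (Sc (im_vec w)) (Sc (im_vec w)
  (im_vec v)).
ring.
Qed.

(** Schwarz's theorem applied to real and imaginary parts settles real directions; both sides are
    C-bilinear in the directions, so [cplx_form_sym] settles the rest. *)
Lemma cderive_comm F (p : E) v w : csmooth setT F ->
  cderive (fun q => cderive F q w) p v = cderive (fun q => cderive F q v) p w.
Proof.
move=> sF; have oT : open [set: 'rV[R]_(n + n)] := openT.
have sc u : csmooth setT (fun q => cderive F q u) by exact: csmooth_cderive_cst.
pose fR (q : E) : R^o := complex.Re (F q); pose fI (q : E) : R^o := complex.Im (F q).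
have RD b : (fun q => complex.Re (cderive F q (cplx b))) = 'D_b fR.
  by apply: funext => q; apply: (congr1 (@complex.Re R) (cderive_cplx F q b)).
have ID b : (fun q => complex.Im (cderive F q (cplx b))) = 'D_b fI.
  by apply: funext => q; apply: (congr1 (@complex.Im R) (cderive_cplx F q b)).
have E2 a b : cderive (fun q => cderive F q (cplx b)) p (cplx a) =
    ('D_a ('D_b fR) p : R) +i* ('D_a ('D_b fI) p : R).
  apply: etrans (cderive_cplx _ _ _) _; apply: complex_eq.
    exact: (congr1 (fun g : E -> R^o => 'D_a g p : R) (RD b)).
  exact: (congr1 (fun g : E -> R^o => 'D_a g p : R) (ID b)).
have real a b : cderive (fun q => cderive F q (cplx b)) p (cplx a) =
    cderive (fun q => cderive F q (cplx a)) p (cplx b).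
  apply: etrans (E2 a b) (etrans _ (esym (E2 b a))); apply: complex_eq.
    exact: (derive_comm _ _ _ (sF.1 2)).
  exact: (derive_comm _ _ _ (sF.2 2)).
have lin u v' w' : cderive (fun q => cderive F q (v' + 'i%C *: w')) p u =
    cderive (fun q => cderive F q v') p u +
    'i%C * cderive (fun q => cderive F q w') p u.
  rewrite -(cderiveZ oT I _ _ (sc w')).
  rewrite -(cderiveD oT I _ (sc v') (csmoothM oT (csmooth_cst oT _) (sc w'))).
  apply: (cderive_eq oT) => // q _.
  by rewrite (cderiveDv I _ _ sF) (cderiveZv I _ _ sF).
have ladd u v' w' : cderive (fun q => cderive F q u) p (v' + 'i%C *: w') =
    cderive (fun q => cderive F q u) p v' +
    'i%C * cderive (fun q => cderive F q u) p w'.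
  apply: etrans (cderiveDv I _ _ (sc u)) _.
  exact: (congr1 (+%R (cderive (fun q =>
    cderive F q u) p v')) (cderiveZv I _ _ (sc u))).
exact: (@cplx_form_sym (fun v w => cderive (fun q =>
  cderive F q w) p v) ladd lin real v w).
Qed.

End Symmetry.

(** The field identity behind [dtheta_jet]. There [b] and [c] are the (0,2) and (2,0) parts of the
    Hessian, which cancel by symmetry, while the mixed parts [a] and [d] are counted twice. *)
Lemma dtheta_alg (R : realType) (i a b c d : R[i]) :
  2^-1 * (i / 2 * (a + b - (c + d)) - i / 2 * (d + b - (c + a)) - 0) =
  i / 2 * (a - d).
Proof. by field. Qed.

(** * Derivatives of the defining function *)

HB.lock Definition jet1 (R : realType) (n : nat) (phi : 'rV[R]_(n + n) -> R)
  (q : 'rV[R]_(n + n)) (v : 'rV[R[i]]_(n + n)) : R[i] := cderive (phiC phi) q v.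
HB.lock Definition jet2 (R : realType) (n : nat) (phi : 'rV[R]_(n + n) -> R)
    (q : 'rV[R]_(n + n)) (v w : 'rV[R[i]]_(n + n)) : R[i] :=
  cderive (fun q' => jet1 phi q' w) q v.
HB.lock Definition jet3 (R : realType) (n : nat) (phi : 'rV[R]_(n + n) -> R)
    (q : 'rV[R]_(n + n)) (u v w : 'rV[R[i]]_(n + n)) : R[i] :=
  cderive (fun q' => jet2 phi q' v w) q u.

Section Jets.
Variables (R : realType) (n : nat) (phi : 'rV[R]_(n + n) -> R).
Let E : Type := 'rV[R]_(n + n).
Implicit Types (u v w : 'rV[R[i]]_(n + n)) (q : 'rV[R]_(n + n)).
Hypothesis sphi : smooth_on setT (phi : _ -> R^o).

Lemma jet1E q v : jet1 phi q v = cderive (phiC phi) q v.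
Proof. by rewrite jet1.unlock. Qed.
Lemma jet2E q v w : jet2 phi q v w = cderive (fun q' => jet1 phi q' w) q v.
Proof. by rewrite jet2.unlock. Qed.
Lemma jet3E q u v w : jet3 phi q u v w = cderive (fun q' => jet2 phi q' v w) q u.
Proof. by rewrite jet3.unlock. Qed.

Let oT : open [set: 'rV[R]_(n + n)] := openT.

Notation D1 := (jet1 phi).
Notation D2 := (jet2 phi).
Notation D3 := (jet3 phi).

Lemma smooth_phiC : csmooth setT (phiC phi).
Proof. exact: csmooth_real. Qed.
Lemma smooth_jet1_cst w : csmooth setT (fun q => D1 q w).
Proof.
apply: csmooth_eq (csmooth_cderive_cst oT w smooth_phiC) => // q _.
by rewrite jet1E.
Qed.
Lemma smooth_jet2_cst v w : csmooth setT (fun q => D2 q v w).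
Proof.
apply: csmooth_eq (csmooth_cderive_cst oT v (smooth_jet1_cst w)) => // q _.
by rewrite jet2E.
Qed.
Lemma smooth_jet3_cst u v w : csmooth setT (fun q => D3 q u v w).
Proof.
apply: csmooth_eq (csmooth_cderive_cst oT u (smooth_jet2_cst v w)) => // q _.
by rewrite jet3E.
Qed.

Lemma jet1D q v w : D1 q (v + w) = D1 q v + D1 q w.
Proof. by rewrite !jet1E; exact: (cderiveDv I _ _ smooth_phiC). Qed.
Lemma jet1Z q c v : D1 q (c *: v) = c * D1 q v.
Proof. by rewrite !jet1E; exact: (cderiveZv I _ _ smooth_phiC). Qed.
Lemma jet1_conj q v : D1 q (conj_vec v) = (D1 q v)^*%C.
Proof.
rewrite !jet1E -{2}(conj_vecK v).
apply: etrans _ (cderive_conj oT I (conj_vec v) smooth_phiC).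
by apply: (cderive_eq oT) => // q' _; rewrite conjc_real.
Qed.

Lemma jet2_sym q v w : D2 q v w = D2 q w v.
Proof.
rewrite !jet2E.
have EE (a b : 'rV[R[i]]_(n + n)) : cderive (fun q' => D1 q' a) q b =
    cderive (fun q' => cderive (phiC phi) q' a) q b.
  by apply: (cderive_eq oT) => // q' _; rewrite jet1E.
rewrite !EE; exact: cderive_comm smooth_phiC.
Qed.
Lemma jet2Dl q u v w : D2 q (v + w) u = D2 q v u + D2 q w u.
Proof. by rewrite !jet2E; exact: (cderiveDv I _ _ (smooth_jet1_cst u)). Qed.
Lemma jet2Zl q c v w : D2 q (c *: v) w = c * D2 q v w.
Proof. by rewrite !jet2E; exact: (cderiveZv I _ _ (smooth_jet1_cst w)). Qed.
Lemma jet2Dr q u v w : D2 q u (v + w) = D2 q u v + D2 q u w.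
Proof. by rewrite jet2_sym jet2Dl !(jet2_sym q u). Qed.
Lemma jet2Zr q c v w : D2 q v (c *: w) = c * D2 q v w.
Proof. by rewrite jet2_sym jet2Zl (jet2_sym q v). Qed.
Lemma jet2_conj q v w : D2 q (conj_vec v) (conj_vec w) = (D2 q v w)^*%C.
Proof.
rewrite !jet2E -{2}(conj_vecK v).
apply: etrans _ (cderive_conj oT I (conj_vec v) (smooth_jet1_cst w)).
by apply: (cderive_eq oT) => // q' _; rewrite jet1_conj.
Qed.

Lemma jet3_sym12 q u v w : D3 q u v w = D3 q v u w.
Proof.
rewrite !jet3E.
have EE (a b : 'rV[R[i]]_(n + n)) : cderive (fun q' => D2 q' a w) q b =
    cderive (fun q' => cderive (fun q'' => D1 q'' w) q' a) q b.
  by apply: (cderive_eq oT) => // q' _; rewrite jet2E.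
rewrite !EE; exact: cderive_comm (smooth_jet1_cst w).
Qed.
Lemma jet3_sym23 q u v w : D3 q u v w = D3 q u w v.
Proof. rewrite !jet3E; exact: (cderive_eq oT u I (fun q' _ => jet2_sym q' v w)). Qed.
Lemma jet3D q u v w w' : D3 q (w + w') u v = D3 q w u v + D3 q w' u v.
Proof. by rewrite !jet3E; exact: (cderiveDv I _ _ (smooth_jet2_cst u v)). Qed.
Lemma jet3Z q c u v w : D3 q (c *: u) v w = c * D3 q u v w.
Proof. by rewrite !jet3E; exact: (cderiveZv I _ _ (smooth_jet2_cst v w)). Qed.
Lemma jet3_conj q u v w :
  D3 q (conj_vec u) (conj_vec v) (conj_vec w) = (D3 q u v w)^*%C.
Proof.
rewrite !jet3E -{2}(conj_vecK u).
apply: etrans _ (cderive_conj oT I (conj_vec u) (smooth_jet2_cst v w)).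
by apply: (cderive_eq oT) => // q' _; rewrite jet2_conj.
Qed.

Section OnOpen.
Variable V : set 'rV[R]_(n + n).
Hypothesis oV : open V.
Implicit Types X Y Z : E -> 'rV[R[i]]_(n + n).

Let sub F : csmooth setT F -> csmooth V F.
Proof. exact: csmooth_sub. Qed.

Lemma smooth_jet1 Y : smooth_cfield V Y -> csmooth V (fun q => D1 q (Y q)).
Proof.
move=> sY; apply: (@csmooth_form _ _ _ oV D1) => //.
- by move=> *; exact: jet1D.
- by move=> *; exact: jet1Z.
- by move=> w; apply: sub; exact: smooth_jet1_cst.
Qed.

Lemma derive_jet1 Y p v : V p -> smooth_cfield V Y ->
  cderive (fun q => D1 q (Y q)) p v = D2 p v (Y p) + D1 p (dvec Y p v).
Proof.
move=> Vp sY; rewrite jet2E; apply: (@cderive_form _ _ _ oV D1) => //.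
- by move=> *; exact: jet1D.
- by move=> *; exact: jet1Z.
- by move=> w; apply: sub; exact: smooth_jet1_cst.
Qed.

Lemma smooth_jet2l Y w : smooth_cfield V Y -> csmooth V (fun q => D2 q (Y q) w).
Proof.
move=> sY; apply: (@csmooth_form _ _ _ oV (fun q v => D2 q v w)) => //.
- by move=> *; exact: jet2Dl.
- by move=> *; exact: jet2Zl.
- by move=> v; apply: sub; exact: smooth_jet2_cst.
Qed.

Lemma smooth_jet2 Y Z : smooth_cfield V Y -> smooth_cfield V Z ->
  csmooth V (fun q => D2 q (Y q) (Z q)).
Proof.
move=> sY sZ; apply: (@csmooth_form _ _ _ oV (fun q v => D2 q (Y q) v)) => //.
- by move=> *; exact: jet2Dr.
- by move=> *; exact: jet2Zr.
- by move=> v; exact: smooth_jet2l.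
Qed.

Lemma derive_jet2 Y Z p v : V p -> smooth_cfield V Y -> smooth_cfield V Z ->
  cderive (fun q => D2 q (Y q) (Z q)) p v =
  D3 p v (Y p) (Z p) + D2 p (dvec Y p v) (Z p) + D2 p (Y p) (dvec Z p v).
Proof.
move=> Vp sY sZ.
rewrite (@cderive_form _ _ _ oV (fun q v => D2 q (Y q) v)) //; first last.
- by move=> w; exact: smooth_jet2l.
- by move=> *; exact: jet2Zr.
- by move=> *; exact: jet2Dr.
rewrite jet3E; congr (_ + _);
  apply: (@cderive_form _ _ _ oV (fun q v => D2 q v (Z p))) => //.
- by move=> *; exact: jet2Dl.
- by move=> *; exact: jet2Zl.
- by move=> w; apply: sub; exact: smooth_jet2_cst.
Qed.

Lemma smooth_jet3 X Y Z : smooth_cfield V X -> smooth_cfield V Y ->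
  smooth_cfield V Z -> csmooth V (fun q => D3 q (X q) (Y q) (Z q)).
Proof.
move=> sX sY sZ.
have s1 v w : csmooth V (fun q => D3 q (X q) v w).
  apply: (@csmooth_form _ _ _ oV (fun q u => D3 q u v w)) => //.
  - by move=> *; exact: jet3D.
  - by move=> *; exact: jet3Z.
  - by move=> u; apply: sub; exact: smooth_jet3_cst.
have s2 w : csmooth V (fun q => D3 q (X q) (Y q) w).
  apply: (@csmooth_form _ _ _ oV (fun q u => D3 q (X q) u w)) => //.
  - by move=> *; rewrite !(jet3_sym12 _ (X _)) jet3D.
  - by move=> *; rewrite !(jet3_sym12 _ (X _)) jet3Z.
apply: (@csmooth_form _ _ _ oV (fun q u => D3 q (X q) (Y q) u)) => //.
- by move=> *; rewrite !(jet3_sym23 _ (X _) (Y _)) !(jet3_sym12 _ (X _)) jet3D.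
- by move=> *; rewrite !(jet3_sym23 _ (X _) (Y _)) !(jet3_sym12 _ (X _)) jet3Z.
Qed.

End OnOpen.

Lemma dphi_jet q v : dphi phi q v = D1 q v.
Proof. by rewrite jet1E. Qed.

Lemma jet1_sum q (T : Type) (r : seq T) (w : T -> 'rV[R[i]]_(n + n)) :
  D1 q (\sum_(i <- r) w i) = \sum_(i <- r) D1 q (w i).
Proof. rewrite jet1E (eq_bigr _ (fun i _ => jet1E q (w i)));
  exact: (cderive_sumv I _ _ _ smooth_phiC). Qed.

Lemma del_jet q v : del phi q v = D1 q (p10 v).
Proof.
rewrite -sum_dz jet1_sum; apply: eq_bigr => j _.
by rewrite jet1Z mulrC jet1E.
Qed.

Lemma delbar_jet q v : delbar phi q v = D1 q (p01 v).
Proof.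
rewrite -sum_dzb jet1_sum; apply: eq_bigr => j _.
by rewrite jet1Z mulrC jet1E.
Qed.

Lemma deldelbar_jetE q v w : deldelbar phi q v w =
  \sum_(j < n) \sum_(k < n) D2 q (d_z R j) (d_zb R k) *
    (2^-1 * (dz j v * dzb k w - dzb k v * dz j w)).
Proof.
apply: eq_bigr => j _; apply: eq_bigr => k _; congr (_ * _); rewrite jet2E.
by apply: (cderive_eq oT) => // q' _; rewrite jet1E.
Qed.

Lemma jet2_types q v w : D2 q (p10 v) (p01 w) = \sum_(j < n) \sum_(k < n)
    D2 q (d_z R j) (d_zb R k) * (dz j v * dzb k w).
Proof.
rewrite -sum_dz -sum_dzb.
have J20 u : D2 q 0 u = 0 by rewrite -(scale0r 0) jet2Zl mul0r.
have J02 u : D2 q u 0 = 0 by rewrite jet2_sym J20.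
rewrite (big_morph (fun u => D2 q u _) (jet2Dl q _) (J20 _)).
apply: eq_bigr => j _; rewrite (big_morph (D2 q _) (jet2Dr q _) (J02 _)).
by apply: eq_bigr => k _; rewrite jet2Zl jet2Zr mulrA mulrC.
Qed.

(** The factor 1/2 is the one in the convention for the wedge product. Only the mixed part of the
    Hessian enters. *)
Lemma deldelbar_jet q v w : deldelbar phi q v w =
  2^-1 * (D2 q (p10 v) (p01 w) - D2 q (p10 w) (p01 v)).
Proof.
rewrite deldelbar_jetE (jet2_types q v w) (jet2_types q w v) -sumrB big_distrr.
apply: eq_bigr => j _; rewrite -sumrB big_distrr; apply: eq_bigr => k _.
move: (D2 _ _ _) (dz j v) (dz j w) (dzb k v) (dzb k w) => a b c d e.
by rewrite /=; ring.
Qed.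

Lemma theta_jet q v : theta phi q v = 'i%C / 2 * (D1 q (p01 v) - D1 q (p10 v)).
Proof. by rewrite /theta delbar_jet del_jet. Qed.

(** Compared with [deldelbar_jet], this is d theta = i ddbar phi. On constant extensions the bracket
    vanishes, so only the derivatives of the coefficients of theta remain. *)
Lemma dtheta_jet q v w : dtheta phi q v w =
  'i%C / 2 * (D2 q (p10 v) (p01 w) - D2 q (p10 w) (p01 v)).
Proof.
have dth (a b : 'rV[R[i]]_(n + n)) : cderive (fun q' => theta phi q' a) q b =
    'i%C / 2 * (D2 q b (p01 a) - D2 q b (p10 a)).
  have sB : csmooth setT (fun q' => D1 q' (p01 a) - D1 q' (p10 a)).
    by apply: csmoothB => //; exact: smooth_jet1_cst.
  have -> : cderive (fun q' => theta phi q' a) q b =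
      cderive (fun q' => 'i%C / 2 * (D1 q' (p01 a) - D1 q' (p10 a))) q b.
    by apply: (cderive_eq oT) => // q' _; rewrite theta_jet.
  rewrite (cderiveZ oT I _ _ sB); congr (_ * _).
  rewrite !jet2E; exact: (cderiveB oT I _ (smooth_jet1_cst _) (smooth_jet1_cst _)).
have br0 : bracket (fun=> v) (fun=> w) q = 0.
  by rewrite bracketE !dvec_cst subrr.
have th0 : theta phi q 0 = 0.
  rewrite theta_jet p01_0 p10_0 subrr; exact: mulr0.
rewrite /dtheta /extd !dth br0 th0.
have Ev (a b : 'rV[R[i]]_(n + n)) : D2 q a b = D2 q (p10 a) b + D2 q (p01 a) b.
  apply: etrans (jet2Dl q b _ _); congr (D2 q _ b).
  exact/esym/p10_p01.
rewrite (Ev v (p01 w)) (Ev v (p10 w)) (Ev w (p01 v)) (Ev w (p10 v)).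
rewrite (jet2_sym q (p01 v) (p10 w)) (jet2_sym q (p01 w) (p10 v)).
rewrite (jet2_sym q (p01 w) (p01 v)) (jet2_sym q (p10 w) (p10 v)).
exact: dtheta_alg.
Qed.

Lemma Ltheta_jet q v w : Ltheta phi q v w =
  2^-1 * (D2 q (p10 v) (p01 w) - D2 q (p10 w) (p01 v)).
Proof.
by rewrite /Ltheta dtheta_jet !mulrA mulNr iiC opprK mul1r.
Qed.

End Jets.

(** * The projection on the CR structure *)

HB.lock Definition proj10 (R : realType) (n : nat) (phi : 'rV[R]_(n + n) -> R)
    (xi : 'rV[R]_(n + n) -> 'rV[R[i]]_(n + n)) (q : 'rV[R]_(n + n))
    (v : 'rV[R[i]]_(n + n)) : 'rV[R[i]]_(n + n) :=
  p10 v - jet1 phi q (p10 v) *: xi q.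

Section Geometry.
Variables (R : realType) (n : nat) (phi : 'rV[R]_(n + n) -> R).
Variables (V : set 'rV[R]_(n + n)) (xi : 'rV[R]_(n + n) -> 'rV[R[i]]_(n + n)).
Let E : Type := 'rV[R]_(n + n).
Implicit Types (u v w Z W U : 'rV[R[i]]_(n + n)) (q : 'rV[R]_(n + n)).
Hypothesis sphi : smooth_on setT (phi : _ -> R^o).
Hypothesis oV : open V.
Hypothesis spc : forall p, V p -> spc_at phi p.
Hypothesis xiP : is_xi phi V xi.

Notation D1 := (jet1 phi).
Notation D2 := (jet2 phi).
Notation D3 := (jet3 phi).
Notation pi := (proj10 phi xi).
Notation xib q := (conj_vec (xi q)).
Notation r := (curv phi xi).

Lemma jet1_0 q : D1 q 0 = 0.
Proof. by rewrite -(scale0r 0) (jet1Z sphi) mul0r. Qed.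
Lemma jet1N q v : D1 q (- v) = - D1 q v.
Proof. by rewrite -scaleN1r (jet1Z sphi) mulN1r. Qed.
Lemma jet1B q v w : D1 q (v - w) = D1 q v - D1 q w.
Proof. by rewrite (jet1D sphi) jet1N. Qed.
Lemma jet2_0l q v : D2 q 0 v = 0.
Proof. by rewrite -(scale0r 0) (jet2Zl sphi) mul0r. Qed.
Lemma jet2_0r q v : D2 q v 0 = 0.
Proof. by rewrite (jet2_sym sphi) jet2_0l. Qed.
Lemma jet2Nl q v w : D2 q (- v) w = - D2 q v w.
Proof. by rewrite -scaleN1r (jet2Zl sphi) mulN1r. Qed.
Lemma jet2Bl q v w u : D2 q (v - w) u = D2 q v u - D2 q w u.
Proof. by rewrite (jet2Dl sphi) jet2Nl. Qed.
Lemma jet3_0 q v w : D3 q 0 v w = 0.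
Proof. by rewrite -(scale0r 0) (jet3Z sphi) mul0r. Qed.
Lemma jet1_split q v : D1 q v = D1 q (p10 v) + D1 q (p01 v).
Proof. by rewrite -(jet1D sphi) p10_p01. Qed.

Lemma T10E q v : T10 phi q v <-> type10 v /\ D1 q v = 0.
Proof. by rewrite /T10 (dphi_jet phi). Qed.

Lemma T10_D q v w : T10 phi q v -> T10 phi q w -> T10 phi q (v + w).
Proof.
move=> /T10E[tv dv] /T10E[tw dw]; apply/T10E; split; first exact: type10D.
by rewrite (jet1D sphi) dv dw addr0.
Qed.
Lemma T10_Z q c v : T10 phi q v -> T10 phi q (c *: v).
Proof.
move=> /T10E[tv dv]; apply/T10E; split; first exact: type10Z.
by rewrite (jet1Z sphi) dv mulr0.
Qed.
Lemma T10_N q v : T10 phi q v -> T10 phi q (- v).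
Proof. by rewrite -scaleN1r; apply: T10_Z. Qed.
Lemma T10_B q v w : T10 phi q v -> T10 phi q w -> T10 phi q (v - w).
Proof. by move=> hv hw; exact: (T10_D hv (T10_N hw)). Qed.

Lemma proj10D q v w : pi q (v + w) = pi q v + pi q w.
Proof. by rewrite proj10.unlock p10D (jet1D sphi) scalerDl opprD addrACA. Qed.
Lemma proj10Z q c v : pi q (c *: v) = c *: pi q v.
Proof. by rewrite proj10.unlock p10Z (jet1Z sphi) -scalerA -scalerBr. Qed.
Lemma proj10N q v : pi q (- v) = - pi q v.
Proof. by rewrite -scaleN1r proj10Z scaleN1r. Qed.
Lemma proj10B q v w : pi q (v - w) = pi q v - pi q w.
Proof. by rewrite proj10D proj10N. Qed.
Lemma proj10_0 q : pi q 0 = 0.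
Proof. by rewrite -(scale0r 0) proj10Z !scale0r. Qed.

Lemma smooth_xi : smooth_cfield V xi.
Proof. by case: xiP. Qed.

Lemma smooth_p10 (Y : E -> 'rV[R[i]]_(n + n)) :
  smooth_cfield V Y -> smooth_cfield V (fun q => p10 (Y q)).
Proof.
move=> sY; apply: (@smooth_cfield_eq _ _ _ oV (fun q =>
  2^-1 *: (Y q - 'i%C *: Jvec (Y q)))).
  by move=> q _; rewrite p10.unlock.
have sJ : smooth_cfield V (fun q => Jvec (Y q)).
  move/(smooth_cfieldP oV): sY => sY; apply/(smooth_cfieldP oV) => a.
  rewrite -(fintype.splitK a); case: (fintype.split a) => j /=.
    by apply: (csmooth_eq oV _ (csmoothN oV (sY (rshift n j)))) => q _; rewrite JvecEl.
  by apply: (csmooth_eq oV _ (sY (lshift n j))) => q _; rewrite JvecEr.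
apply: smooth_cfieldZ => //; first exact: csmooth_cst.
apply: smooth_cfieldB => //; apply: smooth_cfieldZ => //; exact: csmooth_cst.
Qed.

Lemma smooth_proj10 (Y : E -> 'rV[R[i]]_(n + n)) :
  smooth_cfield V Y -> smooth_cfield V (fun q => pi q (Y q)).
Proof.
move=> sY; have s1 := smooth_p10 sY.
apply: (@smooth_cfield_eq _ _ _ oV (fun q => p10 (Y q) - D1 q (p10 (Y q)) *: xi q)).
  by move=> q _; rewrite proj10.unlock.
apply: smooth_cfieldB => //; apply: smooth_cfieldZ => //; last exact: smooth_xi.
exact: smooth_jet1.
Qed.

Section AtPoint.
Variable q : 'rV[R]_(n + n).
Hypothesis Vq : V q.

Lemma xi_type10 : type10 (xi q).
Proof. by case: xiP => _ /(_ q Vq)[]. Qed.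
Lemma jet1_xi : D1 q (xi q) = 1.
Proof.
case: xiP => _ /(_ q Vq)[_ + _].
by rewrite (del_jet sphi) p10_id //; exact: xi_type10.
Qed.
Lemma jet1_xib : D1 q (xib q) = 1.
Proof. by rewrite (jet1_conj sphi) jet1_xi rmorph1. Qed.
Lemma p10_xi : p10 (xi q) = xi q.
Proof. by apply: p10_id; exact: xi_type10. Qed.
Lemma p01_xi : p01 (xi q) = 0.
Proof. by apply: p01_0P; exact: xi_type10. Qed.
Lemma p10_xib : p10 (xib q) = 0.
Proof. by apply: p10_conj0; exact: xi_type10. Qed.
Lemma p01_xib : p01 (xib q) = xib q.
Proof. by apply: p01_conj_id; exact: xi_type10. Qed.

Lemma half_eq0 (x : R[i]) : 2^-1 * x = 0 -> x = 0.
Proof. by move/eqP; rewrite mulf_eq0 invr_eq0 (negPf (two_neq0 R)) /= => /eqP. Qed.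

Lemma xi_orth Z : T10 phi q Z -> D2 q (xi q) (conj_vec Z) = 0.
Proof.
move=> tZ; case: xiP => _ /(_ q Vq)[_ _ /(_ Z tZ)].
have [tz _] := (T10E _ _).1 tZ.
by rewrite (deldelbar_jet sphi) p10_xi p01_xi jet2_0r subr0 p01_conj_id // => /half_eq0.
Qed.

Lemma xi_orth' Z : T10 phi q Z -> D2 q Z (xib q) = 0.
Proof.
move=> tZ; rewrite (jet2_sym sphi) -(conj_vecK Z) (jet2_conj sphi) xi_orth //.
exact: rmorph0.
Qed.

Lemma proj10_T10 v : T10 phi q (pi q v).
Proof.
apply/T10E; rewrite proj10.unlock; split.
  apply: type10D; first exact: type10_p10.
  by apply: type10N; apply: type10Z; exact: xi_type10.
by rewrite jet1B (jet1Z sphi) jet1_xi mulr1 subrr.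
Qed.

Lemma proj10_id v : T10 phi q v -> pi q v = v.
Proof.
move=> /T10E[tv dv]; rewrite proj10.unlock p10_id // dv scale0r subr0 //.
Qed.
Lemma proj10_conj0 v : type10 v -> pi q (conj_vec v) = 0.
Proof.
move=> tv; rewrite proj10.unlock p10_conj0 // jet1_0 scale0r subr0 //.
Qed.

Lemma proj10_type10 v : type10 v -> v = pi q v + D1 q v *: xi q.
Proof. by move=> tv; rewrite proj10.unlock p10_id // subrK. Qed.

Lemma p10_decomp v : p10 v = pi q v + D1 q (p10 v) *: xi q.
Proof. by rewrite proj10.unlock subrK. Qed.

Lemma p01_decomp v :
  p01 v = conj_vec (pi q (conj_vec v)) + D1 q (p01 v) *: xib q.
Proof.
rewrite {1}p01E {1}p10_decomp conj_vecD conj_vecZ p10_conj (jet1_conj sphi) conjcK.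
by [].
Qed.

(** The splitting of the complexified tangent space into T_{1,0}, T_{0,1} and the lines of xi and
    conj xi. It gives the invertibility of [frame_mx] and the case distinction of the uniqueness
    proof. *)
Lemma frame_decomp v : v = pi q v + conj_vec (pi q (conj_vec v)) +
  (D1 q (p10 v) *: xi q + D1 q (p01 v) *: xib q).
Proof. by rewrite -{1}(p10_p01 v) {1}p10_decomp {1}p01_decomp addrACA. Qed.

Lemma Ltheta_T10 Z W : type10 Z -> type10 W ->
  Ltheta phi q Z (conj_vec W) = 2^-1 * D2 q Z (conj_vec W).
Proof.
move=> tZ tW; rewrite (Ltheta_jet sphi) (p10_id tZ) (p01_conj_id tW).
by rewrite (p01_0P tZ) jet2_0r subr0.
Qed.

Lemma jet2_gt0 Z : T10 phi q Z -> Z != 0 -> 0 < D2 q Z (conj_vec Z).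
Proof.
move=> tZ Z0; have [tz _] := (T10E _ _).1 tZ.
have := spc Vq tZ Z0; rewrite Ltheta_T10 // pmulr_rgt0 // invr_gt0.
Qed.

Lemma jet2_ge0 Z : T10 phi q Z -> 0 <= D2 q Z (conj_vec Z).
Proof.
move=> tZ; have [->|Z0] := eqVneq Z 0; first by rewrite jet2_0l.
by apply: ltW; apply: jet2_gt0.
Qed.

Lemma T10_nondeg Z : T10 phi q Z -> D2 q Z (conj_vec Z) = 0 -> Z = 0.
Proof.
move=> tZ H; apply/eqP/negPn/negP => Z0.
by have := jet2_gt0 tZ Z0; rewrite H ltxx.
Qed.

(** The test used for identities in T_{1,0}: by strict pseudoconvexity the Hessian is definite
    there, and the difference Z - W may itself serve as U. *)
Lemma T10_eq Z W : T10 phi q Z -> T10 phi q W ->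
  (forall U, T10 phi q U -> D2 q Z (conj_vec U) = D2 q W (conj_vec U)) -> Z = W.
Proof.
move=> tZ tW ZW; apply: subr0_eq; apply: T10_nondeg; first exact: T10_B.
by rewrite jet2Bl (ZW _ (T10_B tZ tW)) subrr.
Qed.

Lemma curvE : r q = D2 q (xi q) (xib q).
Proof.
rewrite /curv (deldelbar_jet sphi) p10_xi p01_xib p10_xib jet2_0l subr0 mulrA.
by rewrite mulfV ?two_neq0 // mul1r.
Qed.

Lemma curv_real : (r q)^*%C = r q.
Proof. by rewrite curvE -(jet2_conj sphi) conj_vecK (jet2_sym sphi). Qed.

End AtPoint.

Lemma smooth_curv : csmooth V r.
Proof.
apply: (@csmooth_eq _ _ _ oV (fun q => D2 q (xi q) (xib q))).
  by move=> q Vq; rewrite curvE.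
have s1 := smooth_xi; apply: smooth_jet2 => //.
exact: (smooth_cfield_conj oV s1).
Qed.

End Geometry.

(** * Christoffel symbols without a frame *)

HB.lock Definition proj01 (R : realType) (n : nat) (phi : 'rV[R]_(n + n) -> R)
    (xi : 'rV[R]_(n + n) -> 'rV[R[i]]_(n + n)) (q : 'rV[R]_(n + n))
    (v : 'rV[R[i]]_(n + n)) : 'rV[R[i]]_(n + n) :=
  conj_vec (proj10 phi xi q (conj_vec v)).

(* A form on the whole complexified tangent space that extends D2 on
   T_{1,0} x T_{0,1} and whose hermitian version is positive definite: its matrix
   can be inverted to solve for the Christoffel symbols, smoothly in q. *)
Definition frame_form (R : realType) (n : nat) (phi : 'rV[R]_(n + n) -> R)
    (xi : 'rV[R]_(n + n) -> 'rV[R[i]]_(n + n)) (q : 'rV[R]_(n + n))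
    (v w : 'rV[R[i]]_(n + n)) : R[i] :=
  jet2 phi q (proj10 phi xi q v) (proj01 phi xi q w) +
  jet2 phi q (proj10 phi xi q w) (proj01 phi xi q v) +
  (jet1 phi q (p10 v) * jet1 phi q (p01 w) +
   jet1 phi q (p01 v) * jet1 phi q (p10 w)).

HB.lock Definition frame_mx (R : realType) (n : nat) (phi : 'rV[R]_(n + n) -> R)
    (xi : 'rV[R]_(n + n) -> 'rV[R[i]]_(n + n)) (q : 'rV[R]_(n + n)) :
  'M[R[i]]_(n + n) :=
  \matrix_(i, j) frame_form phi xi q (delta_mx 0 i) (delta_mx 0 j).

(** The linear functional sending u to D3(x, w, [proj01] u) is represented through [frame_form] by
    the inverse matrix. In [frame_form] only the T_{1,0} component of a vector pairs with T_{0,1},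
    so projecting the solution to T_{1,0} loses nothing of the defining equation. *)
HB.lock Definition christoffel (R : realType) (n : nat)
    (phi : 'rV[R]_(n + n) -> R) (xi : 'rV[R]_(n + n) -> 'rV[R[i]]_(n + n))
    (q : 'rV[R]_(n + n)) (x w : 'rV[R[i]]_(n + n)) : 'rV[R[i]]_(n + n) :=
  proj10 phi xi q ((\row_j jet3 phi q x w (proj01 phi xi q (delta_mx 0 j))) *m
    invmx (frame_mx phi xi q)).

Section Christoffel.
Variables (R : realType) (n : nat) (phi : 'rV[R]_(n + n) -> R).
Variables (V : set 'rV[R]_(n + n)) (xi : 'rV[R]_(n + n) -> 'rV[R[i]]_(n + n)).
Let E : Type := 'rV[R]_(n + n).
Implicit Types (u v w Z W U : 'rV[R[i]]_(n + n)) (q : 'rV[R]_(n + n)).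
Hypothesis sphi : smooth_on setT (phi : _ -> R^o).
Hypothesis oV : open V.
Hypothesis spc : forall p, V p -> spc_at phi p.
Hypothesis xiP : is_xi phi V xi.

Notation D1 := (jet1 phi).
Notation D2 := (jet2 phi).
Notation D3 := (jet3 phi).
Notation pi := (proj10 phi xi).
Notation pib := (proj01 phi xi).
Notation kf := (frame_form phi xi).
Notation Gam := (christoffel phi xi).

Lemma proj01D q v w : pib q (v + w) = pib q v + pib q w.
Proof. by rewrite proj01.unlock conj_vecD (proj10D xi sphi) conj_vecD. Qed.
Lemma proj01Z q c v : pib q (c *: v) = c *: pib q v.
Proof. by rewrite proj01.unlock conj_vecZ (proj10Z xi sphi) conj_vecZ conjcK. Qed.
Lemma proj10_conj q v : pi q (conj_vec v) = conj_vec (pib q v).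
Proof. by rewrite proj01.unlock conj_vecK. Qed.
Lemma proj01_conj q v : pib q (conj_vec v) = conj_vec (pi q v).
Proof. by rewrite proj01.unlock conj_vecK. Qed.

Lemma frame_formDl q u v w : kf q (u + v) w = kf q u w + kf q v w.
Proof.
rewrite /frame_form (proj10D xi sphi) proj01D p10D p01D (jet2Dl sphi) (jet2Dr sphi).
rewrite !(jet1D sphi).
move: (D2 _ _ _) (D2 _ _ _) (D2 _ _ _) (D2 _ _ _) (D1 _ _) (D1 _ _) (D1 _ _)
  (D1 _ _) (D1 _ _) (D1 _ _) => *; ring.
Qed.
Lemma frame_formZl q c v w : kf q (c *: v) w = c * kf q v w.
Proof.
rewrite /frame_form (proj10Z xi sphi) proj01Z p10Z p01Z (jet2Zl sphi) (jet2Zr sphi).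
rewrite !(jet1Z sphi).
move: (D2 _ _ _) (D2 _ _ _) (D1 _ _) (D1 _ _) (D1 _ _) (D1 _ _) => *; ring.
Qed.
Lemma frame_form_sym q v w : kf q v w = kf q w v.
Proof.
rewrite /frame_form.
move: (D2 _ _ _) (D2 _ _ _) (D1 _ _) (D1 _ _) (D1 _ _) (D1 _ _) => *; ring.
Qed.
Lemma frame_formDr q u v w : kf q w (u + v) = kf q w u + kf q w v.
Proof. by rewrite frame_form_sym frame_formDl !(frame_form_sym q w). Qed.
Lemma frame_formZr q c v w : kf q w (c *: v) = c * kf q w v.
Proof. by rewrite frame_form_sym frame_formZl (frame_form_sym q w). Qed.

Lemma frame_mxE q v w : kf q v w = (v *m frame_mx phi xi q *m w^T) 0 0.
Proof.
have K0 u : kf q 0 u = 0 by rewrite -(scale0r 0) frame_formZl mul0r.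
have K0' u : kf q u 0 = 0 by rewrite frame_form_sym K0.
rewrite mxE {1}[w]row_sum_delta (big_morph _ (fun a b => frame_formDr q a b v) (K0' v)).
apply: eq_bigr => j _; rewrite frame_formZr [RHS]mulrC !mxE; congr (_ * _).
rewrite {1}[v]row_sum_delta (big_morph _ (fun a b => frame_formDl q a b _) (K0 _)).
by apply: eq_bigr => i _; rewrite frame_formZl frame_mx.unlock mxE.
Qed.

Lemma mulcJ_eq0 (z : R[i]) : z * z^*%C = 0 -> z = 0.
Proof. by move/eqP; rewrite mulf_eq0 conjc_eq0 orbb => /eqP. Qed.

Lemma ge0_add_eq0 (a b : R[i]) : 0 <= a -> 0 <= b -> a + b = 0 -> a = 0 /\ b = 0.
Proof. by move=> a0 b0 /eqP; rewrite paddr_eq0 // => /andP[/eqP-> /eqP->]. Qed.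

Section AtPoint.
Variable q : 'rV[R]_(n + n).
Hypothesis Vq : V q.

Lemma frame_form_conj v : kf q v (conj_vec v) =
  D2 q (pi q v) (conj_vec (pi q v)) +
  D2 q (pi q (conj_vec v)) (conj_vec (pi q (conj_vec v))) +
  (D1 q (p10 v) * (D1 q (p10 v))^*%C + D1 q (p01 v) * (D1 q (p01 v))^*%C).
Proof.
rewrite /frame_form proj01_conj p01_conj p10_conj !(jet1_conj sphi).
by rewrite proj10_conj conj_vecK.
Qed.

(** For v in the kernel, [frame_form] of v and conj v is zero; it is a sum of four nonnegative
    terms, one for each summand of [frame_decomp], and each of them vanishes only with its
    component. *)
Lemma frame_mx_unit : frame_mx phi xi q \in unitmx.
Proof.
rewrite -row_free_unit; apply: inj_row_free => v vK.
have := frame_form_conj v; rewrite frame_mxE vK mul0mx mxE => /esym.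
have p1 := jet2_ge0 sphi spc Vq (proj10_T10 sphi xiP Vq v).
have p2 := jet2_ge0 sphi spc Vq (proj10_T10 sphi xiP Vq (conj_vec v)).
move/(ge0_add_eq0 (addr_ge0 p1 p2) (addr_ge0 (mulcJ_ge0 _) (mulcJ_ge0 _))).
case=> /(ge0_add_eq0 p1 p2)[e1 e2].
move/(ge0_add_eq0 (mulcJ_ge0 _) (mulcJ_ge0 _)) => [/mulcJ_eq0 e3 /mulcJ_eq0 e4].
have z1 := T10_nondeg sphi spc Vq (proj10_T10 sphi xiP Vq v) e1.
have z2 := T10_nondeg sphi spc Vq (proj10_T10 sphi xiP Vq (conj_vec v)) e2.
by rewrite (frame_decomp xi sphi q v) z1 z2 e3 e4 conj_vec0 !scale0r !addr0.
Qed.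

Lemma christoffel_T10 x w : T10 phi q (Gam q x w).
Proof. by rewrite christoffel.unlock; exact: (proj10_T10 sphi xiP Vq). Qed.

Lemma christoffelP x w U : T10 phi q U ->
  D2 q (Gam q x w) (conj_vec U) = D3 q x w (conj_vec U).
Proof.
move=> tU; have [tu du] := (T10E _ _ _).1 tU.
have pU : pib q (conj_vec U) = conj_vec U by rewrite proj01_conj (proj10_id xi tU).
have kU g : kf q g (conj_vec U) = D2 q (pi q g) (conj_vec U).
  rewrite /frame_form pU (proj10_conj0 xi sphi q tu) (jet2_0l sphi) addr0.
  rewrite (p10_conj0 tu) (p01_conj_id tu) (jet1_0 sphi) (jet1_conj sphi) du.
  by rewrite rmorph0 !mulr0 !addr0.
(* By [kU] the pairing with conj U is that of the unprojected solution, where the matrix and its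
   inverse cancel; the row of D3 values is then summed back by linearity in the last slot. *)
rewrite christoffel.unlock -kU frame_mxE mulmxKV; last exact: frame_mx_unit.
rewrite mxE -{2}pU [in RHS](row_sum_delta (conj_vec U)).
set u := conj_vec U.
have P0 : pib q 0 = 0 by rewrite -(scale0r 0) proj01Z !scale0r.
have L0 : D3 q x w (pib q 0) = 0.
  by rewrite P0 (jet3_sym23 sphi) (jet3_sym12 sphi) (jet3_0 sphi).
have LD a b : D3 q x w (pib q (a + b)) = D3 q x w (pib q a) + D3 q x w (pib q b).
  by rewrite proj01D !(jet3_sym23 sphi q x w) !(jet3_sym12 sphi q x) (jet3D sphi).
rewrite (big_morph (fun a => D3 q x w (pib q a)) LD L0).
apply: eq_bigr => j _; rewrite proj01Z (jet3_sym23 sphi q x w) (jet3_sym12 sphi q x).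
rewrite (jet3Z sphi) (jet3_sym12 sphi q _ x) (jet3_sym23 sphi q x _ w) mulrC.
by rewrite !mxE.
Qed.

Lemma christoffel_eq x w Z : T10 phi q Z ->
  (forall U, T10 phi q U -> D2 q Z (conj_vec U) = D3 q x w (conj_vec U)) ->
  Gam q x w = Z.
Proof.
move=> tZ H; apply: (T10_eq sphi spc Vq _ tZ); first exact: christoffel_T10.
by move=> U tU; rewrite christoffelP // H.
Qed.

(** Inherited from the symmetry of D3; it makes the torsion vanish on T_{1,0} x T_{1,0} and
    transfers linearity from one slot to the other. *)
Lemma christoffel_sym x w : Gam q x w = Gam q w x.
Proof.
apply: christoffel_eq => [|U tU]; first exact: christoffel_T10.
by rewrite christoffelP // (jet3_sym12 sphi).
Qed.
Lemma christoffelDl x y w : Gam q (x + y) w = Gam q x w + Gam q y w.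
Proof.
apply: christoffel_eq => [|U tU].
  exact: (T10_D sphi (christoffel_T10 _ _) (christoffel_T10 _ _)).
by rewrite (jet2Dl sphi) !christoffelP // (jet3D sphi).
Qed.
Lemma christoffelZl c x w : Gam q (c *: x) w = c *: Gam q x w.
Proof.
apply: christoffel_eq => [|U tU]; first exact: (T10_Z sphi _ (christoffel_T10 _ _)).
by rewrite (jet2Zl sphi) christoffelP // (jet3Z sphi).
Qed.
Lemma christoffelDr x y w : Gam q w (x + y) = Gam q w x + Gam q w y.
Proof. by rewrite !(christoffel_sym w) christoffelDl. Qed.
Lemma christoffelZr c x w : Gam q w (c *: x) = c *: Gam q w x.
Proof. by rewrite !(christoffel_sym w) christoffelZl. Qed.
Lemma christoffel0l w : Gam q 0 w = 0.
Proof. by rewrite -(scale0r 0) christoffelZl !scale0r. Qed.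
Lemma christoffel0r w : Gam q w 0 = 0.
Proof. by rewrite christoffel_sym christoffel0l. Qed.

End AtPoint.

Lemma smooth_proj01 (Y : E -> 'rV[R[i]]_(n + n)) :
  smooth_cfield V Y -> smooth_cfield V (fun q => pib q (Y q)).
Proof.
move=> sY.
have s1 := smooth_proj10 sphi oV xiP (smooth_cfield_conj oV sY).
by apply: (smooth_cfield_eq oV _ (smooth_cfield_conj oV s1)) => q _;
  rewrite proj01.unlock.
Qed.

Lemma smooth_christoffel (X Y : E -> 'rV[R[i]]_(n + n)) :
  smooth_cfield V X -> smooth_cfield V Y ->
  smooth_cfield V (fun q => Gam q (X q) (Y q)).
Proof.
move=> sX sY.
have se j : smooth_cfield V (fun=> delta_mx 0 j : 'rV[R[i]]_(n + n))
  by exact: smooth_cfield_cst.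
have s10 j := smooth_proj10 sphi oV xiP (se j).
have s01 j := smooth_proj01 (se j).
have sK i j : csmooth V (fun q => frame_mx phi xi q i j).
  apply: (@csmooth_eq _ _ _ oV (fun q => kf q (delta_mx 0 i) (delta_mx 0 j))).
    by move=> q _; rewrite frame_mx.unlock mxE.
  have a10 k := smooth_jet1 sphi oV (smooth_cfield_cst oV (p10 (delta_mx 0 k :
    'rV[R[i]]_(n + n)))).
  have a01 k := smooth_jet1 sphi oV (smooth_cfield_cst oV (p01 (delta_mx 0 k :
    'rV[R[i]]_(n + n)))).
  rewrite /frame_form; apply: csmoothD => //; apply: csmoothD => //;
    by [exact: smooth_jet2 | exact: csmoothM].
have sg : smooth_cfield V (fun q => \row_j D3 q (X q) (Y q) (pib q (delta_mx 0 j))).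
  apply/(smooth_cfieldP oV) => j.
  apply: (@csmooth_eq _ _ _ oV (fun q => D3 q (X q) (Y q) (pib q (delta_mx 0 j)))).
    by move=> q _; rewrite mxE.
  exact: smooth_jet3.
have sI := csmooth_invmx oV sK frame_mx_unit.
apply: (smooth_cfield_eq oV _ (smooth_proj10 sphi oV xiP (smooth_cfield_mulmx oV
  sg sI))).
by move=> q _; rewrite christoffel.unlock.
Qed.

End Christoffel.

(** * The connection *)

(** The formula of the overview applied to the T_{1,0} component of [Y], together with the plain
    derivative of its xi coefficient, which amounts to declaring xi parallel. The components of type
    (0,1) are left to [nablaGL], which adds the conjugate expression and so becomes real. *)
HB.lock Definition nabla10 (R : realType) (n : nat) (phi : 'rV[R]_(n + n) -> R)
    (xi : 'rV[R]_(n + n) -> 'rV[R[i]]_(n + n)) (q : 'rV[R]_(n + n))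
    (x : 'rV[R[i]]_(n + n)) (Y : 'rV[R]_(n + n) -> 'rV[R[i]]_(n + n)) :
  'rV[R[i]]_(n + n) :=
  proj10 phi xi q (dvec (fun q' => proj10 phi xi q' (Y q')) q x) +
  christoffel phi xi q (p10 x) (proj10 phi xi q (Y q)) +
  (curv phi xi q / 2 * (jet1 phi q (p01 x) - jet1 phi q (p10 x))) *:
    proj10 phi xi q (Y q) +
  cderive (fun q' => jet1 phi q' (p10 (Y q'))) q x *: xi q.

HB.lock Definition nablaGL (R : realType) (n : nat) (phi : 'rV[R]_(n + n) -> R)
    (xi : 'rV[R]_(n + n) -> 'rV[R[i]]_(n + n)) (q : 'rV[R]_(n + n))
    (x : 'rV[R[i]]_(n + n)) (Y : 'rV[R]_(n + n) -> 'rV[R[i]]_(n + n)) :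
  'rV[R[i]]_(n + n) :=
  nabla10 phi xi q x Y + conj_vec (nabla10 phi xi q (conj_vec x) (conj_field Y)).

Section Nabla.
Variables (R : realType) (n : nat) (phi : 'rV[R]_(n + n) -> R).
Variables (V : set 'rV[R]_(n + n)) (xi : 'rV[R]_(n + n) -> 'rV[R[i]]_(n + n)).
Implicit Types (u v w x Z W U : 'rV[R[i]]_(n + n)) (q : 'rV[R]_(n + n)).
Implicit Types (X Y : 'rV[R]_(n + n) -> 'rV[R[i]]_(n + n)).
Hypothesis sphi : smooth_on setT (phi : _ -> R^o).
Hypothesis oV : open V.
Hypothesis spc : forall p, V p -> spc_at phi p.
Hypothesis xiP : is_xi phi V xi.

Notation D1 := (jet1 phi).
Notation D2 := (jet2 phi).
Notation D3 := (jet3 phi).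
Notation pi := (proj10 phi xi).
Notation xib q := (conj_vec (xi q)).
Notation r := (curv phi xi).
Notation Gam := (christoffel phi xi).
Notation sm := (smooth_cfield V).

Let D1D := jet1D sphi.
Let D1Z := jet1Z sphi.
Let D2J := jet2_conj sphi.
Let D2s := jet2_sym sphi.
Let D2Dl := jet2Dl sphi.
Let D2Zl := jet2Zl sphi.
Let D2Dr := jet2Dr sphi.
Let D2Zr := jet2Zr sphi.
Let sxi := smooth_xi xiP.

(** Differentiate the constant D1(Y) = c. The Hessian thus measures how far a flat derivative leaves
    the kernel of D1; the lemma serves sections of T_{1,0} with c = 0 and xi with c = 1. *)
Lemma jet1_dvec Y c p v : V p -> sm Y -> (forall q, V q -> D1 q (Y q) = c) ->
  D1 p (dvec Y p v) = - D2 p v (Y p).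
Proof.
move=> Vp sY cY; have := derive_jet1 sphi oV v Vp sY.
have -> : cderive (fun q => D1 q (Y q)) p v = 0.
  by rewrite -(cderive_cst p c v); apply: (cderive_eq oV).
by move/esym/eqP; rewrite addrC addr_eq0 => /eqP.
Qed.

Lemma jet1_bracket X Y c d p : V p -> sm X -> sm Y ->
  (forall q, V q -> D1 q (X q) = c) -> (forall q, V q -> D1 q (Y q) = d) ->
  D1 p (bracket X Y p) = 0.
Proof.
move=> Vp sX sY cX cY; rewrite bracketE (jet1B sphi).
rewrite (jet1_dvec _ Vp sX cX) (jet1_dvec _ Vp sY cY) (D2s p (Y p)).
by rewrite opprK addNr.
Qed.

Section AtPoint.
Variable p : 'rV[R]_(n + n).
Hypothesis Vp : V p.

(** Since xi is orthogonal to T_{0,1}, only the xi component of v contributes, with D2(xi, conj xi)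
    = r. *)
Lemma jet2_xi_conj v : type10 v -> D2 p (xi p) (conj_vec v) = (D1 p v)^*%C * r p.
Proof.
move=> tv; rewrite {1}(proj10_type10 phi xi p tv) conj_vecD conj_vecZ D2Dr D2Zr.
by rewrite (xi_orth sphi xiP Vp (proj10_T10 sphi xiP Vp v)) add0r (curvE sphi xiP Vp).
Qed.

Lemma jet2_xib v : type10 v -> D2 p v (xib p) = D1 p v * r p.
Proof.
move=> tv; rewrite D2s -(conjcK (D2 p _ _)) -D2J conj_vecK jet2_xi_conj //.
by rewrite conjcM conjcK (curv_real sphi xiP Vp).
Qed.

Lemma jet2_proj10 v U : type10 v -> T10 phi p U ->
  D2 p (pi p v) (conj_vec U) = D2 p v (conj_vec U).
Proof.
move=> tv tU; rewrite {2}(proj10_type10 phi xi p tv) D2Dl D2Zl.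
by rewrite (xi_orth sphi xiP Vp tU) mulr0 addr0.
Qed.

(** Projecting the constant field [U] extends it to a section, so a pointwise identity can be proved
    by differentiating a relation between sections. *)
Lemma T10_extend U : T10 phi p U -> exists Y,
  [/\ sm Y, forall q, V q -> T10 phi q (Y q) & Y p = U].
Proof.
move=> tU; exists (fun q => pi q U); split.
- by apply: (smooth_proj10 sphi oV xiP); apply: smooth_cfield_cst.
- by move=> q Vq; exact: (proj10_T10 sphi xiP Vq).
- exact: (proj10_id xi tU).
Qed.

Lemma T10_jet1 Y : (forall q, V q -> T10 phi q (Y q)) ->
  forall q, V q -> D1 q (Y q) = 0.
Proof. by move=> tY q Vq; case/T10E: (tY q Vq). Qed.
Lemma T10_type10 Y : (forall q, V q -> T10 phi q (Y q)) ->
  forall q, V q -> type10 (Y q).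
Proof. by move=> tY q Vq; case/T10E: (tY q Vq). Qed.

Lemma dvec_xi_type10 v : type10 (dvec xi p v).
Proof. by apply: (type10_dvec oV Vp) => // q Vq; exact: (xi_type10 xiP Vq). Qed.
Lemma jet1_dvec_xi v : D1 p (dvec xi p v) = - D2 p v (xi p).
Proof. by apply: (jet1_dvec _ Vp sxi (c := 1)) => q Vq;
  exact: (jet1_xi sphi xiP Vq). Qed.
Lemma dvec_xib v : dvec (conj_field xi) p v = conj_vec (dvec xi p (conj_vec v)).
Proof. exact: (dvec_conj oV Vp). Qed.

(* Differentiate L(xi, conj U) = 0 along W and use the symmetry of the third
   derivatives of phi. *)
Lemma curv_identity W U : T10 phi p W -> T10 phi p U ->
  D3 p (xi p) W (conj_vec U) + D2 p (dvec xi p W) (conj_vec U) =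
  r p * D2 p W (conj_vec U).
Proof.
move=> tW tU; have [Y [sY tY YU]] := T10_extend tU.
have sYb := smooth_cfield_conj oV sY.
have := derive_jet2 sphi oV W Vp sxi sYb.
have -> : cderive (fun q => D2 q (xi q) (conj_field Y q)) p W = 0.
  rewrite -(cderive_cst p 0 W); apply: (cderive_eq oV) => // q Vq.
  exact: (xi_orth sphi xiP Vq (tY q Vq)).
have YbU : conj_field Y p = conj_vec U by rewrite /conj_field YU.
rewrite YbU (dvec_conj oV Vp) // jet2_xi_conj; last first.
  exact: (type10_dvec oV Vp _ sY (T10_type10 tY)).
rewrite (jet1_dvec _ Vp sY (T10_jet1 tY)) YU conjcN -D2J conj_vecK.
rewrite (jet3_sym12 sphi) mulNr => /esym/eqP.
by rewrite subr_eq0 mulrC => /eqP.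
Qed.

End AtPoint.

Notation A := (nabla10 phi xi).
Notation cf q x := (r q / 2 * (D1 q (p01 x) - D1 q (p10 x))).

Lemma smooth_nabla10 X Y : sm X -> sm Y -> sm (fun q => A q (X q) Y).
Proof.
move=> sX sY; have sp := smooth_proj10 sphi oV xiP sY.
have s10 := smooth_p10 oV sX.
have s01 : sm (fun q => p01 (X q)).
  by apply: (smooth_cfield_eq oV _ (smooth_cfieldB oV sX s10)) => q _; rewrite p01_sub.
have s1 : sm (fun q => pi q (dvec (fun q' => pi q' (Y q')) q (X q))).
  by apply: (smooth_proj10 sphi oV xiP); apply: smooth_dvec.
have s2 : sm (fun q => Gam q (p10 (X q)) (pi q (Y q))).
  exact: (smooth_christoffel sphi oV spc xiP s10 sp).
have sc : csmooth V (fun q => cf q (X q)).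
  apply: csmoothM => //.
    by apply: csmoothM => //; [exact: (smooth_curv sphi oV xiP) | exact: csmooth_cst].
  by apply: csmoothB => //; apply: smooth_jet1.
have s3 : sm (fun q => cf q (X q) *: pi q (Y q)) by exact: smooth_cfieldZ.
have s4 : sm (fun q => cderive (fun q' => D1 q' (p10 (Y q'))) q (X q) *: xi q).
  apply: smooth_cfieldZ => //; apply: csmooth_cderive => //.
  by apply: smooth_jet1 => //; apply: smooth_p10.
have s123 := smooth_cfieldD oV (smooth_cfieldD oV s1 s2) s3.
by apply: (smooth_cfield_eq oV _ (smooth_cfieldD oV s123 s4)) => q _;
  rewrite nabla10.unlock.
Qed.

Section NablaAt.
Variable p : 'rV[R]_(n + n).
Hypothesis Vp : V p.

Lemma cf_D x y : cf p (x + y) = cf p x + cf p y.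
Proof.
rewrite p01D p10D !D1D; move: (r p / 2) (D1 _ _) (D1 _ _) (D1 _ _) (D1 _ _) => *; ring.
Qed.
Lemma cf_Z c x : cf p (c *: x) = c * cf p x.
Proof.
rewrite p01Z p10Z !D1Z; move: (r p / 2) (D1 _ _) (D1 _ _) => *; ring.
Qed.

Let sD1 Y : sm Y -> csmooth V (fun q => D1 q (p10 (Y q))).
Proof. by move=> sY; apply: smooth_jet1 => //; apply: smooth_p10. Qed.
Let spi Y : sm Y -> sm (fun q => pi q (Y q)).
Proof. exact: (smooth_proj10 sphi oV xiP). Qed.

Lemma add4A (a b c d a' b' c' d' : 'rV[R[i]]_(n + n)) :
  a + a' + (b + b') + (c + c') + (d + d') = a + b + c + d + (a' + b' + c' + d').
Proof. by rewrite (addrACA a) (addrACA (a + b)) (addrACA (a + b + c)). Qed.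

Lemma nabla10Dx x y Y : sm Y -> A p (x + y) Y = A p x Y + A p y Y.
Proof.
move=> sY; rewrite nabla10.unlock (dvecDv oV Vp _ _ (spi sY)) (proj10D xi sphi) p10D.
rewrite (christoffelDl sphi spc xiP Vp) -p10D cf_D scalerDl.
by rewrite (cderiveDv Vp _ _ (sD1 sY)) scalerDl add4A.
Qed.

Lemma nabla10Zx c x Y : sm Y -> A p (c *: x) Y = c *: A p x Y.
Proof.
move=> sY; rewrite nabla10.unlock (dvecZv oV Vp _ _ (spi sY)) (proj10Z xi sphi).
rewrite cf_Z p10Z (christoffelZl sphi spc xiP Vp).
by rewrite (cderiveZv Vp _ _ (sD1 sY)) -!scalerA -!scalerDr.
Qed.

Lemma nabla10D x X Y : sm X -> sm Y ->
  A p x (fun q => X q + Y q) = A p x X + A p x Y.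
Proof.
move=> sX sY; rewrite nabla10.unlock.
rewrite (@dvec_eq _ _ _ oV p Vp _ (fun q => pi q (X q) + pi q (Y q))); last first.
  by move=> q _; rewrite (proj10D xi sphi).
have -> : cderive (fun q => D1 q (p10 (X q + Y q))) p x =
    cderive (fun q => D1 q (p10 (X q)) + D1 q (p10 (Y q))) p x.
  by apply: (cderive_eq oV) => // q _; rewrite p10D D1D.
rewrite (dvecD oV Vp _ (spi sX) (spi sY)) !(proj10D xi sphi).
rewrite (christoffelDr sphi spc xiP Vp) scalerDr.
by rewrite (cderiveD oV Vp _ (sD1 sX) (sD1 sY)) scalerDl add4A.
Qed.

Lemma nabla10M x F Y : csmooth V F -> sm Y ->
  A p x (fun q => F q *: Y q) = cderive F p x *: p10 (Y p) + F p *: A p x Y.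
Proof.
move=> sF sY; rewrite nabla10.unlock.
rewrite (@dvec_eq _ _ _ oV p Vp _ (fun q => F q *: pi q (Y q))); last first.
  by move=> q _; rewrite (proj10Z xi sphi).
have -> : cderive (fun q => D1 q (p10 (F q *: Y q))) p x =
    cderive (fun q => F q * D1 q (p10 (Y q))) p x.
  by apply: (cderive_eq oV) => // q _; rewrite p10Z D1Z.
rewrite (dvecZ oV Vp _ sF (spi sY)) (proj10D xi sphi) !(proj10Z xi sphi).
rewrite (christoffelZr sphi spc xiP Vp) (cderiveM oV Vp _ sF (sD1 sY)).
(* The derivative of [F] appears twice, on the T_{1,0} component and on the xi coefficient;
   [p10_decomp] reassembles the two into the full (1,0) part of [Y]. *)
rewrite (proj10_id xi (proj10_T10 sphi xiP Vp _)) {2}(p10_decomp phi xi p (Y p)).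
move: (cderive F p x) (cderive _ p x) (F p) (D1 p (p10 (Y p))) => a b c d.
move: (pi p (dvec _ _ _)) (Gam _ _ _) (cf p x) => e f g.
move: (pi p (Y p)) (xi p) => h k.
by apply/rowP => j; rewrite !mxE; ring.
Qed.

End NablaAt.
End Nabla.

(** * The real connection and its complex extension *)

Section Connection.
Variables (R : realType) (n : nat) (phi : 'rV[R]_(n + n) -> R).
Variables (V : set 'rV[R]_(n + n)) (xi : 'rV[R]_(n + n) -> 'rV[R[i]]_(n + n)).
Let E : Type := 'rV[R]_(n + n).
Implicit Types (u v w x Z W U : 'rV[R[i]]_(n + n)) (q : 'rV[R]_(n + n)).
Implicit Types (X Y : 'rV[R]_(n + n) -> 'rV[R[i]]_(n + n)).
Hypothesis sphi : smooth_on setT (phi : _ -> R^o).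
Hypothesis oV : open V.
Hypothesis spc : forall p, V p -> spc_at phi p.
Hypothesis xiP : is_xi phi V xi.

Notation D1 := (jet1 phi).
Notation pi := (proj10 phi xi).
Notation r := (curv phi xi).
Notation Gam := (christoffel phi xi).
Notation sm := (smooth_cfield V).

Notation A := (nabla10 phi xi).
Notation N := (nablaGL phi xi).
Notation cf q x := (r q / 2 * (D1 q (p01 x) - D1 q (p10 x))).

Let sJ := smooth_cfield_conj oV.

Lemma smooth_nablaGL X Y : sm X -> sm Y -> sm (fun q => N q (X q) Y).
Proof.
move=> sX sY.
have s1 := smooth_nabla10 sphi oV spc xiP sX sY.
have s2 := sJ (smooth_nabla10 sphi oV spc xiP (sJ sX) (sJ sY)).
by apply: (smooth_cfield_eq oV _ (smooth_cfieldD oV s1 s2)) => q _;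
  rewrite nablaGL.unlock.
Qed.

Section AtPoint.
Variable p : 'rV[R]_(n + n).
Hypothesis Vp : V p.

Lemma nablaGLDx x y Y : sm Y -> N p (x + y) Y = N p x Y + N p y Y.
Proof.
move=> sY; rewrite nablaGL.unlock conj_vecD.
rewrite (nabla10Dx sphi oV spc xiP Vp x y sY).
by rewrite (nabla10Dx sphi oV spc xiP Vp _ _ (sJ sY)) conj_vecD addrACA.
Qed.

Lemma nablaGLZx c x Y : sm Y -> N p (c *: x) Y = c *: N p x Y.
Proof.
move=> sY; rewrite nablaGL.unlock conj_vecZ.
rewrite (nabla10Zx sphi oV spc xiP Vp c x sY).
by rewrite (nabla10Zx sphi oV spc xiP Vp _ _ (sJ sY)) conj_vecZ conjcK scalerDr.
Qed.

Lemma nablaGLD x X Y : sm X -> sm Y ->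
  N p x (fun q => X q + Y q) = N p x X + N p x Y.
Proof.
move=> sX sY; rewrite nablaGL.unlock (nabla10D sphi oV spc xiP Vp x sX sY).
have -> : conj_field (fun q => X q + Y q) = fun q => conj_field X q + conj_field Y q.
  by apply: funext => q; exact: conj_vecD.
by rewrite (nabla10D sphi oV spc xiP Vp _ (sJ sX) (sJ sY)) conj_vecD addrACA.
Qed.

Lemma nablaGLM x F Y : csmooth V F -> sm Y ->
  N p x (fun q => F q *: Y q) = cderive F p x *: Y p + F p *: N p x Y.
Proof.
move=> sF sY; rewrite nablaGL.unlock (nabla10M sphi oV spc xiP Vp x sF sY).
have -> : conj_field (fun q => F q *: Y q) = fun q => (F q)^*%C *: conj_field Y q.
  by apply: funext => q; exact: conj_vecZ.
rewrite (nabla10M sphi oV spc xiP Vp _ (csmooth_conj oV sF) (sJ sY)).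
rewrite conj_vecD !conj_vecZ conjcK (cderive_conj oV Vp _ sF) conjcK conj_vecK.
rewrite -[conj_vec (p10 _)]p01E addrACA -scalerDr -scalerDr.
by rewrite p10_p01.
Qed.

Lemma nablaGLZ x c Y : sm Y -> N p x (fun q => c *: Y q) = c *: N p x Y.
Proof.
move=> sY; rewrite (nablaGLM x (csmooth_cst oV c) sY) (cderive_cst p).
by rewrite scale0r add0r.
Qed.

Lemma nablaGL_conj x Y : N p (conj_vec x) (conj_field Y) = conj_vec (N p x Y).
Proof.
rewrite nablaGL.unlock conj_vecK.
have -> : conj_field (conj_field Y) = Y.
  by apply: funext => q; exact: conj_vecK.
by rewrite conj_vecD conj_vecK addrC.
Qed.

(** Such a field has (1,0) part c xi with c constant. The three cases needed are conjugates of
    sections of T_{1,0} (c = 0), T (c = i) and N (c = 1). *)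
Lemma nabla10_vanish x Y c : (forall q, V q -> pi q (Y q) = 0) ->
  (forall q, V q -> D1 q (p10 (Y q)) = c) -> A p x Y = 0.
Proof.
move=> pY cY; rewrite nabla10.unlock pY //.
have -> : dvec (fun q => pi q (Y q)) p x = 0.
  by rewrite -(dvec_cst p 0 x); apply: (dvec_eq oV Vp).
have -> : cderive (fun q => D1 q (p10 (Y q))) p x = 0.
  by rewrite -(cderive_cst p c x); apply: (cderive_eq oV).
rewrite (christoffel0r sphi spc xiP Vp) (proj10_0 xi sphi) scaler0 scale0r.
by rewrite !addr0.
Qed.

Lemma nablaGL_T10 x Y : sm Y -> (forall q, V q -> T10 phi q (Y q)) ->
  N p x Y = pi p (dvec Y p x) + Gam p (p10 x) (Y p) + cf p x *: Y p.
Proof.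
move=> sY tY; rewrite nablaGL.unlock.
have tY10 q : V q -> type10 (Y q) by move=> Vq; case/T10E: (tY q Vq).
have D1Y q : V q -> D1 q (Y q) = 0 by move=> Vq; case/T10E: (tY q Vq).
rewrite (@nabla10_vanish _ (conj_field Y) 0); first last.
- by move=> q Vq; rewrite (p10_conj0 (tY10 q Vq)) (jet1_0 sphi).
- by move=> q Vq; exact: (proj10_conj0 xi sphi q (tY10 q Vq)).
rewrite conj_vec0 addr0 nabla10.unlock (proj10_id xi (tY p Vp)).
have -> : dvec (fun q => pi q (Y q)) p x = dvec Y p x.
  by apply: (dvec_eq oV Vp) => q Vq; exact: (proj10_id xi (tY q Vq)).
have -> : cderive (fun q => D1 q (p10 (Y q))) p x = 0.
  rewrite -(cderive_cst p 0 x); apply: (cderive_eq oV) => // q Vq.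
  by rewrite (p10_id (tY10 q Vq)) D1Y.
by rewrite scale0r addr0.
Qed.

End AtPoint.

Definition connGL (X Y : E -> E) : E -> E :=
  fun p => re_vec (N p (cplx (X p)) (cfield Y)).

Let sC (X : E -> E) := (smooth_fieldP oV X).1.

(** By [nablaGL_conj] the value on real arguments equals its conjugate, so taking the real part in
    [connGL] discards nothing. *)
Lemma cplx_connGL (X Y : E -> E) p :
  cplx (connGL X Y p) = N p (cplx (X p)) (cfield Y).
Proof.
apply: cplx_real; rewrite -nablaGL_conj conj_cplx.
by have -> : conj_field (cfield Y) = cfield Y by apply: funext => q; exact: conj_cplx.
Qed.

Lemma smooth_re_im X : sm X -> sm (cfield (re_field X)) /\ sm (cfield (im_field X)).
Proof. by move=> [sR sI]; split; apply: sC. Qed.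

(** The C-bilinear extension of [connGL] is [nablaGL] again, so all conditions on the connection can
    be verified with complex fields and the explicit formula. *)
Lemma nablaC_connGL X Y p : V p -> sm X -> sm Y ->
  nablaC connGL X Y p = N p (X p) Y.
Proof.
move=> Vp sX sY; rewrite /nablaC cplxD cplxN cplxD !cplx_connGL.
have [sYr sYi] := smooth_re_im sY.
have EY : Y = fun q => cfield (re_field Y) q + 'i%C *: cfield (im_field Y) q.
  by apply: funext => q; exact: cplx_re_im.
have siY : sm (fun q => 'i%C *: cfield (im_field Y) q).
  by apply: smooth_cfieldZ => //; exact: csmooth_cst.
have -> : N p (X p) Y = N p (X p) (cfield (re_field Y)) +
    'i%C *: N p (X p) (cfield (im_field Y)).
  rewrite -(nablaGLZ Vp _ _ sYi); apply: etrans _ (nablaGLD Vp _ sYr siY).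
  by congr (N p _ _); exact: EY.
rewrite (cplx_re_im (X p)) (nablaGLDx Vp _ _ sYr) (nablaGLDx Vp _ _ sYi).
rewrite (nablaGLZx Vp _ _ sYr) (nablaGLZx Vp _ _ sYi).
rewrite -/(re_field X p) -/(im_field X p).
move: (N p _ _) (N p _ _) (N p _ _) (N p _ _) => a b c d.
by apply/rowP => j; rewrite !mxE; ring: (@iiC R).
Qed.

Lemma cderive_real (f : E -> R^o) p (x : E) :
  cderive (fun q => (f q)%:C) p (cplx x) = ('D_x f p : R)%:C.
Proof.
apply: etrans (cderive_cplx _ _ _) _; apply: complex_eq => //.
exact: (derive_cst (0 : R^o) p x).
Qed.

Lemma connGL_is_connection : is_connection V connGL.
Proof.
split.
- move=> X Y sX sY.
  by case: (smooth_nablaGL (sC sX) (sC sY)).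
- move=> X X' Y sX sX' sY p Vp; apply: cplx_inj.
  by rewrite cplxD !cplx_connGL cplxD (nablaGLDx Vp _ _ (sC sY)).
- move=> X Y Y' sX sY sY' p Vp; apply: cplx_inj.
  rewrite cplxD !cplx_connGL -(nablaGLD Vp _ (sC sY) (sC sY')).
  by congr (N p _ _); apply: funext => q; exact: cplxD.
- move=> f X Y sf sX sY p Vp; apply: cplx_inj.
  by rewrite cplxZ !cplx_connGL cplxZ (nablaGLZx Vp _ _ (sC sY)).
move=> f X Y sf sX sY p Vp; apply: cplx_inj.
rewrite cplxD !cplxZ !cplx_connGL -cderive_real.
rewrite -(nablaGLM Vp _ (csmooth_real oV sf) (sC sY)).
by congr (N p _ _); apply: funext => q; exact: cplxZ.
Qed.

End Connection.

(** * Parallelism of T, N, the CR structure and the Levi form *)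

Section Existence.
Variables (R : realType) (n : nat) (phi : 'rV[R]_(n + n) -> R).
Variables (V : set 'rV[R]_(n + n)) (xi : 'rV[R]_(n + n) -> 'rV[R[i]]_(n + n)).
Let E : Type := 'rV[R]_(n + n).
Implicit Types (u v w x Z W U : 'rV[R[i]]_(n + n)) (q : 'rV[R]_(n + n)).
Implicit Types (X Y : 'rV[R]_(n + n) -> 'rV[R[i]]_(n + n)).
Hypothesis sphi : smooth_on setT (phi : _ -> R^o).
Hypothesis oV : open V.
Hypothesis spc : forall p, V p -> spc_at phi p.
Hypothesis xiP : is_xi phi V xi.

Notation D1 := (jet1 phi).
Notation D2 := (jet2 phi).
Notation D3 := (jet3 phi).
Notation pi := (proj10 phi xi).
Notation xib q := (conj_vec (xi q)).
Notation r := (curv phi xi).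
Notation sm := (smooth_cfield V).

Let D1Z := jet1Z sphi.
Let D1J := jet1_conj sphi.
Let D2J := jet2_conj sphi.
Let D2s := jet2_sym sphi.
Let D2Dl := jet2Dl sphi.
Let D2Zl := jet2Zl sphi.
Let sxi := smooth_xi xiP.

Notation N := (nablaGL phi xi).
Notation cf q x := (r q / 2 * (D1 q (p01 x) - D1 q (p10 x))).
Notation T := (Tfield xi).
Notation Nu := (Nfield xi).

Let sJ := smooth_cfield_conj oV.

Lemma cplx_Tfield q : cplx (T q) = 'i%C *: (xi q - xib q).
Proof.
apply/rowP => a; rewrite !mxE; case: (xi q 0 a) => x y.
by apply: complex_eq => /=; ring.
Qed.
Lemma cplx_Nfield q : cplx (Nu q) = xi q + xib q.
Proof.
apply/rowP => a; rewrite !mxE; case: (xi q 0 a) => x y.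
by apply: complex_eq => /=; ring.
Qed.

Let sxib : sm (conj_field xi) := sJ sxi.

Lemma smooth_Tfield : sm (cfield T).
Proof.
have s1 := smooth_cfieldZ oV (csmooth_cst oV 'i%C) (smooth_cfieldB oV sxi sxib).
by apply: (smooth_cfield_eq oV _ s1) => q _; rewrite /cfield cplx_Tfield.
Qed.
Lemma smooth_Nfield : sm (cfield Nu).
Proof.
by apply: (smooth_cfield_eq oV _ (smooth_cfieldD oV sxi sxib)) => q _;
  rewrite /cfield cplx_Nfield.
Qed.

Lemma p10_Tfield q : V q -> p10 (cplx (T q)) = 'i%C *: xi q.
Proof.
move=> Vq; rewrite cplx_Tfield p10Z p10D p10N (p10_xi xiP Vq) (p10_xib xiP Vq).
by rewrite subr0.
Qed.
Lemma p10_Nfield q : V q -> p10 (cplx (Nu q)) = xi q.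
Proof.
move=> Vq; rewrite cplx_Nfield p10D (p10_xi xiP Vq) (p10_xib xiP Vq).
by rewrite addr0.
Qed.

Lemma nablaGL_real_vanish p x (Y : E -> E) c : V p ->
  (forall q, V q -> p10 (cplx (Y q)) = c *: xi q) -> N p x (cfield Y) = 0.
Proof.
move=> Vp hY; rewrite nablaGL.unlock.
have -> : conj_field (cfield Y) = cfield Y by apply: funext => q; exact: conj_cplx.
have dY q : V q -> D1 q (p10 (cfield Y q)) = c.
  by move=> Vq; rewrite hY // D1Z (jet1_xi sphi xiP Vq) mulr1.
have pY q : V q -> pi q (cfield Y q) = 0.
  move=> Vq; rewrite proj10.unlock dY // hY //; exact: subrr.
have V0 y := nabla10_vanish sphi oV spc xiP Vp y pY dY.
by rewrite !V0 conj_vec0 addr0.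
Qed.

Lemma nablaGL_Tfield p x : V p -> N p x (cfield T) = 0.
Proof. by move=> Vp; apply: nablaGL_real_vanish => // q Vq; exact: p10_Tfield. Qed.
Lemma nablaGL_Nfield p x : V p -> N p x (cfield Nu) = 0.
Proof.
move=> Vp; apply: (@nablaGL_real_vanish _ _ _ 1) => // q Vq.
by rewrite scale1r p10_Nfield.
Qed.

Lemma field_parallel_Tfield : field_parallel V (connGL phi xi) T.
Proof.
move=> X sX p Vp; apply: cplx_inj; rewrite (cplx_connGL phi xi) nablaGL_Tfield //.
by apply/rowP => a; rewrite !mxE.
Qed.
Lemma field_parallel_Nfield : field_parallel V (connGL phi xi) Nu.
Proof.
move=> X sX p Vp; apply: cplx_inj; rewrite (cplx_connGL phi xi) nablaGL_Nfield //.
by apply/rowP => a; rewrite !mxE.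
Qed.

Lemma T10_sectionP Y : T10_section phi V Y ->
  [/\ sm Y, forall q, V q -> T10 phi q (Y q), forall q, V q -> type10 (Y q)
    & forall q, V q -> D1 q (Y q) = 0].
Proof.
by move=> [sY tY]; split=> // q Vq; have [] := (T10E phi q _).1 (tY q Vq).
Qed.

Let nC := nablaC_connGL sphi oV spc xiP.
Let nT10 := nablaGL_T10 sphi oV spc xiP.

Lemma nablaGL_is_T10 p x Y : V p -> T10_section phi V Y -> T10 phi p (N p x Y).
Proof.
move=> Vp [sY tY]; rewrite (nT10 Vp _ sY tY).
apply: (T10_D sphi); last exact: (T10_Z sphi _ (tY p Vp)).
apply: (T10_D sphi); first exact: (proj10_T10 sphi xiP Vp).
exact: (christoffel_T10 sphi xiP Vp).
Qed.

Lemma T10_parallel_connGL : T10_parallel phi V (connGL phi xi).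
Proof.
move=> X Z sX hZ; have [sZ _] := hZ; have sX' := (smooth_fieldP oV X).1 sX.
split.
  apply: (smooth_cfield_eq oV _ (smooth_nablaGL sphi oV spc xiP sX' sZ)) => q Vq.
  by rewrite nC.
by move=> q Vq; rewrite nC //; exact: nablaGL_is_T10.
Qed.

(** The coefficient is imaginary on real vectors because r is real and conjugation exchanges del phi
    and delbar phi. This sign makes the two correction terms cancel in nabla L. *)
Lemma cf_conj p x : V p -> (cf p (conj_vec x))^*%C = - cf p x.
Proof.
move=> Vp; rewrite p01_conj p10_conj !D1J conjcM conjcM (curv_real sphi xiP Vp).
have -> : ((2 : R[i])^-1)^*%C = 2^-1 by rewrite fmorphV rmorph_nat.
rewrite conjcD conjcN !conjcK; move: (r p / 2) (D1 _ _) (D1 _ _) => a b c; ring.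
Qed.

Lemma jet2_nablaGL p x Y U : V p -> T10_section phi V Y -> T10 phi p U ->
  D2 p (N p x Y) (conj_vec U) = D2 p (dvec Y p x) (conj_vec U) +
    D3 p (p10 x) (Y p) (conj_vec U) + cf p x * D2 p (Y p) (conj_vec U).
Proof.
move=> Vp hY tU; have [sY tY t1 _] := T10_sectionP hY.
rewrite (nT10 Vp _ sY tY) !D2Dl D2Zl (christoffelP sphi spc xiP Vp _ _ tU).
by rewrite (jet2_proj10 sphi xiP Vp (type10_dvec oV Vp x sY t1) tU).
Qed.

Lemma nablaGL_conj_field p x Y :
  N p x (conj_field Y) = conj_vec (N p (conj_vec x) Y).
Proof. by rewrite -(nablaGL_conj phi xi) conj_vecK. Qed.

(** The product rule for D2(Z, conj W) produces one D3 term and two flat derivatives. The latter are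
    matched by the projected derivatives in nabla Z and nabla W; the former is shared between
    Gamma(., Z) and the conjugate of Gamma(., W). *)
Lemma L_parallel_connGL : L_parallel phi V (connGL phi xi).
Proof.
move=> X Z W sX hZ hW p Vp.
have [sZ tZ tZ1 _] := T10_sectionP hZ; have [sW tW tW1 _] := T10_sectionP hW.
have sX' := (smooth_fieldP oV X).1 sX.
have t10 Y x : T10_section phi V Y -> type10 (N p x Y).
  by move=> hY; have [] := (T10E phi p _).1 (nablaGL_is_T10 x Vp hY).
rewrite !nC //; last exact: sJ.
rewrite nablaGL_conj_field (Ltheta_T10 sphi) ?(Ltheta_T10 sphi);
  try by [exact: t10 | exact: tZ1 | exact: tW1].
rewrite /cfield; set x := cplx (X p).
have -> : conj_vec x = x by exact: conj_cplx.
have -> : cderive (fun q => Ltheta phi q (Z q) (conj_field W q)) p x =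
    2^-1 * cderive (fun q => D2 q (Z q) (conj_field W q)) p x.
  rewrite -(cderiveZ oV Vp _ _ (smooth_jet2 sphi oV sZ (sJ sW))).
  by apply: (cderive_eq oV) => // q Vq; rewrite (Ltheta_T10 sphi) //;
    [exact: tZ1|exact: tW1].
rewrite (derive_jet2 sphi oV x Vp sZ (sJ sW)).
rewrite (jet2_nablaGL x Vp hZ (tW p Vp)).
have -> : D2 p (Z p) (conj_vec (N p x W)) =
    (D2 p (N p x W) (conj_vec (Z p)))^*%C by rewrite -D2J conj_vecK D2s.
rewrite (jet2_nablaGL x Vp hW (tZ p Vp)) !conjcD conjcM -!D2J -(jet3_conj sphi).
rewrite conj_vecK -[x in cf p x]conj_cplx (cf_conj _ Vp).
rewrite (dvec_conj oV Vp _ sW) conj_cplx -/x.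
rewrite -[conj_vec (p10 x)]p01_conj conj_cplx -/x -[conj_field W p]/(conj_vec (W p)).
(* Splitting the direction in D3: its (1,0) part is absorbed by the symbol acting on [Z], its (0,1)
   part by the conjugate of the symbol acting on [W]. *)
rewrite -{1}(p10_p01 x) (jet3D sphi).
rewrite (jet3_sym23 sphi p (p01 x)) (D2s p (conj_vec (W p)))
  (D2s p (conj_vec (dvec W p x))).
move: (D3 _ _ _ _) (D3 _ _ _ _) (D2 _ _ _) (D2 _ _ _) (D2 _ _ _) (cf p x) =>
  a b c d e f.
ring.
Qed.

End Existence.

(** * The torsion on T_{1,0}, T and N *)

Section Torsion.
Variables (R : realType) (n : nat) (phi : 'rV[R]_(n + n) -> R).
Variables (V : set 'rV[R]_(n + n)) (xi : 'rV[R]_(n + n) -> 'rV[R[i]]_(n + n)).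
Implicit Types (u v w x U : 'rV[R[i]]_(n + n)) (q : 'rV[R]_(n + n)).
Implicit Types (X Y Z W : 'rV[R]_(n + n) -> 'rV[R[i]]_(n + n)).
Hypothesis sphi : smooth_on setT (phi : _ -> R^o).
Hypothesis oV : open V.
Hypothesis spc : forall p, V p -> spc_at phi p.
Hypothesis xiP : is_xi phi V xi.

Notation D1 := (jet1 phi).
Notation D2 := (jet2 phi).
Notation D3 := (jet3 phi).
Notation pi := (proj10 phi xi).
Notation xib q := (conj_vec (xi q)).
Notation r := (curv phi xi).
Notation Gam := (christoffel phi xi).
Notation sm := (smooth_cfield V).

Let D1J := jet1_conj sphi.
Let D2J := jet2_conj sphi.
Let D2s := jet2_sym sphi.
Let D2Dl := jet2Dl sphi.
Let D2Zl := jet2Zl sphi.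
Let sxi := smooth_xi xiP.

Notation N := (nablaGL phi xi).
Notation cf q x := (r q / 2 * (D1 q (p01 x) - D1 q (p10 x))).
Notation T := (Tfield xi).
Notation Nu := (Nfield xi).
Notation D := (connGL phi xi).

Let sJ := smooth_cfield_conj oV.
Let sxib : sm (conj_field xi) := sJ sxi.
Let nC := nablaC_connGL sphi oV spc xiP.
Let nT10 := nablaGL_T10 sphi oV spc xiP.
Let sT : sm (cfield T) := smooth_Tfield oV xiP.
Let sN : sm (cfield Nu) := smooth_Nfield oV xiP.

(** Flat derivatives preserve type (1,0), and the two Hessian terms in D1 of the bracket cancel by
    symmetry. Arbitrary constants are allowed so that brackets with xi, where D1 is 1, are
    covered. *)
Lemma bracket_T10 X Y c d p : V p -> sm X -> sm Y ->
  (forall q, V q -> type10 (X q)) -> (forall q, V q -> type10 (Y q)) ->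
  (forall q, V q -> D1 q (X q) = c) -> (forall q, V q -> D1 q (Y q) = d) ->
  T10 phi p (bracket X Y p).
Proof.
move=> Vp sX sY tX tY cX cY; apply/T10E; split;
  last exact: (jet1_bracket sphi oV Vp sX sY cX cY).
rewrite bracketE; apply: type10D; first exact: (type10_dvec oV Vp _ sY tY).
by apply: type10N; exact: (type10_dvec oV Vp _ sX tX).
Qed.

Lemma torsion_connGL X Y p : V p -> sm X -> sm Y ->
  torsion D X Y p = N p (X p) Y - N p (Y p) X - (dvec Y p (X p) - dvec X p (Y p)).
Proof. by move=> Vp sX sY; rewrite /torsion !nC // bracketE. Qed.

Section AtPoint.
Variable p : 'rV[R]_(n + n).
Hypothesis Vp : V p.

Lemma cf_type10 v : type10 v -> D1 p v = 0 -> cf p v = 0.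
Proof. by move=> tv dv; rewrite p01_0P // p10_id // dv (jet1_0 sphi) subrr;
  exact: mulr0. Qed.
Lemma cf_conj_type10 v : type10 v -> D1 p v = 0 -> cf p (conj_vec v) = 0.
Proof.
move=> tv dv; rewrite p01_conj_id // p10_conj0 // D1J dv (jet1_0 sphi) conjc0 subrr.
exact: mulr0.
Qed.

Lemma nablaGL_T10_T10 v W : T10_section phi V W -> T10 phi p v ->
  N p v W = pi p (dvec W p v) + Gam p v (W p).
Proof.
move=> [sW tW] /T10E[tz dz]; rewrite (nT10 Vp _ sW tW) cf_type10 //.
by rewrite scale0r addr0 p10_id.
Qed.

Lemma nablaGL_T10_T01 v W : T10_section phi V W -> T10 phi p v ->
  N p (conj_vec v) W = pi p (dvec W p (conj_vec v)).
Proof.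
move=> [sW tW] /T10E[tz dz]; rewrite (nT10 Vp _ sW tW) cf_conj_type10 //.
by rewrite scale0r addr0 p10_conj0 // (christoffel0l sphi spc xiP Vp) addr0.
Qed.

(** The bracket already lies in T_{1,0}, hence is its own projection and cancels the projected flat
    derivatives; the Christoffel terms cancel by symmetry. *)
Lemma torsion_T10_T10 Z W : T10_section phi V Z -> T10_section phi V W ->
  torsion D Z W p = 0.
Proof.
move=> hZ hW; have [sZ tZ tZ1 dZ] := T10_sectionP hZ.
have [sW tW tW1 dW] := T10_sectionP hW.
rewrite torsion_connGL // (nablaGL_T10_T10 hW (tZ p Vp)) (nablaGL_T10_T10 hZ (tW p Vp)).
have := proj10_id xi (bracket_T10 Vp sZ sW tZ1 tW1 dZ dW).
rewrite bracketE (proj10B xi sphi) (christoffel_sym sphi spc xiP Vp (W p)) => <-.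
move: (pi p _) (pi p _) (Gam _ _ _) => a b c.
by rewrite opprD addrACA subrr addr0 subrr.
Qed.

(** The connection removes the T_{1,0} and T_{0,1} components of the bracket. By [jet1_dvec] what
    survives is D2(Z, conj W) times conj xi - xi, which is iT, and D2 is 2L. *)
Lemma torsion_T10_T01 Z W : T10_section phi V Z -> T10_section phi V W ->
  torsion D Z (conj_field W) p =
  (2 * 'i%C * Ltheta phi p (Z p) (conj_field W p)) *: cplx (T p).
Proof.
move=> hZ hW; have [sZ tZ tZ1 dZ] := T10_sectionP hZ.
have [sW tW tW1 dW] := T10_sectionP hW.
rewrite torsion_connGL //; last exact: sJ.
rewrite (nablaGL_conj_field phi xi) -[conj_field W p]/(conj_vec (W p)).
rewrite (nablaGL_T10_T01 hW (tZ p Vp)) (nablaGL_T10_T01 hZ (tW p Vp)).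
rewrite (dvec_conj oV Vp _ sW) (Ltheta_T10 sphi p (tZ1 p Vp) (tW1 p Vp)).
have ty := type10_dvec oV Vp (conj_vec (Z p)) sW tW1.
have tz := type10_dvec oV Vp (conj_vec (W p)) sZ tZ1.
have ey := jet1_dvec sphi oV (conj_vec (Z p)) Vp sW dW.
have ez := jet1_dvec sphi oV (conj_vec (W p)) Vp sZ dZ.
have Ey := proj10_type10 phi xi p ty; have Ez := proj10_type10 phi xi p tz.
rewrite ey in Ey; rewrite ez (D2s p) in Ez.
rewrite {2}Ey {2}Ez conj_vecD conj_vecZ conjcN -D2J conj_vecK.
rewrite cplx_Tfield.
move: (conj_vec (pi p (dvec W p (conj_vec (Z p))))) => a.
move: (pi p (dvec Z p (conj_vec (W p)))) (D2 p (Z p) (conj_vec (W p))) => b c.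
move: (xib p) => d; move: (xi p) => e.
by apply/rowP => j; rewrite !mxE; field: (@iiC R).
Qed.

Let hxi1 q : V q -> type10 (xi q) := fun Vq => xi_type10 xiP Vq.
Let dxi1 q : V q -> D1 q (xi q) = 1 := fun Vq => jet1_xi sphi xiP Vq.

(** By [curv_identity], the projected derivative and Gamma(xi, W) together give [xi, W] + rW; the
    correction term, with del phi (xi) = 1, subtracts half of rW. *)
Lemma nablaGL_xi W : T10_section phi V W ->
  N p (xi p) W = dvec W p (xi p) - dvec xi p (W p) + (r p / 2) *: W p.
Proof.
move=> hW; have [sW tW tW1 dW] := T10_sectionP hW.
rewrite (nT10 Vp _ sW tW) (p10_xi xiP Vp) (p01_xi xiP Vp) (jet1_0 sphi) dxi1 // sub0r.
have tB : T10 phi p (dvec W p (xi p) - dvec xi p (W p)).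
  by rewrite -bracketE; exact: (bracket_T10 Vp sxi sW hxi1 tW1 dxi1 dW).
have -> : pi p (dvec W p (xi p)) + Gam p (xi p) (W p) =
    dvec W p (xi p) - dvec xi p (W p) + r p *: W p.
  apply: (T10_eq sphi spc Vp).
  - exact: (T10_D sphi (proj10_T10 sphi xiP Vp _) (christoffel_T10 sphi xiP Vp _ _)).
  - exact: (T10_D sphi tB (T10_Z sphi _ (tW p Vp))).
  move=> U tU; rewrite !D2Dl D2Zl (jet2Nl sphi) (christoffelP sphi spc xiP Vp _ _ tU).
  rewrite (jet2_proj10 sphi xiP Vp (type10_dvec oV Vp _ sW tW1) tU).
  rewrite -(curv_identity sphi oV xiP Vp (tW p Vp) tU).
  move: (D2 _ _ _) (D2 _ _ _) (D3 _ _ _ _) => a b c; ring.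
move: (dvec W p (xi p)) (dvec xi p (W p)) => a b; move: (W p) (r p) => c d.
by apply/rowP => j; rewrite !mxE; field.
Qed.

(** Here Gamma is absent because conj xi has no (1,0) part, and the flat derivative needs no
    projection: its D1 value is -D2(W, conj xi) = 0. *)
Lemma nablaGL_xib W : T10_section phi V W ->
  N p (xib p) W = dvec W p (xib p) + (r p / 2) *: W p.
Proof.
move=> hW; have [sW tW tW1 dW] := T10_sectionP hW.
rewrite (nT10 Vp _ sW tW) (p10_xib xiP Vp) (p01_xib xiP Vp) (jet1_0 sphi).
rewrite (jet1_xib sphi xiP Vp) subr0 mulr1 (christoffel0l sphi spc xiP Vp) addr0.
rewrite (proj10_id xi) //; apply/T10E; split; first exact: (type10_dvec oV Vp _ sW tW1).
rewrite (jet1_dvec sphi oV _ Vp sW dW) D2s (xi_orth' sphi xiP Vp (tW p Vp)).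
exact: oppr0.
Qed.

(** In T = i(xi - conj xi) the two summands r/2 W cancel and so do the derivatives of [W] and the
    derivative of xi; only the derivative of conj xi is left. In N = xi + conj xi the same summands
    add up to rW, which explains the form of the condition on N. *)
Lemma tau_T10 W : T10_section phi V W ->
  tau xi D W p = - 'i%C *: dvec (conj_field xi) p (W p).
Proof.
move=> hW; have [sW tW tW1 dW] := T10_sectionP hW.
rewrite /tau (torsion_connGL Vp sT sW) (nablaGL_Tfield sphi oV spc xiP _ Vp) subr0.
have -> : dvec (cfield T) p (W p) = 'i%C *: (dvec xi p (W p)
  - dvec (conj_field xi) p (W p)).
  rewrite -(dvecB oV Vp _ sxi sxib) -(dvecZc oV Vp _ _ (smooth_cfieldB oV sxi sxib)).
  by apply: (dvec_eq oV Vp) => q _; exact: cplx_Tfield.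
rewrite {1 2}/cfield cplx_Tfield (nablaGLZx sphi oV spc xiP Vp _ _ sW).
have -> : N p (xi p - xib p) W = N p (xi p) W - N p (xib p) W.
  rewrite (nablaGLDx sphi oV spc xiP Vp _ _ sW) -scaleN1r.
  by rewrite (nablaGLZx sphi oV spc xiP Vp _ _ sW) scaleN1r.
rewrite (dvecZv oV Vp _ _ sW) (dvecBv oV Vp _ _ sW) (nablaGL_xi hW) (nablaGL_xib hW).
move: (dvec W p (xi p)) (dvec W p (xib p)) => a b.
move: (dvec xi p (W p)) (dvec (conj_field xi) p (W p)) => c d.
move: (r p) (W p) => e f.
by apply/rowP => j; rewrite !mxE; ring.
Qed.

Lemma torsion_Nfield W : T10_section phi V W ->
  torsion D (cfield Nu) W p = r p *: W p + 'i%C *: tau xi D W p.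
Proof.
move=> hW; have [sW tW tW1 dW] := T10_sectionP hW.
rewrite tau_T10 // (torsion_connGL Vp sN sW)
  (nablaGL_Nfield sphi oV spc xiP _ Vp) subr0.
have -> : dvec (cfield Nu) p (W p) = dvec xi p (W p) + dvec (conj_field xi) p (W p).
  rewrite -(dvecD oV Vp _ sxi sxib).
  by apply: (dvec_eq oV Vp) => q _; exact: cplx_Nfield.
rewrite {1 2}/cfield cplx_Nfield (nablaGLDx sphi oV spc xiP Vp _ _ sW).
rewrite (dvecDv oV Vp _ _ sW) (nablaGL_xi hW) (nablaGL_xib hW).
move: (dvec W p (xi p)) (dvec W p (xib p)) => a b.
move: (dvec xi p (W p)) (dvec (conj_field xi) p (W p)) => c d.
move: (r p) (W p) => e f.
by by apply/rowP => j; rewrite !mxE; field: (@iiC R).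
Qed.

(** Up to a factor, the conjugate is the derivative of xi along conj W: it has type (1,0), and its
    D1 value is -D2(conj W, xi), which vanishes by the choice of xi. *)
Lemma tau_T01 W : T10_section phi V W -> T01 phi p (tau xi D W p).
Proof.
move=> hW; have [sW tW tW1 dW] := T10_sectionP hW.
rewrite /T01 tau_T10 // (dvec_xib oV xiP Vp) conj_vecZ conj_vecK; apply: (T10_Z sphi).
apply/T10E; split; first exact: (dvec_xi_type10 oV xiP Vp).
rewrite (jet1_dvec_xi sphi oV xiP Vp) D2s (xi_orth sphi xiP Vp (tW p Vp)).
exact: oppr0.
Qed.

(** Differentiate r = D2(xi, conj xi) along conj U, and D2(xi, conj Y) = 0 along conj xi for a
    section Y through U. Both contain D3(xi, conj xi, conj U) and the same multiple of r, so
    subtraction leaves one Hessian term. *)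
Lemma curv_derive U : T10 phi p U ->
  cderive r p (conj_vec U) = - D2 p (dvec xi p (xib p)) (conj_vec U).
Proof.
move=> tU; have [Y [sY tY YU]] := T10_extend sphi oV xiP tU.
have [tu du] := (T10E _ _ _).1 tU.
have -> : cderive r p (conj_vec U) =
    cderive (fun q => D2 q (xi q) (conj_field xi q)) p (conj_vec U).
  by apply: (cderive_eq oV) => // q Vq; exact: (curvE sphi xiP Vq).
rewrite (derive_jet2 sphi oV _ Vp sxi sxib) (dvec_xib oV xiP Vp) conj_vecK.
have txi v : type10 (dvec xi p v) by exact: (dvec_xi_type10 oV xiP Vp).
rewrite (jet2_xib sphi xiP Vp (txi _)) (jet2_xi_conj sphi xiP Vp (txi _)).
rewrite !(jet1_dvec_xi sphi oV xiP Vp) (D2s p (conj_vec U) (xi p)).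
rewrite (xi_orth sphi xiP Vp tU).
have := derive_jet2 sphi oV (xib p) Vp sxi (sJ sY).
have -> : cderive (fun q => D2 q (xi q) (conj_field Y q)) p (xib p) = 0.
  rewrite -(cderive_cst p 0 (xib p)); apply: (cderive_eq oV) => // q Vq.
  exact: (xi_orth sphi xiP Vq (tY q Vq)).
have tY1 q : V q -> type10 (Y q) by move=> Vq; case/T10E: (tY q Vq).
have dY q : V q -> D1 q (Y q) = 0 by move=> Vq; case/T10E: (tY q Vq).
rewrite -[conj_field Y p]/(conj_vec (Y p)) YU (dvec_conj oV Vp _ sY) conj_vecK.
rewrite (jet2_xi_conj sphi xiP Vp (type10_dvec oV Vp _ sY tY1)).
rewrite (jet1_dvec sphi oV _ Vp sY dY) YU (D2s p (xi p) U).
rewrite -[conj_field xi p]/(xib p) (jet3_sym12 sphi p (conj_vec U)).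
rewrite (jet3_sym23 sphi p (xi p)) (jet3_sym12 sphi p (xi p)).
rewrite (jet3_sym23 sphi p (xib p)).
move: (D3 p _ _ _) (D2 p _ _) ((- D2 p _ _)^*%C) (r p) => a b c d /eqP.
rewrite eq_sym => /eqP H; rewrite oppr0 mul0r addr0.
have -> : a = - b - c * d by apply/eqP; rewrite -subr_eq0 -H; apply/eqP; ring.
ring.
Qed.

End AtPoint.
End Torsion.

(** * The value of tau on N and the gradient of the transverse curvature *)

Section TauN.
Variables (R : realType) (n : nat) (phi : 'rV[R]_(n + n) -> R).
Variables (V : set 'rV[R]_(n + n)) (xi : 'rV[R]_(n + n) -> 'rV[R[i]]_(n + n)).
Let E : Type := 'rV[R]_(n + n).
Implicit Types (u v w x U : 'rV[R[i]]_(n + n)) (q : 'rV[R]_(n + n)).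
Implicit Types (X Y Z W : 'rV[R]_(n + n) -> 'rV[R[i]]_(n + n)).
Hypothesis sphi : smooth_on setT (phi : _ -> R^o).
Hypothesis oV : open V.
Hypothesis spc : forall p, V p -> spc_at phi p.
Hypothesis xiP : is_xi phi V xi.

Notation D1 := (jet1 phi).
Notation D2 := (jet2 phi).
Notation pi := (proj10 phi xi).
Notation xib q := (conj_vec (xi q)).
Notation r := (curv phi xi).
Notation sm := (smooth_cfield V).

Let D1D := jet1D sphi.
Let D1Z := jet1Z sphi.
Let D1J := jet1_conj sphi.
Let D2s := jet2_sym sphi.
Let D2Dl := jet2Dl sphi.
Let D2Zl := jet2Zl sphi.
Let D2Dr := jet2Dr sphi.
Let D2Zr := jet2Zr sphi.
Let sxi := smooth_xi xiP.

Notation T := (Tfield xi).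
Notation Nu := (Nfield xi).

Let sJ := smooth_cfield_conj oV.
Let sxib : sm (conj_field xi) := sJ sxi.
Let sT : sm (cfield T) := smooth_Tfield oV xiP.
Let sN : sm (cfield Nu) := smooth_Nfield oV xiP.

Notation gt := (gtheta phi xi).
Notation th := (theta phi).
Notation pH := (piH phi xi).

Lemma conjc_half : ((2 : R[i])^-1)^*%C = 2^-1.
Proof. by rewrite fmorphV rmorph_nat. Qed.
Lemma conjc_i : ('i%C : R[i])^*%C = - 'i%C.
Proof. by apply: complex_eq; rewrite /= ?oppr0. Qed.

Lemma theta_conj q v : th q (conj_vec v) = (th q v)^*%C.
Proof.
rewrite !(theta_jet sphi)
  p01_conj p10_conj !D1J !conjcM conjc_half conjc_i conjcD conjcN.
move: ((D1 q (p10 v))^*%C) ((D1 q (p01 v))^*%C) => a b; ring.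
Qed.
Lemma thetaD q v w : th q (v + w) = th q v + th q w.
Proof.
rewrite !(theta_jet sphi) p01D p10D !D1D.
move: (D1 q (p10 v)) (D1 q (p01 v)) (D1 q (p10 w)) (D1 q (p01 w)) => a b c d; ring.
Qed.
Lemma thetaZ q c v : th q (c *: v) = c * th q v.
Proof.
rewrite !(theta_jet sphi) p01Z p10Z !D1Z.
move: (D1 q (p10 v)) (D1 q (p01 v)) => a b; ring.
Qed.

Lemma piHD q v w : pH q (v + w) = pH q v + pH q w.
Proof. by rewrite /piH thetaD scalerDl opprD addrACA. Qed.
Lemma piHZ q c v : pH q (c *: v) = c *: pH q v.
Proof. by rewrite /piH thetaZ -scalerA -scalerBr. Qed.

Lemma gthetaD q u v w : gt q u (v + w) = gt q u v + gt q u w.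
Proof.
rewrite /gtheta piHD JvecD thetaD !(dtheta_jet sphi) p10D p01D D2Dl D2Dr.
move: (D2 q _ _) (D2 q _ _) (D2 q _ _) (D2 q _ _) (th q u) (th q v) (th q w) => *; ring.
Qed.
Lemma gthetaZ q c u v : gt q u (c *: v) = c * gt q u v.
Proof.
rewrite /gtheta piHZ JvecZ thetaZ !(dtheta_jet sphi) p10Z p01Z D2Zl D2Zr.
move: (D2 q _ _) (D2 q _ _) (th q u) (th q v) => *; ring.
Qed.

Lemma cplx_re_half v : cplx (re_vec v) = 2^-1 *: (v + conj_vec v).
Proof.
apply/rowP => a; rewrite !mxE; case: (v 0 a) => x y.
have -> : (x +i* y) + (x +i* y)^*%C = 2 * x%:C.
  by apply: complex_eq => /=; ring.
by rewrite mulrA mulVf ?mul1r // two_neq0.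
Qed.
Lemma cplx_im_half v : 'i%C *: cplx (im_vec v) = 2^-1 *: (v - conj_vec v).
Proof.
apply/rowP => a; rewrite !mxE; case: (v 0 a) => x y.
have -> : (x +i* y) - (x +i* y)^*%C = 2 * ('i%C * y%:C).
  by apply: complex_eq => /=; ring.
by rewrite [RHS]mulrA mulVf ?mul1r // two_neq0.
Qed.

Variable G : E -> E.
Hypothesis gradG : is_gradient phi xi V (curv phi xi) G.

Section AtPoint.
Variable p : 'rV[R]_(n + n).
Hypothesis Vp : V p.

(** The gradient is characterised on real tangent vectors of the leaf only. The real and imaginary
    parts of conj U are such vectors, and both sides are C-linear. *)
Lemma gradient_T01 U : T10 phi p U ->
  gt p (cplx (G p)) (conj_vec U) = cderive r p (conj_vec U).
Proof.
move=> /T10E[tu du]; have [_ gG] := gradG Vp; set v := conj_vec U.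
have dv : D1 p v = 0 by rewrite D1J du conjc0.
have cr := smooth_curv sphi oV xiP.
have d1 : dphi phi p (cplx (re_vec v)) = 0.
  by rewrite (dphi_jet phi) cplx_re_half D1Z D1D D1J dv conjc0 addr0; exact: mulr0.
have d2 : dphi phi p (cplx (im_vec v)) = 0.
  have : D1 p ('i%C *: cplx (im_vec v)) = 0.
    rewrite cplx_im_half D1Z D1D (jet1N sphi) D1J dv conjc0 oppr0 addr0; exact: mulr0.
  rewrite D1Z (dphi_jet phi) => /eqP; rewrite mulf_eq0 => /orP[/eqP|/eqP//].
  by move=> /(congr1 (@complex.Im R)) /= /eqP; rewrite oner_eq0.
rewrite (cplx_re_im v) gthetaD gthetaZ (gG _ d1) (gG _ d2).
by rewrite (cderiveDv Vp _ _ cr) (cderiveZv Vp _ _ cr).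
Qed.

Notation g := (pH p (cplx (G p))).

Lemma piH_grad_real : conj_vec g = g.
Proof. by rewrite /piH conj_vecB conj_vecZ -theta_conj !conj_cplx. Qed.

(** Tangency to the leaf makes the del and delbar values of the gradient opposite, so either of them
    is a multiple of theta; subtracting theta times T removes it. *)
Lemma jet1_p10_piH : D1 p (p10 g) = 0.
Proof.
have [+ _] := gradG Vp; rewrite (dphi_jet phi) jet1_split //.
rewrite /piH p10D p10N p10Z (p10_Tfield xiP Vp) (jet1B sphi) !D1Z (jet1_xi sphi xiP Vp).
rewrite (theta_jet sphi).
move: (D1 p _) (D1 p _) => a b /eqP; rewrite addr_eq0 => /eqP ->.
by field: (@iiC R).
Qed.

Lemma p10_piH : p10 g = pi p g.
Proof. by rewrite (p10_decomp phi xi p g) jet1_p10_piH scale0r addr0. Qed.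

(** On conj U, J is multiplication by -i, which turns d theta (., J conj U) into half of the
    Hessian. *)
Lemma jet2_piH U : T10 phi p U ->
  2^-1 * D2 p (pi p g) (conj_vec U) = cderive r p (conj_vec U).
Proof.
move=> tU; rewrite -(gradient_T01 tU); have [tu du] := (T10E _ _ _).1 tU.
have thU : th p (conj_vec U) = 0.
  by rewrite (theta_jet sphi) p01_conj_id // p10_conj0 // D1J du (jet1_0 sphi)
    conjc0 subrr; exact: mulr0.
rewrite /gtheta thU mulr0 addr0 [in pH p (conj_vec U)]/piH thU scale0r subr0.
rewrite Jvec_conj tu conj_vecZ conjc_i (dtheta_jet sphi)
  p01Z p10Z p01_conj_id // p10_conj0 //.
rewrite scaler0 (jet2_0l sphi) subr0 p10_piH D2Zr.
by move: (D2 p _ _) => a; field: (@iiC R).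
Qed.

(** Both sides pair equally with every conj U, by [jet2_piH] and [curv_derive]. The horizontal
    gradient of r is thus expressed by the flat derivative of xi along conj xi, the quantity that
    occurs in the bracket of T and N. *)
Lemma pi_piH : pi p g = -2 *: pi p (dvec xi p (xib p)).
Proof.
have tx := dvec_xi_type10 oV xiP Vp (xib p).
apply: (T10_eq sphi spc Vp).
- exact: (proj10_T10 sphi xiP Vp).
- exact: (T10_Z sphi _ (proj10_T10 sphi xiP Vp _)).
move=> U tU; rewrite D2Zl (jet2_proj10 sphi xiP Vp tx tU).
have := jet2_piH tU; rewrite (curv_derive sphi oV xiP Vp tU).
move: (D2 p _ _) (D2 p _ _) => a b H.
by apply: (mulfI (invr_neq0 (two_neq0 R))); rewrite H; field.
Qed.

Lemma Jvec_piH : Jvec g = 'i%C *: pi p g - 'i%C *: conj_vec (pi p g).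
Proof.
rewrite -{1}(p10_p01 g) JvecD Jvec_p10 Jvec_p01 p10_piH p01E piH_grad_real p10_piH.
by rewrite scaleNr.
Qed.

(** As T and N are parallel, tau(N) = -[T, N] = -2i [xi, conj xi]. The bracket is found from the
    flat derivative of xi along conj xi: its T_{1,0} component gives the gradient by [pi_piH], and
    its xi component is -r. *)
Lemma tau_Nfield : tau xi (connGL phi xi) (cfield Nu) p =
  - Jvec g - (2 * r p) *: cplx (T p).
Proof.
rewrite /tau (torsion_connGL sphi oV spc xiP Vp sT sN).
rewrite (nablaGL_Tfield sphi oV spc xiP _ Vp) (nablaGL_Nfield sphi oV spc xiP _ Vp).
rewrite subrr sub0r Jvec_piH pi_piH.
have dT v : dvec (cfield T) p v = 'i%C *: (dvec xi p v - dvec (conj_field xi) p v).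
  rewrite -(dvecB oV Vp _ sxi sxib) -(dvecZc oV Vp _ _ (smooth_cfieldB oV sxi sxib)).
  by apply: (dvec_eq oV Vp) => q _; exact: cplx_Tfield.
have dN v : dvec (cfield Nu) p v = dvec xi p v + dvec (conj_field xi) p v.
  rewrite -(dvecD oV Vp _ sxi sxib).
  by apply: (dvec_eq oV Vp) => q _; exact: cplx_Nfield.
have eT : cfield T p = 'i%C *: (xi p - xib p) by exact: cplx_Tfield.
have eN : cfield Nu p = xi p + xib p by exact: cplx_Nfield.
rewrite dT dN eT eN cplx_Tfield !(dvecZv oV Vp _ _ sxi) !(dvecZv oV Vp _ _ sxib).
rewrite !(dvecBv oV Vp _ _ sxi) !(dvecBv oV Vp _ _ sxib) !(dvecDv oV Vp _ _ sxi)
  !(dvecDv oV Vp _ _ sxib).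
rewrite !(dvec_xib oV xiP Vp) conj_vecK.
have tx := dvec_xi_type10 oV xiP Vp (xib p).
have := proj10_type10 phi xi p tx; rewrite (jet1_dvec_xi sphi oV xiP Vp) D2s.
rewrite -(curvE sphi xiP Vp).
have cr : conj_vec (- r p *: xi p) = - r p *: xib p.
  by rewrite conj_vecZ conjcN (curv_real sphi xiP Vp).
have c2 w : conj_vec (-2 *: w) = -2 *: conj_vec w.
  by rewrite conj_vecZ conjcN conjc_nat.
rewrite c2; move: (pi p (dvec xi p (xib p))) => f Ef; rewrite Ef conj_vecD cr.
move: (conj_vec f) (dvec xi p (xi p)) => f' a.
move: (conj_vec a) (xib p) (r p) => a' b c; move: (xi p) => d.
by apply/rowP => j; rewrite !mxE; field: (@iiC R).
Qed.

End AtPoint.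

Lemma connGL_graham_lee : graham_lee_connection phi V xi G (connGL phi xi).
Proof.
split.
- exact: (connGL_is_connection sphi oV spc xiP).
- exact: (T10_parallel_connGL sphi oV spc xiP).
- split; first exact: (L_parallel_connGL sphi oV spc xiP).
    exact: (field_parallel_Tfield sphi oV spc xiP).
  exact: (field_parallel_Nfield sphi oV spc xiP).
split.
- by move=> Z W hZ hW p Vp; exact: (torsion_T10_T10 sphi oV spc xiP Vp).
- by move=> Z W hZ hW p Vp; exact: (torsion_T10_T01 sphi oV spc xiP Vp).
- by move=> W hW p Vp; exact: (torsion_Nfield sphi oV spc xiP Vp).
- by move=> W hW p Vp; exact: (tau_T01 sphi oV spc xiP Vp).
exact: tau_Nfield.
Qed.

End TauN.

(** * Uniqueness *)

Section Tensoriality.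
Variables (R : realType) (n : nat) (V : set 'rV[R]_(n + n)) (p : 'rV[R]_(n + n)).
Hypothesis oV : open V.
Let E : Type := 'rV[R]_(n + n).
Notation sm := (smooth_field V).

Lemma smooth_field_cst (x : E) : sm (fun=> x).
Proof. by move=> k; exact: Ck_cst. Qed.

(** The constant coordinate fields form a smooth frame over all of [V], so linearity over functions
    gives at once a value that depends only on X p. *)
Lemma tensorial (L : (E -> E) -> E) :
  (forall X Y, sm X -> sm Y -> L (fun q => X q + Y q) = L X + L Y) ->
  (forall (f : E -> R^o) X, smooth_on V f -> sm X ->
    L (fun q => f q *: X q) = f p *: L X) ->
  forall X, sm X -> L X = L (fun=> X p).
Proof.
move=> LD LZ.
have sZ (f : E -> R^o) (x : E) : smooth_on V f -> sm (fun q => f q *: x).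
  move=> sf; apply/(smooth_rowP oV) => a k.
  apply: Ck_eq (CkM oV (sf k) (Ck_cst oV k (x 0 a : R^o))) => // q _.
  by rewrite mxE.
have L0 : L (fun=> 0) = 0.
  have H := LZ (fun=> 0) (fun=> 0) (fun k => Ck_cst oV k _) (smooth_field_cst 0).
  by move: H; rewrite !scale0r.
have Lsum (f : 'I_(n + n) -> E -> R^o) (r : seq 'I_(n + n)) :
    (forall a, smooth_on V (f a)) ->
    sm (fun q => \sum_(a <- r) f a q *: delta_mx 0 a) /\
    L (fun q => \sum_(a <- r) f a q *: delta_mx 0 a) =
    \sum_(a <- r) f a p *: L (fun=> delta_mx 0 a).
  move=> sf; elim: r => [|a r [IHs IHL]].
    rewrite big_nil; split.
      have -> : (fun q : E => \sum_(a <- [::]) f a q *: delta_mx 0 a) = fun=> 0 :> E.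
        by apply: funext => q; rewrite big_nil.
      exact: smooth_field_cst.
    by rewrite -[RHS]L0; congr L; apply: funext => q; rewrite big_nil.
  have -> : (fun q => \sum_(b <- a :: r) f b q *: delta_mx 0 b) =
      fun q => f a q *: delta_mx 0 a + \sum_(b <- r) f b q *: delta_mx 0 b :> E.
    by apply: funext => q; rewrite big_cons.
  have sa := sZ (f a) (delta_mx 0 a) (sf a).
  split; first by move=> k; exact: (CkD oV (sa k) (IHs k)).
  by rewrite LD // IHL big_cons (LZ (f a) (fun=> delta_mx 0 a) (sf a)
    (smooth_field_cst _)).
have LE X : sm X -> L X = \sum_a X p 0 a *: L (fun=> delta_mx 0 a).
  move=> sX; have sXa a : smooth_on V (fun q => X q 0 a : R^o).
    exact: ((smooth_rowP oV _).1 sX a).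
  rewrite -(Lsum (fun a q => X q 0 a) (index_enum _) sXa).2; congr L.
  by apply: funext => q; rewrite [LHS]row_sum_delta.
move=> X sX; rewrite LE // [RHS]LE //; exact: smooth_field_cst.
Qed.

End Tensoriality.

(** * The difference tensor of two connections and its complex extension *)

HB.lock Definition diff_tensor (R : realType) (n : nat) (p : 'rV[R]_(n + n))
    (Da Db : ('rV[R]_(n + n) -> 'rV[R]_(n + n)) ->
      ('rV[R]_(n + n) -> 'rV[R]_(n + n)) -> 'rV[R]_(n + n) -> 'rV[R]_(n + n))
    (x y : 'rV[R]_(n + n)) : 'rV[R]_(n + n) :=
  Da (fun=> x) (fun=> y) p - Db (fun=> x) (fun=> y) p.

HB.lock Definition diff_ctensor (R : realType) (n : nat) (p : 'rV[R]_(n + n))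
    (Da Db : ('rV[R]_(n + n) -> 'rV[R]_(n + n)) ->
      ('rV[R]_(n + n) -> 'rV[R]_(n + n)) -> 'rV[R]_(n + n) -> 'rV[R]_(n + n))
    (x y : 'rV[R[i]]_(n + n)) : 'rV[R[i]]_(n + n) :=
  let B := diff_tensor p Da Db in
  cplx (B (re_vec x) (re_vec y) - B (im_vec x) (im_vec y)) +
  'i%C *: cplx (B (re_vec x) (im_vec y) + B (im_vec x) (re_vec y)).

Section DifferenceTensor.
Variables (R : realType) (n : nat) (V : set 'rV[R]_(n + n)) (p : 'rV[R]_(n + n)).
Hypothesis oV : open V.
Hypothesis Vp : V p.
Let E : Type := 'rV[R]_(n + n).
Variables (Da Db : (E -> E) -> (E -> E) -> (E -> E)).
Hypothesis Ca : is_connection V Da.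
Hypothesis Cb : is_connection V Db.
Notation sm := (smooth_cfield V).

Notation B := (diff_tensor p Da Db).

(** Tensoriality is used in each slot separately; in the second one the derivative terms of the two
    Leibniz rules are equal and cancel. *)
Lemma diff_tensorE (X Y : 'rV[R]_(n + n) -> 'rV[R]_(n + n))
  : smooth_field V X -> smooth_field V Y ->
  Da X Y p - Db X Y p = B (X p) (Y p).
Proof.
case: Ca => [_ aDX aDY aZX aZY]; case: Cb => [_ bDX bDY bZX bZY].
move=> sX sY; rewrite diff_tensor.unlock.
rewrite (@tensorial _ _ V p oV (fun X => Da X Y p - Db X Y p)) //; first last.
- by move=> f X' sf sX'; rewrite aZX // bZX // scalerBr.
- by move=> X' X'' sX' sX''; rewrite aDX // bDX // opprD addrACA.
have sx := smooth_field_cst oV (X p).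
rewrite (@tensorial _ _ V p oV (fun Y => Da (fun=> X p) Y p - Db (fun=> X p) Y p)) //.
  by move=> Y' Y'' sY' sY''; rewrite aDY // bDY // opprD addrACA.
by move=> f Y' sf sY'; rewrite aZY // bZY // opprD addrACA subrr add0r scalerBr.
Qed.

Let sc (x : E) : smooth_field V (fun=> x) := smooth_field_cst oV x.

Lemma diff_tensorDl (x y z : 'rV[R]_(n + n)) : B (x + y) z = B x z + B y z.
Proof.
case: Ca => [_ aDX aDY aZX aZY]; case: Cb => [_ bDX bDY bZX bZY].
by rewrite diff_tensor.unlock (aDX _ _ _ (sc x) (sc y) (sc z))
  // (bDX _ _ _ (sc x) (sc y) (sc z)) // opprD addrACA.
Qed.
Lemma diff_tensorDr (x y z : 'rV[R]_(n + n)) : B z (x + y) = B z x + B z y.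
Proof.
case: Ca => [_ aDX aDY aZX aZY]; case: Cb => [_ bDX bDY bZX bZY].
by rewrite diff_tensor.unlock (aDY _ _ _ (sc z) (sc x) (sc y))
  // (bDY _ _ _ (sc z) (sc x) (sc y)) // opprD addrACA.
Qed.
Lemma diff_tensorZl (c : R) (x y : 'rV[R]_(n + n)) : B (c *: x) y = c *: B x y.
Proof.
case: Ca => [_ aDX aDY aZX aZY]; case: Cb => [_ bDX bDY bZX bZY].
have scc : smooth_on V (fun=> c : R^o) by move=> k; exact: Ck_cst.
by rewrite diff_tensor.unlock (aZX _ _ _ scc (sc x) (sc y))
  // (bZX _ _ _ scc (sc x) (sc y)) // scalerBr.
Qed.
Lemma diff_tensorZr (c : R) (x y : 'rV[R]_(n + n)) : B x (c *: y) = c *: B x y.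
Proof.
case: Ca => [_ aDX aDY aZX aZY]; case: Cb => [_ bDX bDY bZX bZY].
have scc : smooth_on V (fun=> c : R^o) by move=> k; exact: Ck_cst.
rewrite diff_tensor.unlock (aZY _ _ _ scc (sc x) (sc y)) // (bZY _ _ _ scc (sc x)
  (sc y)) //.
by rewrite opprD addrACA subrr add0r scalerBr.
Qed.

Notation BC := (diff_ctensor p Da Db).

Lemma diff_ctensorE (X Y : 'rV[R]_(n + n) -> 'rV[R[i]]_(n + n)) : sm X -> sm Y ->
  nablaC Da X Y p - nablaC Db X Y p = BC (X p) (Y p).
Proof.
move=> [sXr sXi] [sYr sYi]; rewrite /nablaC diff_ctensor.unlock /=.
have [e1 e2] := (diff_tensorE sXr sYr, diff_tensorE sXi sYi).
have [e3 e4] := (diff_tensorE sXr sYi, diff_tensorE sXi sYr).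
rewrite -[B (re_vec (X p)) (re_vec (Y p))]e1 -[B (im_vec (X p)) (im_vec (Y p))]e2.
rewrite -[B (re_vec (X p)) (im_vec (Y p))]e3 -[B (im_vec (X p)) (re_vec (Y p))]e4.
rewrite !(cplxD, cplxN).
move: (cplx (Da (re_field X) (re_field Y) p)) (cplx (Da (im_field X) (im_field Y)
  p)) => a b.
move: (cplx (Da (re_field X) (im_field Y) p)) (cplx (Da (im_field X) (re_field Y)
  p)) => c d.
move: (cplx (Db (re_field X) (re_field Y) p)) (cplx (Db (im_field X) (im_field Y)
  p)) => e f.
move: (cplx (Db (re_field X) (im_field Y) p)) (cplx (Db (im_field X) (re_field Y)
  p)) => g h.
by apply/rowP => j; rewrite !mxE; ring.
Qed.

Lemma diff_ctensorDl (x y z : 'rV[R[i]]_(n + n)) : BC (x + y) z = BC x z + BC y z.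
Proof.
rewrite diff_ctensor.unlock /= !re_vecD !im_vecD !diff_tensorDl !cplxD !cplxN.
rewrite !cplxD.
move: (cplx (B (re_vec x) (re_vec z))) (cplx (B (im_vec x) (im_vec z))) => a b.
move: (cplx (B (re_vec x) (im_vec z))) (cplx (B (im_vec x) (re_vec z))) => c d.
move: (cplx (B (re_vec y) (re_vec z))) (cplx (B (im_vec y) (im_vec z))) => e f.
move: (cplx (B (re_vec y) (im_vec z))) (cplx (B (im_vec y) (re_vec z))) => g h.
by apply/rowP => j; rewrite !mxE; ring.
Qed.
Lemma diff_ctensorDr (x y z : 'rV[R[i]]_(n + n)) : BC z (x + y) = BC z x + BC z y.
Proof.
rewrite diff_ctensor.unlock /= !re_vecD !im_vecD !diff_tensorDr !cplxD !cplxN.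
rewrite !cplxD.
move: (cplx (B (re_vec z) (re_vec x))) (cplx (B (im_vec z) (im_vec x))) => a b.
move: (cplx (B (re_vec z) (im_vec x))) (cplx (B (im_vec z) (re_vec x))) => c d.
move: (cplx (B (re_vec z) (re_vec y))) (cplx (B (im_vec z) (im_vec y))) => e f.
move: (cplx (B (re_vec z) (im_vec y))) (cplx (B (im_vec z) (re_vec y))) => g h.
by apply/rowP => j; rewrite !mxE; ring.
Qed.

Lemma diff_ctensorZl (c : R[i]) (x y : 'rV[R[i]]_(n + n)) : BC (c *: x) y = c *: BC x y.
Proof.
have BN (u v : 'rV[R]_(n + n)) : B (- u)
  v = - B u v by rewrite -scaleN1r diff_tensorZl scaleN1r.
rewrite diff_ctensor.unlock /= !re_vecZ !im_vecZ !diff_tensorDl !BN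
  !diff_tensorZl !(cplxD, cplxN, cplxZ).
move: (cplx (B (re_vec x) (re_vec y))) (cplx (B (im_vec x) (im_vec y))) => a b.
move: (cplx (B (re_vec x) (im_vec y))) (cplx (B (im_vec x) (re_vec y))) => e d.
rewrite [c in RHS](complexE c); move: (complex.Re c)%:C (complex.Im c)%:C => s t.
by apply/rowP => j; rewrite !mxE; ring: (@iiC R).
Qed.
Lemma diff_ctensorZr (c : R[i]) (x y : 'rV[R[i]]_(n + n)) : BC x (c *: y) = c *: BC x y.
Proof.
have BN (u v : 'rV[R]_(n + n)) : B u (- v)
  = - B u v by rewrite -scaleN1r diff_tensorZr scaleN1r.
rewrite diff_ctensor.unlock /= !re_vecZ !im_vecZ !diff_tensorDr !BN
  !diff_tensorZr !(cplxD, cplxN, cplxZ).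
move: (cplx (B (re_vec x) (re_vec y))) (cplx (B (im_vec x) (im_vec y))) => a b.
move: (cplx (B (re_vec x) (im_vec y))) (cplx (B (im_vec x) (re_vec y))) => e d.
rewrite [c in RHS](complexE c); move: (complex.Re c)%:C (complex.Im c)%:C => s t.
by apply/rowP => j; rewrite !mxE; ring: (@iiC R).
Qed.

Lemma diff_ctensor_conj (x y : 'rV[R[i]]_(n + n)) : BC (conj_vec x) (conj_vec y)
  = conj_vec (BC x y).
Proof.
have BNl (u v : 'rV[R]_(n + n)) : B (- u)
  v = - B u v by rewrite -scaleN1r diff_tensorZl scaleN1r.
have BNr (u v : 'rV[R]_(n + n)) : B u (- v)
  = - B u v by rewrite -scaleN1r diff_tensorZr scaleN1r.
have ciN : ('i%C : R[i])^*%C = - 'i%C by apply: complex_eq; rewrite /= ?oppr0.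
rewrite diff_ctensor.unlock /= !re_conj !im_conj !BNl !BNr conj_vecD conj_vecZ
  !conj_cplx opprK.
by rewrite ciN -opprD cplxN scalerN scaleNr.
Qed.

Lemma diff_ctensor_cplx (x y : 'rV[R]_(n + n)) : BC (cplx x) (cplx y) = cplx (B x y).
Proof.
have B0l (z : 'rV[R]_(n + n)) : B 0 z = 0 by rewrite -(scale0r 0)
  diff_tensorZl !scale0r.
have B0r (z : 'rV[R]_(n + n)) : B z 0 = 0 by rewrite -(scale0r 0)
  diff_tensorZr !scale0r.
rewrite diff_ctensor.unlock /= !re_cplx !im_cplx !B0l !B0r subr0 addr0.
have -> : cplx (0 : E) = 0 by apply/rowP => a; rewrite !mxE.
by rewrite scaler0 addr0.
Qed.

Lemma diff_ctensor_re_im (x y : 'rV[R[i]]_(n + n)) :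
  BC x y = BC (cplx (re_vec x)) y + 'i%C *: BC (cplx (im_vec x)) y.
Proof. by rewrite -diff_ctensorZl -diff_ctensorDl -cplx_re_im. Qed.

End DifferenceTensor.

(** * Vanishing of the difference tensor *)

Section Uniqueness.
Variables (R : realType) (n : nat) (phi : 'rV[R]_(n + n) -> R).
Variables (V : set 'rV[R]_(n + n)) (xi : 'rV[R]_(n + n) -> 'rV[R[i]]_(n + n)).
Let E : Type := 'rV[R]_(n + n).
Implicit Types (u v w x U : 'rV[R[i]]_(n + n)) (q : 'rV[R]_(n + n)).
Implicit Types (X Y Z W : 'rV[R]_(n + n) -> 'rV[R[i]]_(n + n)).
Hypothesis sphi : smooth_on setT (phi : _ -> R^o).
Hypothesis oV : open V.
Hypothesis spc : forall p, V p -> spc_at phi p.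
Hypothesis xiP : is_xi phi V xi.

Notation D2 := (jet2 phi).
Notation xib q := (conj_vec (xi q)).
Notation sm := (smooth_cfield V).

Let D2Dl := jet2Dl sphi.
Let D2Zl := jet2Zl sphi.
Let D2Dr := jet2Dr sphi.
Let D2Zr := jet2Zr sphi.

Notation T := (Tfield xi).
Notation Nu := (Nfield xi).

Variables (G : E -> E) (Da Db : (E -> E) -> (E -> E) -> (E -> E)).
Hypothesis GLa : graham_lee_connection phi V xi G Da.
Hypothesis GLb : graham_lee_connection phi V xi G Db.

Section AtPoint.
Variable p : 'rV[R]_(n + n).
Hypothesis Vp : V p.

Let Ca : is_connection V Da. Proof. by case: GLa. Qed.
Let Cb : is_connection V Db. Proof. by case: GLb. Qed.
Notation B := (diff_tensor p Da Db).
Notation BC := (diff_ctensor p Da Db).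
Let sc (x : E) : smooth_field V (fun=> x) := smooth_field_cst oV x.
Let BE := diff_tensorE oV Vp Ca Cb.
Let BCE := diff_ctensorE oV Vp Ca Cb.
Let BCDl := diff_ctensorDl oV Vp Ca Cb.
Let BCDr := diff_ctensorDr oV Vp Ca Cb.
Let BCZl := diff_ctensorZl oV Vp Ca Cb.
Let BCZr := diff_ctensorZr oV Vp Ca Cb.
Let BCJ := diff_ctensor_conj oV Vp Ca Cb.
Let BCc := diff_ctensor_cplx oV Vp Ca Cb.
Let BCri := diff_ctensor_re_im oV Vp Ca Cb.

(** The bracket is common to both torsions, so equal torsions mean a symmetric difference tensor. *)
Lemma torsion_diff X Y : sm X -> sm Y ->
  torsion Da X Y p - torsion Db X Y p = BC (X p) (Y p) - BC (Y p) (X p).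
Proof.
move=> sX sY; rewrite /torsion -!BCE //.
move: (nablaC Da X Y p) (nablaC Da Y X p) (nablaC Db X Y p) (nablaC Db Y X p)
  (bracket X Y p) => a b c d e.
by apply/rowP => j; rewrite !mxE; ring.
Qed.

Let sT : sm (cfield T) := smooth_Tfield oV xiP.
Let sN : sm (cfield Nu) := smooth_Nfield oV xiP.
Let sTr : smooth_field V T := (smooth_fieldP oV T).2 sT.
Let sNr : smooth_field V Nu := (smooth_fieldP oV Nu).2 sN.

Lemma diff_ctensor_real_parallel x (Y : E -> E) : smooth_field V Y ->
  field_parallel V Da Y -> field_parallel V Db Y -> BC x (cplx (Y p)) = 0.
Proof.
move=> sY pa pb; have B0 (z : E) : B z (Y p) = 0.
  by rewrite -(BE (sc z) sY) (pa _ (sc z) p Vp) (pb _ (sc z) p Vp) subrr.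
rewrite BCri !BCc !B0.
have -> : cplx (0 : E) = 0 by apply/rowP => a; rewrite !mxE.
by rewrite scaler0 addr0.
Qed.

Lemma diff_ctensor_T x : BC x (cplx (T p)) = 0.
Proof.
case: GLa => [_ _ [_ pa _] _]; case: GLb => [_ _ [_ pb _] _].
exact: (diff_ctensor_real_parallel x sTr pa pb).
Qed.
Lemma diff_ctensor_N x : BC x (cplx (Nu p)) = 0.
Proof.
case: GLa => [_ _ [_ _ pa] _]; case: GLb => [_ _ [_ _ pb] _].
exact: (diff_ctensor_real_parallel x sNr pa pb).
Qed.

Lemma xi_NT : xi p = 2^-1 *: cplx (Nu p) - ('i%C / 2) *: cplx (T p).
Proof.
rewrite cplx_Tfield cplx_Nfield; move: (xib p) => a; move: (xi p) => b.
by apply/rowP => j; rewrite !mxE; field: (@iiC R).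
Qed.
Lemma xib_NT : xib p = 2^-1 *: cplx (Nu p) + ('i%C / 2) *: cplx (T p).
Proof.
rewrite cplx_Tfield cplx_Nfield; move: (xib p) => a; move: (xi p) => b.
by apply/rowP => j; rewrite !mxE; field: (@iiC R).
Qed.

Lemma T10_extendS z : T10 phi p z -> exists Y, T10_section phi V Y /\ Y p = z.
Proof. by move=> /(T10_extend sphi oV xiP)[Y [sY tY Yz]]; exists Y. Qed.

Lemma T10_T01_eq0 v : T10 phi p v -> T10 phi p (conj_vec v) -> v = 0.
Proof.
move=> /T10E[tv _] /T10E[tcv _]; rewrite -(conj_vecK v) -(p01_conj_id tv).
by rewrite p01_0P // conj_vec0.
Qed.

Lemma diff_ctensor_T10 x z : T10 phi p z -> T10 phi p (BC x z).
Proof.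
move=> /T10_extendS[Z [hZ <-]]; have [sZ _] := hZ.
have real (y : E) : T10 phi p (BC (cplx y) (Z p)).
  have -> : cplx y = cfield (fun=> y) p by [].
  rewrite -(BCE ((smooth_fieldP oV _).1 (sc y)) sZ).
  case: GLa => [_ pa _ _]; case: GLb => [_ pb _ _].
  exact: (T10_B sphi ((pa _ _ (sc y) hZ).2 p Vp) ((pb _ _ (sc y) hZ).2 p Vp)).
rewrite BCri; exact: (T10_D sphi (real _) (T10_Z sphi _ (real _))).
Qed.

(** The prescribed torsion makes the tensor symmetric on this pair. One order of the arguments has
    its value in T_{1,0}, the other in T_{0,1}, and these meet only in zero. *)
Lemma diff_ctensor_T01_T10 w z : T10 phi p w -> T10 phi p z ->
  BC (conj_vec w) z = 0.
Proof.
move=> tw tz; have sym : BC z (conj_vec w) = BC (conj_vec w) z.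
  have [Z [hZ EZ]] := T10_extendS tz; have [W [hW EW]] := T10_extendS tw.
  have sW := smooth_cfield_conj oV hW.1.
  have := torsion_diff hZ.1 sW.
  case: GLa => [_ _ _ [_ ta _ _ _]]; case: GLb => [_ _ _ [_ tb _ _ _]].
  rewrite (ta _ _ hZ hW p Vp) (tb _ _ hZ hW p Vp) subrr /conj_field EZ EW.
  by move/esym/eqP; rewrite subr_eq0 => /eqP.
apply: T10_T01_eq0; first exact: diff_ctensor_T10.
by rewrite -sym -BCJ conj_vecK; exact: diff_ctensor_T10.
Qed.

(** Since T is parallel, the difference of the two tau values is the tensor on (T, z): it lies in
    T_{0,1} by the condition on tau and in T_{1,0} by parallelism. The torsion condition on N
    expresses the tensor on (N, z) as i times it. *)
Lemma diff_ctensor_NT_T10 z : T10 phi p z ->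
  BC (cplx (T p)) z = 0 /\ BC (cplx (Nu p)) z = 0.
Proof.
move=> tz; have [Z [hZ EZ]] := T10_extendS tz; have sZ := hZ.1.
have tauE : tau xi Da Z p - tau xi Db Z p = BC (cplx (T p)) z.
  by rewrite /tau (torsion_diff sT sZ) EZ diff_ctensor_T subr0.
have := torsion_diff sN sZ; rewrite EZ diff_ctensor_N subr0.
case: GLa => [_ _ _ [_ _ ta ta' _]]; case: GLb => [_ _ _ [_ _ tb tb' _]].
rewrite (ta _ hZ p Vp) (tb _ hZ p Vp) opprD addrACA subrr add0r -scalerBr tauE.
have BT0 : BC (cplx (T p)) z = 0.
  apply: T10_T01_eq0; first exact: diff_ctensor_T10.
  by rewrite -tauE conj_vecB; exact: (T10_B sphi (ta' _ hZ p Vp) (tb' _ hZ p Vp)).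
by rewrite BT0 scaler0 => <-.
Qed.

(** Subtracting the two conditions nabla L = 0 removes the derivative of L, which does not involve
    the connection. Real x come directly from the condition, complex x by linearity. *)
Lemma diff_ctensor_L x z w : T10 phi p z -> T10 phi p w ->
  D2 p (BC x z) (conj_vec w) + D2 p z (BC x (conj_vec w)) = 0.
Proof.
move=> tz tw; have [Z [hZ EZ]] := T10_extendS tz; have [W [hW EW]] := T10_extendS tw.
have sZ := hZ.1; have sW := hW.1; have sWb := smooth_cfield_conj oV sW.
have [twt _] := (T10E _ _ _).1 tw; have [tzt _] := (T10E _ _ _).1 tz.
have real (y : E) : D2 p (BC (cplx y) z) (conj_vec w) + D2 p z (BC (cplx y)
  (conj_vec w)) = 0.
  have sy := (smooth_fieldP oV _).1 (sc y).
  case: GLa => [_ pa [la _ _] _]; case: GLb => [_ pb [lb _ _] _].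
  have := la _ _ _ (sc y) hZ hW p Vp; have := lb _ _ _ (sc y) hZ hW p Vp.
  have Lz v : type10 v -> Ltheta phi p v (conj_vec w) = 2^-1 * D2 p v (conj_vec w).
    by move=> tv; exact: Ltheta_T10.
  have Lw v : Ltheta phi p z v = 2^-1 * D2 p z (p01 v).
    rewrite (Ltheta_jet sphi) (p10_id tzt) (p01_0P tzt) (jet2_0r sphi) subr0 //.
  have BCz : BC (cplx y) z = nablaC Da (cfield (fun=> y))
    Z p - nablaC Db (cfield (fun=> y)) Z p.
    by rewrite (BCE sy sZ) EZ.
  have BCw : BC (cplx y) (conj_vec w) =
      nablaC Da (cfield (fun=> y)) (conj_field W)
        p - nablaC Db (cfield (fun=> y)) (conj_field W) p.
    by rewrite (BCE sy sWb) /conj_field EW.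
  (* By reality the tensor maps T_{0,1} to itself, so the projection that the Levi form applies to
     its second argument is harmless. *)
  have tBw : p01 (BC (cplx y) (conj_vec w)) = BC (cplx y) (conj_vec w).
    rewrite -(conj_vecK (BC _ _)) -BCJ conj_vecK; apply: p01_conj_id.
    by have [] := (T10E _ _ _).1 (diff_ctensor_T10 (conj_vec (cplx y)) tw).
  have [t1 _] := (T10E _ _ _).1 ((pa _ _ (sc y) hZ).2 p Vp).
  have [t2 _] := (T10E _ _ _).1 ((pb _ _ (sc y) hZ).2 p Vp).
  rewrite EZ [conj_field W p]/(conj_vec (W p)) EW (Lz _ t1) (Lz _ t2) !Lw.
  rewrite -tBw BCw BCz p01D p01N (jet2Bl sphi) D2Dr -(scaleN1r (p01 _)) D2Zr mulN1r.
  move: (cderive _ p _) (D2 p _ _) (D2 p _ _) (D2 p _ _) (D2 p _ _) => a b c d e H1 H2.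
  apply: (mulfI (invr_neq0 (two_neq0 R))); rewrite mulr0.
  have -> : 2^-1 * (c - e + (b - d)) =
    (a - 2^-1 * e - 2^-1 * d) - (a - 2^-1 * c - 2^-1 * b) by ring.
  by rewrite H1 H2 subrr.
rewrite (BCri x z) (BCri x (conj_vec w)) D2Dl D2Dr D2Zl D2Zr.
by rewrite addrACA -mulrDr !real mulr0 addr0.
Qed.

(** Let u be the value in question and test the Levi condition against u itself. The second term
    contains the conjugate of the tensor on (conj w, u), already known to vanish, so D2(u, conj u) =
    0 and definiteness gives u = 0. *)
Lemma diff_ctensor_T10_T10 w z : T10 phi p w -> T10 phi p z -> BC w z = 0.
Proof.
move=> tw tz; apply: (T10_nondeg sphi spc Vp); first exact: diff_ctensor_T10.
have tu := diff_ctensor_T10 w tz.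
have := diff_ctensor_L w tz tu.
have -> : BC w (conj_vec (BC w z)) = conj_vec (BC (conj_vec w) (BC w z)).
  by rewrite -[RHS]BCJ conj_vecK.
by rewrite (diff_ctensor_T01_T10 tw tu) conj_vec0 (jet2_0r sphi) addr0.
Qed.

Lemma diff_ctensor_vanish_T10 x z : T10 phi p z -> BC x z = 0.
Proof.
move=> tz; rewrite (frame_decomp xi sphi p x) !BCDl !BCZl.
have [BT BN] := diff_ctensor_NT_T10 tz.
rewrite (diff_ctensor_T10_T10 (proj10_T10 sphi xiP Vp _) tz).
rewrite (diff_ctensor_T01_T10 (proj10_T10 sphi xiP Vp _) tz).
rewrite xib_NT xi_NT !BCDl -scaleNr !BCZl BT BN.
by rewrite !scaler0 !addr0 !scaler0 !addr0.
Qed.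

(** Decompose the second argument: its T_{0,1} component follows from the T_{1,0} one by reality of
    the tensor, and xi and conj xi are combinations of the parallel fields N and T. *)
Lemma diff_ctensor_vanish x y : BC x y = 0.
Proof.
rewrite (frame_decomp xi sphi p y) !BCDr !BCZr.
rewrite (diff_ctensor_vanish_T10 x (proj10_T10 sphi xiP Vp _)).
rewrite -{1}(conj_vecK x) BCJ.
rewrite (diff_ctensor_vanish_T10 _ (proj10_T10 sphi xiP Vp _)) conj_vec0.
rewrite xib_NT xi_NT !BCDr -scaleNr !BCZr diff_ctensor_T diff_ctensor_N.
by rewrite !scaler0 !addr0 !scaler0 !addr0.
Qed.

Lemma graham_lee_unique (X Y : E -> E) : smooth_field V X -> smooth_field V Y ->
  Da X Y p = Db X Y p.
Proof.
move=> sX sY; apply: subr0_eq; rewrite BE //; apply: cplx_inj.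
rewrite -BCc diff_ctensor_vanish.
by apply/rowP => a; rewrite !mxE.
Qed.

End AtPoint.
End Uniqueness.

Theorem theorem4 (R : realType) (n : nat)
    (phi : 'rV[R]_(n + n) -> R) (V : set 'rV[R]_(n + n))
    (xi : 'rV[R]_(n + n) -> 'rV[R[i]]_(n + n))
    (gradr : 'rV[R]_(n + n) -> 'rV[R]_(n + n)) :
  smoothly_bounded_spc_domain phi ->
  foliated_one_sided_nbhd phi V ->
  is_xi phi V xi ->
  is_gradient phi xi V (curv phi xi) gradr ->
  (exists D, graham_lee_connection phi V xi gradr D) /\
  (forall D D',
     graham_lee_connection phi V xi gradr D ->
     graham_lee_connection phi V xi gradr D' ->
     forall X Y, smooth_field V X -> smooth_field V Y ->
     forall p, V p -> D X Y p = D' X Y p).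
Proof.
move=> [sphi _ _ _] [[U [oU _ VU]] VP] xiP gradP.
have spc p : V p -> spc_at phi p by move=> /VP[].
have cphi : continuous (phi : 'rV[R]_(n + n) -> R^o).
  by move=> q; exact: (sphi 0%N).
have oV : open V.
  rewrite VU; apply: openI => //.
  exact: (open_comp (fun q _ => cphi q) (@open_lt R 0)).
split; first by exists (connGL phi xi); exact: connGL_graham_lee.
move=> D D' GL GL' X Y sX sY p Vp.
exact: (graham_lee_unique sphi oV spc xiP GL GL').
Qed.
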